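(* Let $1\le i\le n$, let $w\in W^i$, let $w_0$ be the minimal length representative in $W^i$ of the class of the longest element of $W$, put $\tau=ww_0^{-1}$, and let $m\ge0$ be an integer. Then: \begin{enumerate} \item There is a unique maximal (with respect to inclusion) Kogan face $F_\tau(m\omega_{n+1-i})$ of type $\tau$ in the Gelfand–Tsetlin polytope $GT(m\omega_{n+1-i})$. \item The character of $F_\tau(m\omega_{n+1-i})$ is equal to the character of the Demazure module $V_w(m\omega_i)$. \item The defining poset of $F_\tau(\omega_{n+1-i})$ is isomorphic to $\mathcal P_{\underline\ell_w}$, and so (identifying coordinates via this isomorphism and forgetting the constant coordinates) $F_\tau(m\omega_{n+1-i})=m\mathcal O_{\underline\ell_w}$. \end{enumerate}
   Context: Weyl group and modules. $\mathfrak{sl}_{n+1}(\mathbb C)=\mathfrak n^+\oplus\mathfrak h\oplus\mathfrak n^-$, $\mathfrak b=\mathfrak h\oplus\mathfrak n^+$, positive roots $\alpha_{k,j}=\alpha_k+\dots+\alpha_j$, $R^\pm$ the positive/negative roots, weights written with $\epsilon_1,\dots,\epsilon_{n+1}$ (restricted to $\mathfrak h$, so $\epsilon_1+\dots+\epsilon_{n+1}=0$), $\omega_i=\epsilon_1+\dots+\epsilon_i$. $W=S_{n+1}$ with simple reflections $s_1,\dots,s_n$, $W^i=S_{n+1}/(S_i\times S_{n+1-i})$, each coset being identified with its minimal length representative. $V_w(m\omega_i)=U(\mathfrak b).v_{w(m\omega_i)}\subset V(m\omega_i)$ is the Demazure module, where $v_{w(m\omega_i)}$ spans the weight space of weight $w(m\omega_i)$.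 For $w\in W^i$ put $R_w^-=w^{-1}(R^-)\cap R^+$, $\ell_k=\max(\{i-1\}\cup\{j\mid i\le j\le n,\ \alpha_{k,j}\in R_w^-\})$ for $1\le k\le i$, and $\underline\ell_w=(i-1\le\ell_1\le\dots\le\ell_i\le n)$. Poset and order polytope. $\mathcal P_{\underline\ell}$ is the poset with elements $x_{k,j}$, $1\le k\le i$, $i\le j\le\ell_k$, and $x_{k_1,j_1}\ge x_{k_2,j_2}$ iff $k_1\le k_2$ and $j_1\ge j_2$. With $N=|\mathcal P_{\underline\ell}|$, $$m\mathcal O_{\underline\ell}=\{(s_{k,j})\in\mathbb R_{\ge0}^N\mid s_{k,j}\le m\ \forall k,j,\ \ s_{k_1,j_1}\ge s_{k_2,j_2}\text{ if }x_{k_1,j_1}>x_{k_2,j_2}\}.$$ Gelfand–Tsetlin polytope. The Gelfand–Tsetlin poset has vertices $x_{k,j}$, $0\le k\le n$, $1\le j\le n+1-k$, and cover relations $x_{k-1,j}\ge x_{k,j}\ge x_{k-1,j+1}$. For $\lambda=\sum_j m_j\omega_j$ set $s_{0,j}=m_n+\dots+m_j$ ($s_{0,n+1}=0$) and $GT(\lambda)=\{(s_{k,j})_{k\ge1}\in\mathbb R^{n(n+1)/2}\mid s_{k-1,j}\ge s_{k,j}\ge s_{k-1,j+1}\}$. For $\lambda=m\omega_{n+1-i}$: $s_{0,j}=m$ for $j\le n+1-i$ and $s_{0,j}=0$ otherwise. The weight of $\mathbf s\in GT(\lambda)$ is $\mathrm{wt}\,\mathbf s=\sum_{k=0}^n\sum_{j=1}^{n+1}(s_{k+1,j}-s_{k,j})\epsilon_{k+1}$,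 where $s_{p,q}=0$ if $x_{p,q}$ is not a vertex of the Gelfand–Tsetlin poset. The character of a face is $\sum e^{\mathrm{wt}\,\mathbf s}$ over the lattice points $\mathbf s$ of the face. Kogan faces. For $0\le k\le n-1$, $1\le j\le n-k$, let $A_{k,j}$ be the equality $x_{k,j}=x_{k+1,j}$. A Kogan face is a face of $GT(\lambda)$ defined by imposing a set of such equalities. Its type is the element of $W$ obtained by starting with the identity, going through the rows from the bottom row ($k=n-1$) to the top row ($k=0$), in each row from left to right (increasing $j$), and multiplying on the right by $s_{k+j}$ for every imposed equality $A_{k,j}$. The defining poset of a face $F$ is the set of coordinates $x_{k,j}$ ($k\ge1$) which are not constant on $F$, with the order induced from the Gelfand–Tsetlin poset. *)

(* Defs.v *)
(* Conventions.
   - Positions 1, ..., n+1 are the elements 0, ..., n of 'I_n.+1 shifted by one;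
     all indices k, j, i, r below are 1-based natural numbers unless their type
     is an ordinal type.
   - W = S_{n+1} acts by eps_a |-> eps_{w a}, and products in W are compositions
     of functions. The product of {perm _} is the opposite one, hence [wmul].
   - A weight is an element of h^*, written as a row vector mu in the eps_a;
     mu is only defined up to multiples of eps_1 + ... + eps_{n+1}, so weights
     are compared through the functionals [wt_eval mu] on h.
   - A point of R^N, where the N coordinates are indexed by a finite set of pairs
     (k, j), is a function nat * nat -> R which vanishes off this set. Points of
     a Gelfand-Tsetlin polytope also carry the prescribed row k = 0. *)
From HB Require Import structures.
From mathcomp Require Import all_boot all_order all_algebra all_fingroup.
From mathcomp Require Import all_classical all_reals.
From mathcomp Require Import complex.
From Stdlib Require Import Relation_Operators.

Set Implicit Arguments.
Unset Strict Implicit.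
Unset Printing Implicit Defensive.

Import Order.TTheory GRing.Theory Num.Theory.

Local Open Scope classical_set_scope.
Local Open Scope card_scope.
Local Open Scope ring_scope.

Section WeylGroup.
Variable n : nat.
Implicit Types w u v : 'S_n.+1.

Definition wmul u v : 'S_n.+1 := (v * u)%g.

(* s_r, for 1 <= r <= n *)
Definition simple_refl (r : nat) : 'S_n.+1 := tperm (inord r.-1) (inord r).

Definition word_elt (s : seq nat) : 'S_n.+1 :=
  foldl (fun w r => wmul w (simple_refl r)) 1%g s.

Definition has_word w (l : nat) : bool :=
  [exists t : l.-tuple 'I_n, word_elt [seq (val r).+1 | r <- t] == w].

Lemma has_word_exists w : exists l, has_word w l.
Proof.
pose ok v := exists s : seq 'I_n, word_elt [seq (val r).+1 | r <- s] = v.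
suff [s <-] : ok w.
  by exists (size s); apply/existsP; exists (in_tuple s).
have foldE (s : seq nat) v :
    foldl (fun w r => wmul w (simple_refl r)) v s = wmul v (word_elt s).
  elim: s v => [|r s IH] v; first by rewrite /word_elt /wmul /= mul1g.
  by rewrite /word_elt /= !IH /wmul mulg1 mulgA.
have ok1 : ok 1%g by exists [::].
have okM u v : ok u -> ok v -> ok (u * v)%g.
  move=> [s Es] [t Et]; exists (t ++ s).
  by rewrite map_cat /word_elt foldl_cat foldE -/(word_elt _) Es Et.
have okS (r : nat) : (0 < r <= n)%N -> ok (simple_refl r).
  case: r => // r /= lt_rn; exists [:: Ordinal lt_rn].
  by rewrite /word_elt /= /wmul mulg1.
have okT d : forall x y : 'I_n.+1, (y = x + d.+1 :> nat)%N -> ok (tperm x y).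
  elim: d => [|d IH] x y Exy.
    have -> : tperm x y = simple_refl y.
      by rewrite /simple_refl Exy addn1 /= -[x.+1]addn1 -Exy !inord_val.
    by apply: okS; rewrite (leq_ord y) Exy addn1.
  have ltz : (x + d.+1 < n.+1)%N.
    by apply: leq_trans (ltn_ord y); rewrite Exy !addnS ltnS.
  pose z := Ordinal ltz.
  have okxz : ok (tperm x z) by apply: IH.
  have yn : (0 < y <= n)%N by rewrite (leq_ord y) Exy addnS.
  have okzy : ok (tperm z y).
    suff -> : tperm z y = simple_refl y by apply: okS.
    rewrite /simple_refl inord_val; congr tperm; apply/val_inj.
    by rewrite /= Exy [(x + d.+2)%N]addnS /= inordK.
  have -> : tperm x y = (tperm x z ^ tperm z y)%g.
    have zx : z != x by rewrite -val_eqE /= -[X in _ != X]addn0 eqn_add2l.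
    have yx : y != x by rewrite -val_eqE /= Exy -[X in _ != X]addn0 eqn_add2l.
    by rewrite tpermJ tpermL tpermD.
  by rewrite conjgE tpermV; apply: (okM) => //; apply: okM.
have [ts -> _] := prod_tpermP w.
elim: ts => [|[x y] ts IH]; first by rewrite big_nil.
rewrite big_cons; apply: okM => //=.
case: (ltngtP x y) => [lt_xy|lt_yx|/val_inj ->].
- by apply: (okT (y - x.+1)%N); rewrite addnS -addSn subnKC.
- by rewrite tpermC; apply: (okT (x - y.+1)%N); rewrite addnS -addSn subnKC.
- by rewrite tperm1.
Qed.

Definition wlength w : nat := ex_minn (has_word_exists w).

Definition longest w : Prop := forall v, (wlength v <= wlength w)%N.

(* S_i x S_{n+1-i} *)
Definition parabolic (i : nat) : {set 'S_n.+1} :=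
  [set u : 'S_n.+1 | [forall a : 'I_n.+1, (u a < i)%N == (a < i)%N]]%SET.

(* w \in W^i *)
Definition min_coset_rep (i : nat) w : Prop :=
  forall u, u \in parabolic i -> (wlength w <= wlength (wmul w u))%N.

Definition longest_min_rep (i : nat) w : Prop :=
  min_coset_rep i w /\ exists2 u, u \in parabolic i & longest (wmul w u).

End WeylGroup.

Section Weights.
Variables (K : pzRingType) (n : nat).

Definition eps (k : nat) : 'rV[K]_n.+1 := \row_(a < n.+1) (a.+1 == k)%:R.

Definition omega (i : nat) : 'rV[K]_n.+1 := \sum_(1 <= k < i.+1) eps k.

Definition simple_root (r : nat) : 'rV[K]_n.+1 := eps r - eps r.+1.

Definition alpha (k j : nat) : 'rV[K]_n.+1 :=
  \sum_(k <= r < j.+1) simple_root r.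

(* w eps_a = eps_{w a} *)
Definition wact (w : 'S_n.+1) (x : 'rV[K]_n.+1) : 'rV[K]_n.+1 :=
  col_perm w^-1%g x.

Definition wt_eval (mu : 'rV[K]_n.+1) (H : 'M[K]_n.+1) : K :=
  \sum_(a < n.+1) mu 0 a * H a a.

End Weights.

Section Poset.
Variable n : nat.

Definition pos_root (x : 'rV[int]_n.+1) : bool :=
  [exists k : 'I_n.+1, exists j : 'I_n.+1,
     [&& (0 < k)%N, (k <= j)%N & x == alpha int n k j]].

Definition neg_root (x : 'rV[int]_n.+1) : bool := pos_root (- x).

(* R_w^- = w^{-1}(R^-) \cap R^+ *)
Definition Rw_minus (w : 'S_n.+1) (x : 'rV[int]_n.+1) : bool :=
  neg_root (wact w x) && pos_root x.

Definition ell (i : nat) (w : 'S_n.+1) (k : nat) : nat :=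
  maxn i.-1 (\max_(i <= j < n.+1 | Rw_minus w (alpha int n k j)) j).

End Poset.

Definition poset_elt (i : nat) (l : nat -> nat) : set (nat * nat) :=
  [set x | (1 <= x.1 <= i)%N /\ (i <= x.2 <= l x.1)%N].

Definition poset_ge (x y : nat * nat) : Prop :=
  (x.1 <= y.1)%N /\ (y.2 <= x.2)%N.

Definition order_polytope (R : realType) (i : nat) (l : nat -> nat) (m : nat) :
    set (nat * nat -> R) :=
  [set s | [/\ forall x, ~ poset_elt i l x -> s x = 0,
               forall x, poset_elt i l x -> 0 <= s x <= m%:R
             & forall x y, poset_elt i l x -> poset_elt i l y ->
                 poset_ge x y -> x <> y -> s y <= s x]].

Section GelfandTsetlin.
Variables (R : realType) (n : nat).

Definition gt_vertex (x : nat * nat) : bool :=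
  (0 < x.2)%N && (x.1 + x.2 <= n.+1)%N.

(* x covers y, i.e. x_{k-1,j} >= x_{k,j} or x_{k,j} >= x_{k-1,j+1} *)
Definition gtposet_cover (x y : nat * nat) : Prop :=
  [/\ gt_vertex x, gt_vertex y &
      y = (x.1.+1, x.2) \/ x = (y.1.+1, y.2.-1)].

Definition gtposet_ge : nat * nat -> nat * nat -> Prop :=
  clos_refl_trans (nat * nat) gtposet_cover.

(* The top row of GT(\sum_r c_r omega_r) *)
Definition gt_top (c : nat -> nat) (j : nat) : nat := (\sum_(j <= r < n.+1) c r)%N.

Definition GT (c : nat -> nat) : set (nat * nat -> R) :=
  [set s | [/\ forall x, ~~ gt_vertex x -> s x = 0,
               forall j, gt_vertex (0%N, j) -> s (0%N, j) = (gt_top c j)%:R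
             & forall k j, gt_vertex (k.+1, j) ->
                 s (k, j.+1) <= s (k.+1, j) <= s (k, j)]].

(* Coefficients of the weight m omega_i *)
Definition fund_mult (m i : nat) : nat -> nat := fun r => if r == i then m else 0%N.

Definition gt_weight (s : nat * nat -> R) : 'rV[R]_n.+1 :=
  \sum_(0 <= k < n.+1) \sum_(1 <= j < n.+2)
     (s (k.+1, j) - s (k, j)) *: eps R n k.+1.

(* D selects the imposed equalities A_{k,j}; its values outside of the range
   0 <= k <= n-1, 1 <= j <= n-k are irrelevant. *)
Definition kogan_face (c : nat -> nat) (D : pred (nat * nat)) :
    set (nat * nat -> R) :=
  [set s | GT c s /\
     forall k j, (k < n)%N -> (1 <= j <= n - k)%N -> D (k, j) ->
       s (k, j) = s (k.+1, j)].

Definition kogan_word (D : pred (nat * nat)) : seq nat :=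
  flatten [seq [seq (k + j)%N | j <- iota 1 (n - k) & D (k, j)]
          | k <- rev (iota 0 n)].

Definition kogan_type (D : pred (nat * nat)) : 'S_n.+1 :=
  word_elt n (kogan_word D).

Definition kogan_face_of_type (c : nat -> nat) (tau : 'S_n.+1)
    (F : set (nat * nat -> R)) : Prop :=
  exists2 D, kogan_type D = tau & F = kogan_face c D.

Definition max_kogan_face (c : nat -> nat) (tau : 'S_n.+1)
    (F : set (nat * nat -> R)) : Prop :=
  kogan_face_of_type c tau F /\
  forall G, kogan_face_of_type c tau G -> F `<=` G -> G = F.

Definition constant_on (F : set (nat * nat -> R)) (x : nat * nat) : Prop :=
  forall s t, F s -> F t -> s x = t x.

(* Elements of the defining poset of F; its order is [gtposet_ge]. *)
Definition defining_poset (F : set (nat * nat -> R)) : set (nat * nat) :=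
  [set x | [/\ gt_vertex x, (1 <= x.1)%N & ~ constant_on F x]].

Definition lattice_point (s : nat * nat -> R) : Prop :=
  forall x, s x \is a Num.int.

End GelfandTsetlin.

Arguments gtposet_ge : clear implicits.

(* The point of R^P whose coordinate at x is the coordinate of s at phi x. *)
Definition pull_coords (R : realType) (P : set (nat * nat))
    (phi : nat * nat -> nat * nat) (s : nat * nat -> R) : nat * nat -> R :=
  fun x => if x \in P then s (phi x) else 0.

Section Modules.
Variables (C : fieldType) (n : nat) (V : vectType C).
Variable rho : 'M[C]_n.+1 -> 'End(V).

Definition in_sl (A : 'M[C]_n.+1) : Prop := \tr A = 0.

Definition in_h (A : 'M[C]_n.+1) : Prop := in_sl A /\ is_diag_mx A.

Definition in_b (A : 'M[C]_n.+1) : Prop :=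
  in_sl A /\ forall a b : 'I_n.+1, (b < a)%N -> A a b = 0.

Definition in_nplus (A : 'M[C]_n.+1) : Prop :=
  forall a b : 'I_n.+1, (b <= a)%N -> A a b = 0.

(* Only the restriction of rho to sl_{n+1} matters, here and below. *)
Definition sl_module : Prop :=
  (forall a A B, in_sl A -> in_sl B -> rho (a *: A + B) = a *: rho A + rho B) /\
  (forall A B, in_sl A -> in_sl B ->
     rho (A *m B - B *m A) = (rho A \o rho B)%VF - (rho B \o rho A)%VF).

Definition irreducible_module : Prop :=
  (fullv : {vspace V}) <> 0%VS /\
  forall U : {vspace V},
    (forall A, in_sl A -> (rho A @: U <= U)%VS) -> U = 0%VS \/ U = fullv.

Definition coroot (r : 'I_n) : 'M[C]_n.+1 :=
  delta_mx (widen_ord (leqnSn n) r) (widen_ord (leqnSn n) r)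
  - delta_mx (lift ord0 r) (lift ord0 r).

(* The coroots form a basis of h. *)
Definition weight_space (mu : 'rV[C]_n.+1) : {vspace V} :=
  (\bigcap_(r < n) passmx.leigenspace (rho (coroot r)) (wt_eval mu (coroot r)))%VS.

Definition highest_weight (mu : 'rV[C]_n.+1) : Prop :=
  exists2 v : V, v != 0 &
    v \in weight_space mu /\ forall A, in_nplus A -> rho A v = 0.

(* x \in U(b).v, where U(b) is spanned by the products of elements of b. *)
Definition in_Ub (v x : V) : Prop :=
  exists ws : seq (C * seq 'M[C]_n.+1),
    (forall p, p \in ws -> forall A, A \in p.2 -> in_b A) /\
    x = \sum_(p <- ws) p.1 *: foldr (fun A u => rho A u) v p.2.

(* D = V_w(lambda), where V = V(lambda) *)
Definition demazure_module (w : 'S_n.+1) (lambda : 'rV[C]_n.+1)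
    (D : {vspace V}) : Prop :=
  exists2 v : V, <[v]>%VS = weight_space (wact w lambda) &
    forall x, x \in D <-> in_Ub v x.

End Modules.

(* The multiplicities of e^mu in the character of the submodule D of V and in
   the character of the face F agree for every mu in h^*. *)
Definition same_character (R : realType) (n : nat) (V : vectType R[i])
    (rho : 'M[R[i]]_n.+1 -> 'End(V)) (D : {vspace V})
    (F : set (nat * nat -> R)) : Prop :=
  forall mu : 'rV[R[i]]_n.+1,
    [set s | [/\ F s, lattice_point s &
       forall H, in_h H ->
         wt_eval (map_mx (real_complex R) (gt_weight n s)) H = wt_eval mu H]]
    #= `I_(\dim (D :&: weight_space rho mu)).

Definition poset_iso (P Q : set (nat * nat)) (geP geQ : nat * nat -> nat * nat -> Prop)
    (phi : nat * nat -> nat * nat) : Prop :=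
  set_bij P Q phi /\
  forall x y, P x -> P y -> (geP x y <-> geQ (phi x) (phi y)).

(* Main.v *)
Require Import Defs.
From HB Require Import structures.
From mathcomp Require Import all_boot all_order all_algebra all_fingroup.
From mathcomp Require Import all_classical all_reals.
From mathcomp Require Import complex.
From mathcomp Require Import zify ring.
From Stdlib Require Import Relation_Operators.

(** Put p = n + 1 - i, and let w t be the 0-based value of w at the 0-based
    position t. The element tau maps p + t to w t for t < i, and is increasing
    on the first p positions.

    The face. Let D be a set of equalities A_{k,j}. Its type is computed by
    letting tokens cross the rows of D from the top row down, each row from
    right to left ([kogan_type_cross]). Start a token at one of the first p
    positions and let it cross only the columns from j on: wherever it ends
    beyond p, the equalities that it used force a vertex of column j to be m
    ([cross_forces]). Restricting D to fewer columns changes the final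
    positions in a controlled way ([cross_column]), so by counting, whenever
    D has type tau, the first p - (w t - t) vertices of the antidiagonal
    p + t + 1 are m on the whole Kogan face of D ([kogan_face_sub]). An explicit
    set of cells has type tau and imposes only this ([kogan_type_tau],
    [tau_face_kogan]). Hence [tau_face] contains every Kogan face of type tau
    and is itself one. Its other coordinates are either 0 or m, or they form a
    copy of the poset, one antidiagonal for each row ([to_gt_bij],
    [to_gt_order], [tau_face_order_polytope]).

    The character. In the m-th tensor power of the i-th tensor power of the
    standard representation, let the vector of minors of an (n+1) x i matrix Y
    be the m-th tensor power of the wedge of its columns. The matrix with
    columns e_1, ..., e_i gives a highest weight vector of weight m omega_i, so
    any irreducible module of this highest weight embeds into the tensors
    ([highest_weight_embedding]): in the product of both modules, the submodule
    generated by the pair of highest weight vectors is the graph of a linear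
    map. Here the grading by height separates the highest weight vectors from
    the rest, and a contravariant Hermitian form shows that no nonzero tensor
    is related to 0. The Demazure module becomes the span of the vectors of
    minors of the matrices in the closed Schubert cell of w
    ([minors_schubert], [schubert_relation]). By Hodge's standard
    monomial theory the coordinates indexed by the standard tableaux below w
    are coordinates on this span: the straightening relations show that
    they determine a tensor ([straightening], [schubert_spanning]), and they
    are linearly independent as polynomials on the cell ([standard_free]). So
    the dimension of a weight space is a number of standard tableaux
    ([demazure_dim]).

    A standard tableau is a chain of m subsets of size i. A fundamental
    Gelfand-Tsetlin pattern encodes a subset by the 0/1 pattern of its
    complement, and a lattice point of the face is the sum of the patterns
    obtained by cutting it at the levels 0, ..., m - 1. This is a bijection with
    the standard tableaux below w that matches the weights
    ([lattice_points_card]). *)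

Set Implicit Arguments.
Unset Strict Implicit.
Unset Printing Implicit Defensive.

Import Order.TTheory GRing.Theory Num.Theory.

Local Open Scope ring_scope.

(** * Matrices acting on tensors *)

Lemma scaleoE (C : comNzRingType) (a : C) (t : C^o) : a *: t = a * t.
Proof. by []. Qed.

Section Tensor.
Variables (C : comNzRingType) (N : nat) (P : finType).
Local Notation idx := {ffun P -> 'I_N}.
Local Notation tns := {ffun idx -> C^o}.
Implicit Types (T : idx) (A B : 'M[C]_N) (x y : tns).

Definition upd T (q : P) (b : 'I_N) : idx :=
  [ffun q' => if q' == q then b else T q'].

(** The matrix A on the tensor factor q; coordinates of a tensor are indexed
    by its multi-indices T. *)
Definition act1 q A x : tns :=
  [ffun T : idx => \sum_b A (T q) b * x (upd T q b)].

Definition act A x : tns := \sum_q act1 q A x.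

Lemma actE A x T : act A x T = \sum_q \sum_b A (T q) b * x (upd T q b).
Proof. by rewrite /act sum_ffunE; apply: eq_bigr => q _; rewrite ffunE. Qed.

Lemma upd_id T q : upd T q (T q) = T.
Proof. by apply/ffunP => q'; rewrite ffunE; case: eqP => [->|]. Qed.

Lemma upd_same T q b : upd T q b q = b.
Proof. by rewrite ffunE eqxx. Qed.

Lemma upd_neq T q q' b : q' != q -> upd T q b q' = T q'.
Proof. by rewrite ffunE => /negPf ->. Qed.

Lemma upd_upd T q b c : upd (upd T q b) q c = upd T q c.
Proof. by apply/ffunP => q'; rewrite !ffunE; case: eqP. Qed.

Lemma upd_swap T q q' b c :
  q != q' -> upd (upd T q b) q' c = upd (upd T q' c) q b.
Proof.
move=> /negPf nqq; apply/ffunP => r; rewrite !ffunE.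
by case: (r =P q') => [->|//]; rewrite eq_sym nqq.
Qed.

Lemma act1_additive q A a x y :
  act1 q A (a *: x + y) = a *: (act1 q A x : tns) + act1 q A y.
Proof.
apply/ffunP => T; rewrite !ffunE scaleoE mulr_sumr -big_split.
by apply: eq_bigr => b _; rewrite !ffunE scaleoE /= mulrDr mulrCA.
Qed.

Lemma act_linear A : linear (act A : {ffun idx -> C^o} -> {ffun idx -> C^o}).
Proof.
move=> a x y; rewrite /act scaler_sumr -big_split; apply: eq_bigr => q _.
exact: act1_additive.
Qed.

Lemma act_linearl a A B x :
  act (a *: A + B) x = a *: (act A x : tns) + act B x.
Proof.
apply/ffunP => T; rewrite !ffunE !actE scaleoE mulr_sumr -big_split; apply: eq_bigr => q _.
rewrite mulr_sumr -big_split; apply: eq_bigr => b _ /=.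
by rewrite !mxE mulrDl mulrA.
Qed.

Lemma act1M q A B x : act1 q A (act1 q B x) = act1 q (A *m B) x.
Proof.
apply/ffunP => T; rewrite !ffunE.
under eq_bigr => b _ do rewrite ffunE upd_same mulr_sumr.
rewrite exchange_big; apply: eq_bigr => c _; rewrite mxE mulr_suml.
by apply: eq_bigr => b _; rewrite upd_upd mulrA.
Qed.

Lemma act1C q q' A B x :
  q != q' -> act1 q A (act1 q' B x) = act1 q' B (act1 q A x).
Proof.
move=> nqq; apply/ffunP => T; rewrite !ffunE.
under eq_bigr => b _ do rewrite ffunE mulr_sumr.
rewrite exchange_big; apply: eq_bigr => c _; rewrite ffunE mulr_sumr.
apply: eq_bigr => b _; rewrite upd_neq ?[q' == q]eq_sym // upd_neq //.
by rewrite upd_swap // mulrCA.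
Qed.

Lemma act1_sum q A (I : finType) (F : I -> tns) :
  act1 q A (\sum_i F i) = \sum_i act1 q A (F i).
Proof.
apply/ffunP => T; rewrite ffunE sum_ffunE.
under eq_bigr do rewrite sum_ffunE mulr_sumr.
by rewrite exchange_big; apply: eq_bigr => i _; rewrite ffunE.
Qed.

(** Matrices in different tensor factors commute, so only the diagonal terms
    of the two double sums survive. *)
Lemma act_bracket A B x :
  act (A *m B - B *m A) x = act A (act B x) - act B (act A x).
Proof.
have actsE A' B' : act A' (act B' x) = \sum_q \sum_q' act1 q A' (act1 q' B' x).
  by rewrite /act; apply: eq_bigr => q _; rewrite act1_sum.
rewrite !actsE [X in _ = _ - X]exchange_big /= -sumrB; apply: eq_bigr => q _.
rewrite (bigD1 q) //= [X in _ = _ - X](bigD1 q) //= !act1M.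
rewrite [X in _ + X - _](_ : _ = \sum_(i | i != q) act1 i B (act1 q A x)); last first.
  by apply: eq_bigr => r nrq; rewrite act1C // eq_sym.
rewrite opprD addrACA subrr addr0.
apply/ffunP => T; rewrite !ffunE -sumrB; apply: eq_bigr => b _.
by rewrite !mxE mulrBl.
Qed.

Lemma act_scalar a x T : act a%:M x T = (a *+ #|P|) * x T.
Proof.
rewrite actE (eq_bigr (fun => a * x T)) => [|q _].
  by rewrite sumr_const mulrnAl.
rewrite (bigD1 (T q)) //= upd_id mxE eqxx mulr1n big1 ?addr0 // => b nb.
by rewrite mxE eq_sym (negPf nb) mul0r.
Qed.

Lemma act_diag A x T : is_diag_mx A ->
  act A x T = (\sum_q A (T q) (T q)) * x T.
Proof.
move=> /is_diag_mxP dA; rewrite actE mulr_suml; apply: eq_bigr => q _.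
rewrite (bigD1 (T q)) //= upd_id big1 ?addr0 // => b nb.
by rewrite dA ?mul0r // eq_sym.
Qed.

(** The transpose of a matrix acts by the transpose for the bilinear form in
    which the pure tensors of basis vectors are orthonormal. *)
Lemma act_adjoint A x y :
  \sum_T x T * act A y T = \sum_T act A^T x T * y T.
Proof.
under eq_bigr do rewrite actE mulr_sumr.
under [RHS]eq_bigr do rewrite actE mulr_suml.
rewrite exchange_big [RHS]exchange_big; apply: eq_bigr => q _ /=.
under eq_bigr do rewrite mulr_sumr.
under [RHS]eq_bigr do rewrite mulr_suml.
rewrite !pair_big /=.
pose h (p : idx * 'I_N) := (upd p.1 q p.2, p.1 q).
have hK : involutive h.
  by case=> T b; rewrite /h /= upd_same upd_upd upd_id.
rewrite (reindex h) /=; last by exists h => ? _; apply: hK.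
apply: eq_bigr => -[T b] _ /=.
by rewrite upd_same upd_upd upd_id mxE; ring.
Qed.

End Tensor.

Section Minors.
Variables (N m i : nat).
Local Notation pos := ('I_m * 'I_i)%type.
Local Notation idx := {ffun pos -> 'I_N}.

Section Ring.
Variable C : comNzRingType.
Implicit Types (T : idx) (Y : 'M[C]_(N, i)).

(** The coordinates of the m-th tensor power of the wedge of the columns of Y. *)
Definition minors Y : {ffun idx -> C^o} :=
  [ffun T : idx => \prod_(l < m) \det (\matrix_(t, u) Y (T (l, t)) u)].

Lemma minorsE Y T :
  minors Y T = \sum_(c : {ffun 'I_m -> 'S_i}) (\prod_l (-1) ^+ (c l))
     * \prod_q Y (T q) (c q.1 q.2).
Proof.
rewrite ffunE /determinant bigA_distr_bigA; apply: eq_bigr => c _.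
rewrite big_split /=; congr (_ * _).
under eq_bigr do under eq_bigr do rewrite mxE.
by rewrite pair_bigA; apply: eq_bigr => -[].
Qed.

Lemma minorsM Y (B : 'M[C]_i) T : minors (Y *m B) T = \det B ^+ m * minors Y T.
Proof.
have -> : \det B ^+ m = \prod_(l < m) \det B by rewrite prodr_const card_ord.
rewrite !ffunE -big_split; apply: eq_bigr => l _ /=; rewrite mulrC -det_mulmx; congr (\det _).
apply/matrixP => t u; rewrite !mxE; apply: eq_bigr => v _.
by rewrite !mxE.
Qed.

End Ring.

Lemma map_minors (C D : comNzRingType) (f : {rmorphism C -> D})
    (Y : 'M[C]_(N, i)) (T : idx) :
  f (minors Y T) = minors (map_mx f Y) T.
Proof.
rewrite !ffunE rmorph_prod; apply: eq_bigr => l _.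
rewrite -det_map_mx; congr (\det _); apply/matrixP => t u.
by rewrite !mxE.
Qed.

Lemma deriv_prod (C : comNzRingType) (I : finType) (F : I -> {poly C}) :
  (\prod_i F i)^`() =
  \sum_j \prod_i (if i == j then (F i)^`() else F i).
Proof.
have gen (s : seq I) : uniq s -> (\prod_(i <- s) F i)^`() =
    \sum_(j <- s) \prod_(i <- s) (if i == j then (F i)^`() else F i).
  elim: s => [|a s IH] /=; first by rewrite !big_nil derivC.
  case/andP=> nas us; rewrite !big_cons derivM IH // eqxx; congr (_ + _).
    congr (_ * _); apply: eq_big_seq => b bs.
    by case: eqP => // eb; rewrite -eb bs in nas.
  rewrite mulr_sumr; apply: eq_big_seq => b bs; rewrite big_cons.
  by case: eqP => // eb; rewrite eb bs in nas.
exact: gen (index_enum_uniq _).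
Qed.

(** Leibniz rule: if Y moves with velocity A Y / d, then so does the vector of
    minors, for the action of A. *)
Lemma deriv_minors (C : comNzRingType) (d : {poly C})
    (Y : 'M[{poly C}]_(N, i)) (A : 'M[{poly C}]_N) (T : idx) :
  (forall a u, d * (Y a u)^`() = (A *m Y) a u) ->
  d * (minors Y T)^`() = act A (minors Y) T.
Proof.
move=> dY; rewrite actE minorsE raddf_sum mulr_sumr.
under [RHS]eq_bigr => q _.
  under eq_bigr => b _.
    rewrite minorsE mulr_sumr.
  over.
  rewrite exchange_big /=.
over.
rewrite [RHS]exchange_big; apply: eq_bigr => c _ /=.
have -> : \prod_l (-1) ^+ c l = ((\prod_l (-1) ^+ c l : C)%:P).
  rewrite rmorph_prod; apply: eq_bigr => l _.
  by rewrite rmorphXn rmorphN rmorph1.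
rewrite deriv_mulC deriv_prod mulr_sumr mulr_sumr; apply: eq_bigr => q _.
rewrite (bigD1 q) //= eqxx mulrCA [X in _ * X]mulrA dY mxE mulr_suml mulr_sumr.
apply: eq_bigr => b _; set e := polyC _.
rewrite [in RHS](bigD1 q) //= upd_same.
under [in RHS]eq_bigr => r nrq do rewrite upd_neq //.
under [in LHS]eq_bigr => r nrq do rewrite (negPf nrq).
by ring.
Qed.

End Minors.

(** * Flows of vectors of minors *)

Section Flow.
Variables (C : numFieldType) (N m i : nat).
Local Notation idx := {ffun 'I_m * 'I_i -> 'I_N}.
Local Notation tns := {ffun idx -> C^o}.
Implicit Types (T : idx) (Y : 'M[C]_(N, i)) (A : 'M[C]_N) (U : {vspace tns}).

(** The line through Y in the direction of Y', as a matrix over the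
    polynomials in x. *)
Definition line_mx Y (Y' : 'M[C]_(N, i)) : 'M[{poly C}]_(N, i) :=
  map_mx polyC Y + 'X *: map_mx polyC Y'.

Lemma line_mxE Y Y' x :
  map_mx (horner_eval x) (line_mx Y Y') = Y + x *: Y'.
Proof.
apply/matrixP => a u; rewrite !mxE /horner_eval !hornerE /=.
by [].
Qed.

Lemma minors_line Y Y' x T :
  (minors m (line_mx Y Y') T).[x] = minors m (Y + x *: Y') T.
Proof.
by rewrite -[LHS]/(horner_eval x _) map_minors line_mxE.
Qed.

(** The coefficients in x of the vector of minors of (1 + x A) Y. As A A = mu
    A, the point Y' = (1 + x A) Y moves with (1 + mu x) dY'/dx = A Y', so the
    Leibniz rule is a recursion on the coefficients. *)
Lemma minors_flow A mu Y : A *m A = mu *: A ->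
  exists c : nat -> tns, [/\ c 0%N = minors m Y,
    forall k, c k.+1 *+ k.+1 = act A (c k) - (mu *+ k) *: c k &
    exists K, forall x, minors m (Y + x *: (A *m Y)) = \sum_(k < K) x ^+ k *: c k].
Proof.
move=> AA; set Yp := line_mx Y (A *m Y).
pose q T : {poly C} := minors m Yp T.
have E T : (1 + mu *: 'X) * (q T)^`() = act (map_mx polyC A) (minors m Yp) T.
  apply: deriv_minors => a u; rewrite /Yp /line_mx mulmxDr -scalemxAr.
  rewrite -!map_mxM mulmxA AA -scalemxAl; move: (A *m Y) => Z.
  rewrite !mxE derivD derivM derivX !derivC mulr0 addr0 mul1r add0r.
  by rewrite mulrDl mul1r -mul_polyC rmorphM /=; congr (_ + _); ring.
pose c k : tns := [ffun T => (q T)`_k].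
exists c; split.
- apply/ffunP => T; rewrite ffunE -horner_coef0 minors_line.
  by rewrite scale0r addr0.
- move=> k; apply/ffunP => T.
  have cE : act A (c k) T = (act (map_mx polyC A) (minors m Yp) T)`_k.
    rewrite !actE coef_sum; apply: eq_bigr => r _; rewrite coef_sum.
    by apply: eq_bigr => b _; rewrite !ffunE mxE coefCM; congr (_ * _); rewrite /q ffunE.
  rewrite ffunMnE [RHS]ffunE cE -E [X in _ = _ + X]ffunE !(ffunE, scaleoE) mulrDl mul1r.
  rewrite coefD -scalerAl coefZ coefXM coef_deriv.
  case: k {cE} => [|k] /=; first by rewrite mulr0n mulr0 mul0r subr0 addr0.
  by rewrite coef_deriv mulrnAl mulrnAr addrK.
- exists (\max_T size (q T)) => x; apply/ffunP => T.
  rewrite -minors_line sum_ffunE (@horner_coef_wide _ (\max_T size (q T))).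
    apply: eq_bigr => k _.
    by rewrite [RHS]ffunE scaleoE [X in _ = _ * X]ffunE mulrC.
  exact: (leq_bigmax T).
Qed.

(** The matrix A acts on the vector of minors of Y as the velocity along (1 +
    x A) Y at x = 0. *)
Lemma act_minors0 A Y T :
  act A (minors m Y) T = (minors m (line_mx Y (A *m Y)) T)^`().[0].
Proof.
set Yp := line_mx Y (A *m Y).
(* The velocity of B Y is A Y = (A adj B / det B) (B Y), and at x = 0 the
   matrix B is the identity. *)
pose B : 'M[{poly C}]_N := 1%:M + 'X *: map_mx polyC A.
have YpE : Yp = B *m map_mx polyC Y.
  by rewrite /B mulmxDl mul1mx -scalemxAl -map_mxM.
have B0 : map_mx (horner_eval 0) B = 1%:M.
  by rewrite map_mxD map_mx1 map_mxZ /= /horner_eval hornerX scale0r addr0.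
have E : \det B * (minors m Yp T)^`() =
    act (map_mx polyC A *m \adj B) (minors m Yp) T.
  apply: deriv_minors => a u.
  have -> : (Yp a u)^`() = map_mx polyC (A *m Y) a u.
    by rewrite !mxE derivD derivM derivX !derivC mulr0 addr0 mul1r add0r.
  rewrite YpE -mulmxA [\adj B *m _]mulmxA mul_adj_mx mul_scalar_mx -scalemxAr.
  by rewrite -map_mxM [RHS]mxE.
move/(congr1 (horner_eval 0)): E; rewrite /= rmorphM /= -det_map_mx B0 det1 mul1r.
rewrite /horner_eval => ->; rewrite !actE -[RHS]/(horner_eval 0 _) rmorph_sum.
apply: eq_bigr => q _; rewrite rmorph_sum; apply: eq_bigr => b _.
rewrite rmorphM /= [X in _ = _ * X]minors_line scale0r addr0; congr (_ * _).
transitivity (map_mx (horner_eval 0) (map_mx polyC A *m \adj B) (T q) b); last first.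
  by rewrite mxE.
rewrite map_mxM map_mx_adj B0 adj1 mulmx1 -map_mx_comp.
by rewrite mxE /= /horner_eval hornerC.
Qed.

(** Derivative at 0 of minors ((1 + x A) Y) = det (1 + x B) ^ m minors Y. *)
Lemma act_minors_trig A Y (B : 'M[C]_i) :
  A *m Y = Y *m B -> is_trig_mx B^T ->
  act A (minors m Y) = (\tr B *+ m) *: minors m Y.
Proof.
move=> AY tB; apply/ffunP => T; rewrite act_minors0 AY.
have -> : line_mx Y (Y *m B) =
    map_mx polyC Y *m (1%:M + 'X *: map_mx polyC B).
  by rewrite mulmxDr mulmx1 -scalemxAr -map_mxM.
rewrite minorsM -map_minors /= derivM derivC mulr0 addr0 hornerM hornerC [RHS]ffunE scaleoE.
congr (_ * _); rewrite deriv_exp hornerMn hornerM.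
set D := 1%:M + _.
have D0 : map_mx (horner_eval 0) D = 1%:M.
  by rewrite map_mxD map_mx1 map_mxZ /= /horner_eval hornerX scale0r addr0.
have tD : is_trig_mx D^T.
  apply/is_trig_mxP => a b ab; rewrite !mxE -val_eqE /= gtn_eqF // add0r.
  by move/is_trig_mxP: tB => /(_ _ _ ab); rewrite mxE => ->; rewrite mulr0.
have -> : (\det D ^+ m.-1).[0] = 1.
  by rewrite -[LHS]/(horner_eval 0 _) rmorphXn -det_map_mx D0 det1 expr1n.
rewrite mulr1 -det_tr (det_trig tD) deriv_prod horner_sum; congr (_ *+ _).
have DE j : D^T j j = 1 + B j j *: 'X.
  by rewrite !mxE eqxx mulr1n -mul_polyC mulrC.
apply: eq_bigr => j _; rewrite (bigD1 j) //= eqxx hornerM DE.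
rewrite derivD derivZ derivX -polyC1 derivC add0r alg_polyC hornerC.
rewrite -[RHS]mulr1; congr (_ * _).
rewrite -[LHS]/(horner_eval 0 _) rmorph_prod big1 // => k /negPf ->.
by rewrite DE /= /horner_eval hornerD hornerZ hornerX mulr0 addr0 hornerC.
Qed.
End Flow.

(** * Schubert cells *)

Lemma poly_all0 (C : numDomainType) (p : {poly C}) : (forall x, p.[x] = 0) -> p = 0.
Proof.
move=> p0; apply/eqP; apply: contraT => nzp.
have := @max_poly_roots _ p [seq k%:R | k <- iota 0 (size p)] nzp.
rewrite size_map size_iota ltnn; apply.
  by apply/allP => x _; apply/eqP/p0.
by rewrite map_inj_uniq ?iota_uniq // => a b /eqP; rewrite eqr_nat => /eqP.
Qed.

Section Orbits.
Variables (C : numFieldType) (N m i : nat).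
Local Notation idx := {ffun 'I_m * 'I_i -> 'I_N}.
Local Notation tns := {ffun idx -> C^o}.
Implicit Types (T : idx) (Y : 'M[C]_(N, i)) (A : 'M[C]_N) (U : {vspace tns}).
Implicit Types (w : 'I_i -> 'I_N).

Definition stable_under U A := forall z : tns, z \in U -> act A z \in U.

(** By the recursion of minors_flow, every coefficient in x lies in U: in
    characteristic 0 the recursion can be divided by k + 1. *)
Lemma minors_exp U A mu Y x : A *m A = mu *: A -> stable_under U A ->
  minors m Y \in U -> minors m (Y + x *: (A *m Y)) \in U.
Proof.
move=> AA sU YU; have [c [c0 cS [K ->]]] := minors_flow m Y AA.
apply: memv_suml => k _; apply: memvZ; move: (nat_of_ord k) => {}k.
elim: k => [|k IH]; first by rewrite c0.
have -> : c k.+1 = k.+1%:R^-1 *: (act A (c k) - (mu *+ k) *: c k).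
  by rewrite -cS -scaler_nat scalerA mulVf ?scale1r ?pnatr_eq0.
by apply/memvZ/memvB; [apply: sU | apply: memvZ].
Qed.

(** The matrix has rank at most one, kills the columns of Y other than column
    u, and adds y - e_b to column u = e_b. *)
Lemma minors_replace U Y (u : 'I_i) (b : 'I_N) (y : 'I_N -> C) :
  (forall v, Y b v = (v == u)%:R) -> (forall a, Y a u = (a == b)%:R) ->
  stable_under U (\matrix_(a, c) ((y a - (a == b)%:R) * (c == b)%:R)) ->
  minors m Y \in U ->
  minors m (\matrix_(a, v) if v == u then y a else Y a v) \in U.
Proof.
move=> rowb colu; set A := \matrix_(a, c) _ => sU YU.
have AE p (Z : 'M_(N, p)) :
    A *m Z = \matrix_(a, v) ((y a - (a == b)%:R) * Z b v).
  apply/matrixP => a v; rewrite !mxE (bigD1 b) //= !mxE eqxx mulr1.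
  by rewrite big1 ?addr0 // => c /negPf nb; rewrite mxE nb mulr0 mul0r.
have AA : A *m A = (y b - 1) *: A.
  by rewrite AE; apply/matrixP => a v; rewrite !mxE !eqxx mulrA [RHS]mulrA; congr (_ * _); rewrite mulrC.
have := minors_exp 1 AA sU YU; congr (minors m _ \in U).
rewrite AE; apply/matrixP => a v; rewrite !mxE rowb.
rewrite mul1r; case: (v =P u) => [->|_]; last by rewrite mulr0 addr0.
by rewrite mulr1 colu addrC subrK.
Qed.

Definition frame w : 'M[C]_(N, i) := \matrix_(a, t) (a == w t)%:R.

(** The closed Schubert cell of w, in coordinates. *)
Definition schubert w Y := forall (a : 'I_N) t, (w t < a)%N -> Y a t = 0.

Definition upper_triangular A := forall a b : 'I_N, (b < a)%N -> A a b = 0.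

Lemma schubert_upper w A Y x : upper_triangular A -> schubert w Y ->
  schubert w (Y + x *: (A *m Y)).
Proof.
move=> uA sY a t wa; rewrite !mxE sY // add0r big1 ?mulr0 // => c _.
by have [ca|ac] := ltnP c a; [rewrite uA ?mul0r | rewrite sY ?mulr0 // (leq_trans wa)].
Qed.

(** The columns of the frame of w are replaced by those of Y from left to
    right. When the turn of column u comes, row w u vanishes in all the other
    columns: the earlier ones end at w v < w u, and the later ones are basis
    vectors. *)
Lemma minors_schubert U w Y : {homo w : s t / (s < t)%N} ->
  (forall A, upper_triangular A -> stable_under U A) ->
  minors m (frame w) \in U -> schubert w Y -> minors m Y \in U.
Proof.
move=> wM sU wU sY.
pose Yk k : 'M[C]_(N, i) := \matrix_(a, t) if (t < k)%N then Y a t else (a == w t)%:R.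
suff YkU k : (k <= i)%N -> minors m (Yk k) \in U.
  have -> : Y = Yk i by apply/matrixP => a t; rewrite mxE ltn_ord.
  exact: YkU.
elim: k => [_|k IH lki].
  by have -> : Yk 0%N = frame w by apply/matrixP => a t; rewrite !mxE.
pose u := Ordinal lki.
have -> : Yk k.+1 = \matrix_(a, v) if v == u then Y a u else Yk k a v.
  apply/matrixP => a v; rewrite !mxE -[v == u]val_eqE /= ltnS leq_eqVlt.
  by case: (v =P k :> nat) => //= vk; have -> : v = u by apply: ord_inj.
apply: (@minors_replace U _ u (w u)) => [v|a||].
- rewrite mxE -[v == u]val_eqE /=; case: ltngtP => [vu|vu|vk].
  + by rewrite sY // wM.
  + by have := wM _ _ (vu : (u < v)%N); rewrite -val_eqE => /ltn_eqF ->.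
  + by have -> : v = u by [apply: ord_inj]; rewrite eqxx.
- by rewrite mxE ltnn.
- apply: sU => a b ba; rewrite mxE; case: (b =P w u) => [eb|]; rewrite ?mulr0 //.
  by rewrite eb in ba; rewrite sY // -val_eqE (gtn_eqF ba) subr0 mul0r.
- exact/IH/ltnW.
Qed.

(** The columns of the standard frame are replaced by those of the frame of w
    from right to left. When the turn of column u comes, row u vanishes in the
    other columns, since w v >= v > u for v > u. *)
Lemma minors_frame U w (le_iN : (i <= N)%N) : {homo w : s t / (s < t)%N} ->
  (forall A, stable_under U A) ->
  minors m (frame (widen_ord le_iN)) \in U -> minors m (frame w) \in U.
Proof.
move=> wM sU wU.
have wge (t : 'I_i) : (t <= w t)%N.
  case: t => t; elim: t => // t IH ti; have /= := IH (ltnW ti).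
  by move/leq_ltn_trans; apply; apply: wM.
pose Yk k : 'M[C]_(N, i) :=
  \matrix_(a, t) if (t < k)%N then (a == widen_ord le_iN t)%:R else (a == w t)%:R.
suff YkU k : (k <= i)%N -> minors m (Yk (i - k)%N) \in U.
  have -> : frame w = Yk (i - i)%N by apply/matrixP => a t; rewrite subnn !mxE.
  exact: YkU.
elim: k => [_|k IH lki].
  rewrite subn0; suff -> : Yk i = frame (widen_ord le_iN) by [].
  by apply/matrixP => a t; rewrite !mxE ltn_ord.
have lui : (i - k.+1 < i)%N by rewrite ltn_subrL (leq_trans _ lki).
pose u := Ordinal lui; have eu : (i - k = u.+1)%N by rewrite subnSK.
have -> : Yk (i - k.+1)%N =
    \matrix_(a, v) if v == u then (a == w u)%:R else Yk (i - k)%N a v.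
  apply/matrixP => a v; rewrite !mxE -[v == u]val_eqE /= eu ltnS [in RHS]leq_eqVlt.
  case: (v =P (i - k.+1)%N :> nat) => //= vu.
  by have -> : v = u by [apply: ord_inj]; rewrite ltnn.
apply: (@minors_replace U _ u (widen_ord le_iN u)) => [v|a||].
- rewrite mxE eu ltnS leqNgt; case: ltnP => /= uv; last first.
    by rewrite -!val_eqE /= eq_sym.
  by rewrite -!val_eqE /= (gtn_eqF uv) ltn_eqF // (leq_trans uv).
- by rewrite mxE eu ltnSn.
- exact: sU.
- exact/IH/ltnW.
Qed.

(** A linear relation that holds on the Schubert cell also holds for the
    image under an upper triangular matrix, by differentiating along a line. *)
Lemma schubert_relation w (f : idx -> C) A Y :
  (forall Y, schubert w Y -> \sum_T f T * minors m Y T = 0) ->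
  upper_triangular A -> schubert w Y -> \sum_T f T * act A (minors m Y) T = 0.
Proof.
move=> f0 uA sY.
pose p : {poly C} := \sum_T f T *: minors m (line_mx Y (A *m Y)) T.
have p0 : p = 0.
  apply: poly_all0 => x; rewrite /p horner_sum.
  under eq_bigr do rewrite hornerZ minors_line.
  exact: f0 (schubert_upper x uA sY).
transitivity (p^`().[0]); last by rewrite p0 deriv0 horner0.
rewrite /p raddf_sum /= horner_sum; apply: eq_bigr => T _.
by rewrite act_minors0 derivZ hornerZ.
Qed.

Lemma minors_frame_self w : injective w ->
  minors m (frame w) [ffun q => w q.2] = 1.
Proof.
move=> wI; rewrite ffunE big1 // => l _; rewrite -[RHS](det1 _ i); congr (\det _).
by apply/matrixP => t u; rewrite !mxE ffunE /= (inj_eq wI).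
Qed.

End Orbits.

(** * Straightening *)

Section Straightening.
Variables (C : numDomainType) (N m i : nat).
Local Notation pos := ('I_m * 'I_i)%type.
Local Notation idx := {ffun pos -> 'I_N}.
Implicit Types (T : idx) (x : idx -> C) (s : {perm pos}) (Q : {set pos}).

Definition permute T s : idx := [ffun q => T (s q)].

Definition alternating x := forall T q r, q.1 = r.1 -> q != r ->
  x (permute T (tperm q r)) = - x T.

(** The Garnir relations: x vanishes when it is antisymmetrised over more than
    i positions. *)
Definition garnir x := forall T Q, (i < #|Q|)%N ->
  \sum_(s | perm_on Q s) (-1) ^+ s * x (permute T s) = 0.

Definition standard T :=
  [forall l : 'I_m, forall t : 'I_i, forall t' : 'I_i, (t < t')%N ==> (T (l, t) < T (l, t'))%N] &&
  [forall l : 'I_m, forall l' : 'I_m, forall t : 'I_i, (l < l')%N ==> (T (l, t) <= T (l', t))%N].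

Lemma eq_opp0 (a : C) : a = - a -> a = 0.
Proof. by move/eqP; rewrite -addr_eq0 -mulr2n mulrn_eq0 => /eqP. Qed.

(** Exchanging two entries of one row of T exchanges two rows of a
    determinant. *)
Lemma minors_alternating (Y : 'M[C]_(N, i)) : alternating (minors m Y).
Proof.
move=> T q r eqr nqr; rewrite !ffunE (bigD1 q.1) //= [in RHS](bigD1 q.1) //=.
rewrite -mulNr; congr (_ * _); last first.
  apply: eq_bigr => l nl; congr (\det _); apply/matrixP => t u; rewrite !mxE ffunE.
  by rewrite tpermD //; apply: contraNneq nl => e; rewrite ?e // eqr e.
set M := \matrix_(t, u) Y (T (q.1, t)) u.
suff -> : \matrix_(t, u) Y (permute T (tperm q r) (q.1, t)) u =
    row_perm (tperm q.2 r.2) M.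
  rewrite row_permE det_mulmx det_perm odd_tperm.
  have -> : q.2 != r.2.
    by apply: contraNneq nqr => e2; rewrite -pair_eqE /= eqr e2 !eqxx.
  by rewrite expr1 mulN1r.
apply/matrixP => t u; rewrite !mxE ffunE; congr (Y (T _) u).
case: q r eqr nqr {M} => [l a] [l' b] /= <- _.
have inj : injective (pair l : 'I_i -> pos) by move=> ? ? [].
by rewrite -(inj_tperm _ _ _ inj).
Qed.

Lemma permute_permute T s s' : permute (permute T s) s' = permute T (s' * s).
Proof. by apply/ffunP => q; rewrite !ffunE permM. Qed.

(** Induction on the support: composing s with the transposition of q and s q
    fixes one more position. *)
Lemma alternating_perm x T s : alternating x -> (forall q, (s q).1 = q.1) ->
  x (permute T s) = (-1) ^+ s * x T.
Proof.
move=> altx; have [k] := ubnP #|[set q | s q != q]|.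
elim: k => // k IH in s T *; rewrite ltnS => card_s rows.
have [/forallP s1|] := boolP [forall q, s q == q].
  have -> : s = 1%g by apply/permP => q; rewrite perm1; apply/eqP.
  rewrite odd_perm1 expr0 mul1r; congr (x _).
  by apply/ffunP => q; rewrite ffunE perm1.
rewrite negb_forall => /existsP[q nq].
pose s' := (s * tperm q (s q))%g.
have rows' r : (s' r).1 = r.1.
  rewrite permM; case: tpermP => [srq|/perm_inj->|_ _]; rewrite ?rows //.
  by rewrite -(rows r) srq.
have Es : s = (s' * tperm q (s q))%g by rewrite -mulgA tperm2 mulg1.
rewrite Es -permute_permute IH //.
  rewrite altx ?rows // 1?eq_sym // odd_permM odd_tperm eq_sym nq.
  by rewrite addbT signrN mulrN mulNr.
apply: leq_trans card_s; apply: proper_card; apply/properP; split.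
  apply/fintype.subsetP => r; rewrite !inE permM; apply: contra => /eqP sr.
  rewrite sr tpermD //; first by apply: contraNneq nq => ->; rewrite sr.
  by apply: contraNneq nq => e; rewrite (perm_inj (etrans e (esym sr))) sr.
by exists q; rewrite !inE ?nq // permM tpermR eqxx.
Qed.

(** In each term of the expansion of the minors two of the more than i
    positions of Q use the same column of Y, and their transposition is a
    sign-reversing involution of the sum. *)
Lemma minors_garnir (Y : 'M[C]_(N, i)) : garnir (minors m Y).
Proof.
move=> T Q card_Q.
under eq_bigr do rewrite minorsE mulr_sumr.
rewrite exchange_big big1 //= => c _.
under eq_bigr do rewrite mulrCA.
rewrite -mulr_sumr; set S := \sum_(s | _) _.
suff -> : S = 0 by rewrite mulr0.
have /injectivePn : ~~ injectiveb (fun q : {q | q \in Q} => c (val q).1 (val q).2).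
  apply/negP => /injectiveP /leq_card.
  by rewrite card_ord card_sig leqNgt card_Q.
move=> [[q qQ] [[r rQ] /= nqr cqr]].
have {}nqr : q != r by [].
have tQ : perm_on Q (tperm q r).
  apply: (fintype.subset_trans (tperm_on q r)).
  by apply/fintype.subsetP => z; rewrite !inE => /orP[]/eqP->.
have onM s : perm_on Q (tperm q r * s)%g = perm_on Q s.
  apply/idP/idP; last exact: perm_onM.
  by move/(perm_onM tQ); rewrite mulgA tperm2 mul1g.
apply: eq_opp0; rewrite {1}/S (reindex_inj (mulgI (tperm q r))) -sumrN /=.
apply: eq_big => [s|s _]; first exact: onM.
rewrite odd_permM odd_tperm nqr /= signrN mulNr; congr (- (_ * _)).
rewrite (reindex_inj (@perm_inj _ (tperm q r))) /=; apply: eq_bigr => z _.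
rewrite !ffunE permM tpermK; congr (Y _ _).
by case: tpermP => // ->.
Qed.

(** The positions of Q carry entries at least T (l, t) in row l and at most T
    (l', t) < T (l, t) in the lower row l'; a permutation of Q that does not
    preserve the rows moves larger entries to the lower row. *)
Lemma permute_on_rows T s (l l' : 'I_m) (t : 'I_i) :
  (l < l')%N -> (T (l', t) < T (l, t))%N ->
  (forall t t' : 'I_i, (t < t')%N -> (T (l, t) < T (l, t'))%N) ->
  (forall t t' : 'I_i, (t < t')%N -> (T (l', t) < T (l', t'))%N) ->
  perm_on [set q : pos | (q.1 == l) && (t <= q.2)%N || (q.1 == l') && (q.2 <= t)%N] s ->
  ~~ [forall q, (s q).1 == q.1] ->
  (\sum_(q : pos) q.1 * T q < \sum_(q : pos) q.1 * permute T s q)%N.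
Proof.
move=> ll' Tt rl rl' sQ; rewrite negb_forall => /existsP[q0 nq0].
have monoW (l0 : 'I_m) (r0 : forall t t' : 'I_i, (t < t')%N -> (T (l0, t) < T (l0, t'))%N) (a b : 'I_i) :
    (a <= b)%N -> (T (l0, a) <= T (l0, b))%N.
  by rewrite leq_eqVlt => /orP[/eqP/ord_inj-> //|/r0/ltnW].
rewrite -(ltr_nat int) !natr_sum -subr_gt0.
(* The odd number z separates the doubled entries of Q in row l from those in
   row l', so no F q is negative. *)
pose z : int := 2 * (T (l, t))%:R - 1.
pose F (q : pos) : int := (q.1%:R - (s q).1%:R) * (2 * (T (s q))%:R - z).
have sumF : \sum_q F q = 2 * (\sum_q ((q : pos).1 * permute T s q)%:R - \sum_q ((q : pos).1 * T q)%:R).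
  have S0 : \sum_(q : pos) (q.1%:R - (s q).1%:R) = 0 :> int.
    rewrite sumrB; apply/eqP; rewrite subr_eq0; apply/eqP.
    by rewrite [LHS](reindex_inj (@perm_inj _ s)).
  have -> : \sum_q F q = \sum_(q : pos) (2 * (q.1%:R - (s q).1%:R) * (T (s q))%:R
        - z * (q.1%:R - (s q).1%:R)).
    by apply: eq_bigr => q _; rewrite /F; ring.
  rewrite sumrB -mulr_sumr S0 mulr0 subr0 mulrBr.
  rewrite [\sum_(q : pos) (q.1 * T q)%:R](reindex_inj (@perm_inj _ s)) /= -mulrBr -sumrB mulr_sumr.
  by apply: eq_bigr => q _; rewrite ffunE !natrM; ring.
have Fge0 q : 0 <= F q /\ ((s q).1 != q.1 -> 0 < F q).
  have [e|ne] := eqVneq (s q).1 q.1.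
    by rewrite /F e subrr mul0r.
  suff : 0 < F q by move=> Fq; split => // ; apply: ltW.
  have nq : s q != q by apply: contraNneq ne => ->.
  have : q \in [set q : pos | (q.1 == l) && (t <= q.2)%N || (q.1 == l') && (q.2 <= t)%N].
    by move/fintype.subsetP: sQ; apply; rewrite inE.
  move/[dup]; rewrite -{1}(perm_closed _ sQ) !inE /F.
  move: (s q : pos) ne {nq}; case: q => a u; case=> b v /= ne.
  move=> /orP[] /andP[/eqP eb uv] /orP[] /andP[/eqP ea au]; subst a b.
  - by rewrite eqxx in ne.
  - have := monoW _ rl _ _ uv => Tuv; rewrite /z !natz; apply: mulr_gt0; lia.
  - have := monoW _ rl' _ _ uv => Tuv; rewrite /z !natz -mulrNN; apply: mulr_gt0; lia.
  - by rewrite eqxx in ne.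
have : 0 < \sum_q F q.
  rewrite (bigD1 q0) //= ltr_pwDl ?sumr_ge0 // => [|q _]; last by case: (Fge0 q).
  by case: (Fge0 q0) => _; apply.
by rewrite sumF pmulr_rgt0.
Qed.

(** If x is zero on the standard tableaux, then it is zero: reordering the
    entries of a row, or a Garnir relation at a descent of a column, expresses
    x T through tableaux whose larger entries lie further down. *)
Theorem straightening x : alternating x -> garnir x ->
  (forall T, standard T -> x T = 0) -> forall T, x T = 0.
Proof.
move=> altx garx stdx.
(* Phi grows when larger entries move to later rows, Psi when they move to the
   right within a row. *)
pose Phi T := (\sum_(q : pos) q.1 * T q)%N; pose Psi T := (\sum_(q : pos) q.2 * T q)%N.
pose B := (\sum_(q : pos) m * N)%N; pose B' := (\sum_(q : pos) i * N)%N.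
have PhiB T : (Phi T <= B)%N by apply: leq_sum => q _; rewrite leq_mul // ltnW.
have PsiB T : (Psi T <= B')%N by apply: leq_sum => q _; rewrite leq_mul // ltnW.
suff main k T : (B - Phi T < k)%N -> x T = 0 by move=> T; apply: (main (B - Phi T).+1).
elim: k T => // k IHk T Tk.
have : forall T', (Phi T < Phi T')%N -> x T' = 0.
  by move=> T' TT'; apply: IHk; have := PhiB T'; lia.
move=> {k IHk Tk}.
have [k] := ubnP (B' - Psi T); elim: k => // k IHk in T *; rewrite ltnS => Tk IH.
have [/existsP[l /existsP[t /existsP[t' /andP[tt' Ttt']]]]|rows] := boolP
    [exists l : 'I_m, exists t : 'I_i, exists t' : 'I_i, (t < t')%N && (T (l, t') <= T (l, t))%N].
  have nt : (l, t) != (l, t') by rewrite -pair_eqE /= eqxx -val_eqE /= (ltn_eqF tt').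
  have swap := altx T (l, t) (l, t') erefl nt.
  move: Ttt'; rewrite leq_eqVlt => /orP[/eqP /ord_inj eT|ltT].
    apply: eq_opp0; rewrite -swap; congr (x _); apply/ffunP => q; rewrite ffunE.
    by case: tpermP => // ->.
  apply/eqP; rewrite -oppr_eq0 -swap; apply/eqP.
  have sumE (h : pos -> nat) :
    (\sum_q h q * permute T (tperm (l, t) (l, t')) q =
     h (l, t) * T (l, t') + (h (l, t') * T (l, t)
      + \sum_(q | (q != (l, t)) && (q != (l, t'))) h q * T q))%N.
    rewrite (bigD1 (l, t)) //= ffunE tpermL; congr (_ + _)%N.
    rewrite (bigD1 (l, t')) 1?eq_sym //= ffunE tpermR; congr (_ + _)%N.
    by apply: eq_bigr => q /andP[n1 n2]; rewrite ffunE tpermD // eq_sym.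
  have sumE0 (h : pos -> nat) :
    (\sum_q h q * T q = h (l, t) * T (l, t) + (h (l, t') * T (l, t')
      + \sum_(q | (q != (l, t)) && (q != (l, t'))) h q * T q))%N.
    by rewrite (bigD1 (l, t)) //= (bigD1 (l, t')) 1?eq_sym.
  apply: IHk => [|T' TT'].
    have := PsiB (permute T (tperm (l, t) (l, t'))).
    by move: Tk; rewrite /Psi !sumE !sumE0 /=; nia.
  apply: IH; move: TT'; rewrite /Phi (sumE (fun q => q.1)) (sumE0 (fun q => q.1)) /=; lia.
have {}rows l (t t' : 'I_i) : (t < t')%N -> (T (l, t) < T (l, t'))%N.
  move=> tt'; rewrite ltnNge; apply: contra rows => Ttt'.
  by apply/existsP; exists l; apply/existsP; exists t; apply/existsP; exists t'; rewrite tt'.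
have [/existsP[l /existsP[l' /existsP[t /andP[ll' Tt]]]]|cols] := boolP
    [exists l : 'I_m, exists l' : 'I_m, exists t : 'I_i, (l < l')%N && (T (l', t) < T (l, t))%N].
  (* The end of row l from t on, together with the beginning of row l' up to
     t, has i + 1 positions. *)
  pose Q := [set q : pos | (q.1 == l) && (t <= q.2)%N || (q.1 == l') && (q.2 <= t)%N].
  have nll' : l != l' by rewrite -val_eqE /= (ltn_eqF ll').
  have card_Q : (i < #|Q|)%N.
    pose g (o : option 'I_i) : pos := if o is Some u then (if (t <= u)%N then l else l', u) else (l', t).
    have gI : injective g.
      case=> [u|] [v|] //=; first by case=> _ ->.
        by case=> + uv; rewrite uv leqnn => /eqP; rewrite (negPf nll').
      by case=> + uv; rewrite -uv leqnn => /esym /eqP; rewrite (negPf nll').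
    apply: leq_trans (_ : #|codom g| <= _)%N.
      by rewrite card_codom // card_option card_ord.
    apply/subset_leq_card/fintype.subsetP => _ /codomP[[u|] ->]; rewrite !inE /=.
      by case: ltnP => ut; rewrite eqxx ?ut //= orbC (ltnW ut).
    by rewrite eqxx leqnn orbT.
  have := garx T Q card_Q.
  (* Modulo tableaux with a larger Phi only the permutations that preserve the
     rows remain, and each of them contributes x T. *)
  pose K := \sum_(s | perm_on Q s && [forall q, (s q).1 == q.1]) (1 : C).
  rewrite (bigID (fun s : {perm pos} => [forall q, (s q).1 == q.1])) /=.
  rewrite [X in _ + X]big1 ?addr0 => [|s /andP[sQ ns]]; last first.
    by rewrite IH ?mulr0 //; apply: (permute_on_rows ll' Tt) => //; apply: rows.
  rewrite (eq_bigr (fun => 1 * x T)) -?mulr_suml => [/eqP|s /andP[sQ /forallP rs]].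
    rewrite mulf_eq0 => /orP[/eqP|/eqP //].
    rewrite sumr_const => /eqP; rewrite pnatr_eq0 => /eqP /card0_eq /(_ 1%g).
    rewrite unfold_in perm_on1 /= => /negbT /forallPn [q]; by rewrite perm1 eqxx.
  rewrite alternating_perm // => [|q]; last exact/eqP.
  by rewrite mulrA -expr2 sqrr_sign mul1r.
apply: stdx; apply/andP; split; apply/forallP => l; apply/forallP => a; apply/forallP => b.
  by apply/implyP => /rows.
apply/implyP => la; rewrite leqNgt; apply: contra cols => Tla.
by apply/existsP; exists l; apply/existsP; exists a; apply/existsP; exists b; rewrite la.
Qed.
End Straightening.

(** * Linear independence of standard monomials *)

Section Independence.
Variables (N i : nat).
Local Notation row := {ffun 'I_i -> 'I_N}.
Implicit Types (I J : row) (s : seq row).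

Definition minor (C : comNzRingType) I (Y : 'M[C]_(N, i)) : C :=
  \det (\matrix_(t, u) Y (I t) u).

Definition increasing I := [forall t : 'I_i, forall u : 'I_i, (t < u)%N ==> (I t < I u)%N].

Definition row_le I J := [forall t, (I t <= J t)%N].

Definition row_ge I J := row_le J I.

Lemma increasingP I : reflect {homo I : t u / (t < u)%N} (increasing I).
Proof.
apply: (iffP forallP) => [iI t u tu|iI t]; last by apply/forallP => u; apply/implyP/iI.
by move/forallP: (iI t) => /(_ u) /implyP; apply.
Qed.

Lemma row_ge_trans : transitive row_ge.
Proof.
move=> J I K /forallP JI /forallP KJ; apply/forallP => t.
exact: leq_trans (KJ t) (JI t).
Qed.

Lemma increasing_inj I : increasing I -> injective I.
Proof.
move=> /increasingP iI t u eI; apply/ord_inj; case: (ltngtP t u) => // /iI;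
by rewrite eI ltnn.
Qed.

Variable C : numFieldType.
Implicit Types Y : 'M[C]_(N, i).

(** If J t0 < I t0, the rows I t with t >= t0 vanish in the columns up to t0;
    this block of zeros meets every term of the determinant. *)
Lemma minor_schubert0 I J Y : increasing I -> increasing J -> ~~ row_le I J ->
  schubert J Y -> minor I Y = 0.
Proof.
move=> /increasingP iI /increasingP iJ; rewrite negb_forall => /existsP[t0].
rewrite -ltnNge => Jt0 sY; rewrite /minor /determinant big1 // => s _.
suff [t t0t st0] : exists2 t : 'I_i, (t0 <= t)%N & (s t <= t0)%N.
  rewrite (bigD1 t) //= mxE sY ?mul0r ?mulr0 //.
  have le_iJ (a b : 'I_i) : (a <= b)%N -> (J a <= J b)%N.
    by rewrite leq_eqVlt => /orP[/eqP/ord_inj->|/iJ/ltnW].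
  apply: leq_ltn_trans (le_iJ _ _ st0) _; apply: leq_trans Jt0 _.
  by move: t0t; rewrite leq_eqVlt => /orP[/eqP/ord_inj->|/iI/ltnW].
have [/existsP[t /andP[]]|/existsPn no] :=
  boolP [exists t : 'I_i, (t0 <= t)%N && (s t <= t0)%N]; first by exists t.
have : (#|[set t : 'I_i | (t0 <= t)%N]| <= #|[set t : 'I_i | (t0 < t)%N]|)%N.
  rewrite -(card_imset _ (@perm_inj _ s)) subset_leq_card //.
  apply/fintype.subsetP => _ /imsetP[t + ->]; rewrite !inE => t0t.
  by have := no t; rewrite t0t -ltnNge.
rewrite leqNgt proper_card //; apply/properP; split.
  by apply/fintype.subsetP => t; rewrite !inE; apply: ltnW.
by exists t0; rewrite !inE ?leqnn ?ltnn.
Qed.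

Lemma minor_line I (Y Y' : 'M[C]_(N, i)) x :
  (minor I (line_mx Y Y')).[x] = minor I (Y + x *: Y').
Proof.
rewrite -line_mxE -[LHS]/(horner_eval x _) -det_map_mx; congr (\det _).
by apply/matrixP => t u; rewrite !mxE.
Qed.

(** The minor of w does not vanish on a dense part of its Schubert cell: along
    the line from Y to the frame of w it is a characteristic polynomial. *)
Lemma minor_cancel w (G : 'M[{poly C}]_(N, i) -> {poly C}) (g : 'M[C]_(N, i) -> C) :
  increasing w ->
  (forall Y Y' x, (G (line_mx Y Y')).[x] = g (Y + x *: Y')) ->
  (forall Y, schubert w Y -> minor w Y * g Y = 0) ->
  forall Y, schubert w Y -> g Y = 0.
Proof.
move=> iw Gg wg Y sY; set E : 'M[C]_(N, i) := frame C w.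
have /increasingP wM := iw.
have sYE x : schubert w (Y + x *: E).
  move=> a t wa; rewrite !mxE sY // add0r -val_eqE /=.
  by rewrite (gtn_eqF wa) mulr0.
have /eqP : minor w (line_mx Y E) * G (line_mx Y E) = 0.
  by apply: poly_all0 => x; rewrite hornerM minor_line Gg wg.
rewrite mulf_eq0 => /orP[/eqP w0|/eqP G0]; last first.
  by have := Gg Y E 0; rewrite G0 horner0 scale0r addr0.
have : char_poly (- \matrix_(t, u) Y (w t) u) = 0.
  rewrite -w0; congr (\det _); apply/matrixP => t u; rewrite !mxE.
  by rewrite (inj_eq (increasing_inj iw)) polyCN opprK addrC rmorph_nat mulr_natr.
by move/eqP; rewrite (negPf (monic_neq0 (char_poly_monic _))).
Qed.

(** Products over chains w >= I1 >= I2 >= ... , by induction on their length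
    and on w. On the Schubert cell of I < w only the products with I1 <= I
    survive, so by induction the coefficients of the products with I1 < w
    vanish; the other products share the factor of w, which can be cancelled.
    *)
Lemma minor_chains_free (K : eqType) (f : K -> C) m w (S : seq K) (r : K -> seq row) :
  increasing w -> uniq S -> {in S &, injective r} ->
  (forall k, k \in S -> [/\ size (r k) = m, all increasing (r k) & path row_ge w (r k)]) ->
  (forall Y, schubert w Y -> \sum_(k <- S) f k * \prod_(I <- r k) minor I Y = 0) ->
  forall k, k \in S -> f k = 0.
Proof.
elim: m w S r => [|m IHm] w S r.
  move=> _ uS rI rP f0 k kS; have rnil k' : k' \in S -> r k' = [::].
    by move=> /rP[/size0nil].
  have : schubert w (0 : 'M[C]_(N, i)) by move=> a t _; rewrite mxE.
  move/f0; rewrite (bigD1_seq k) //= [X in _ + X]big1_seq => [|k' /andP[nk k'S]].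
    by rewrite rnil // big_nil mulr1 addr0.
  have e : k' = k by apply: rI => //; rewrite !rnil.
  by rewrite e eqxx in nk.
have [d] := ubnP (\sum_t w t); elim: d => // d IHd in w S *.
rewrite ltnS => wd iw uS rI rP f0.
have headP k : k \in S -> exists I s, [/\ r k = I :: s, increasing I & row_le I w].
  move=> /rP[]; case: (r k) => // I s _ /= /andP[iI _] /andP[wI _].
  by exists I, s.
have small k : k \in S -> head w (r k) != w -> f k = 0.
  move=> kS; have [I [s [rk iI Iw]]] := headP k kS; rewrite rk /= => nIw.
  pose S' := [seq k <- S | row_le (head w (r k)) I].
  apply: (IHd I S') => //.
  - apply: leq_trans wd; move/forallP: Iw => Iw.
    have /existsP[t nt] : [exists t, I t != w t].
      rewrite -negb_forall; apply: contra nIw => /forallP e.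
      by apply/eqP/ffunP => t; apply/eqP.
    rewrite (bigD1 t) //= [X in (_ < X)%N](bigD1 t) //= -addSn leq_add ?leq_sum //.
    by rewrite ltn_neqAle val_eqE nt Iw.
  - exact: filter_uniq.
  - by move=> x y; rewrite !mem_filter => /andP[_ xS] /andP[_ yS]; apply: rI.
  - move=> k'; rewrite mem_filter => /andP[hk' /rP[-> -> pk']]; split=> //.
    by case: (r k') hk' pk' => //= J s' JI /andP[_ ->]; rewrite andbT.
  - move=> Y sY; rewrite big_filter -[RHS](f0 Y); last first.
      by move=> a t wa; apply: sY; apply: leq_ltn_trans wa; move/forallP: Iw; apply.
    rewrite big_mkcond; apply: eq_big_seq => k' k'S.
    case: ifPn => // nhk'; have [J [s' [rk' iJ Jw]]] := headP k' k'S.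
    rewrite rk' big_cons (minor_schubert0 iJ iI _ sY) ?mul0r ?mulr0 //.
    by rewrite rk' in nhk'.
  - by rewrite mem_filter rk /= kS andbT; apply/forallP => t.
move=> k kS; have [hk|/small] := eqVneq (head w (r k)) w; last exact.
pose S' := [seq k <- S | head w (r k) == w].
apply: (IHm w S' (behead \o r)) => //.
- exact: filter_uniq.
- move=> x y; rewrite !mem_filter => /andP[/eqP hx xS] /andP[/eqP hy yS] /= bxy.
  apply: rI => //; have [I [s [ex _ _]]] := headP x xS.
  have [I' [s' [ey _ _]]] := headP y yS.
  by move: hx hy bxy; rewrite ex ey /= => -> -> ->.
- move=> k'; rewrite mem_filter => /andP[/eqP + /rP[]] /=.
  by case: (r k') => //= J s' -> [->] /andP[_ ->] /andP[_ ->].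
- pose g (D : comNzRingType) (c : C -> D) (Y : 'M[D]_(N, i)) :=
    \sum_(k <- S') c (f k) * \prod_(I <- behead (r k)) minor I Y.
  apply: (@minor_cancel w (g _ polyC) (g _ id)) => // [Y Y' x|Y sY].
    rewrite horner_sum; apply: eq_bigr => k' _; rewrite hornerM hornerC.
    by rewrite horner_prod; congr (_ * _); apply: eq_bigr => I _; rewrite minor_line.
  rewrite -[RHS](f0 Y) // mulr_sumr big_filter big_mkcond.
  apply: eq_big_seq => k' k'S; case: ifPn => [/eqP hw|nw]; last first.
    by rewrite small // mul0r.
  have [I [s [e _ _]]] := headP k' k'S; move: hw; rewrite e /= => ->.
  by rewrite big_cons mulrCA.
- by rewrite mem_filter hk eqxx.
Qed.

Variable m : nat.
Local Notation idx := {ffun 'I_m * 'I_i -> 'I_N}.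

Definition tableau_row (T : idx) l : row := [ffun t => T (l, t)].

Definition below w (T : idx) := [forall l : 'I_m, row_le (tableau_row T l) w].

Lemma minors_rows Y T : minors m Y T = \prod_l minor (tableau_row T l) Y.
Proof.
rewrite ffunE; apply: eq_bigr => l _; congr (\det _).
by apply/matrixP => t u; rewrite !mxE ffunE.
Qed.

Lemma standard_increasing T l : standard T -> increasing (tableau_row T l).
Proof.
move=> /andP[/forallP /(_ l) /forallP sr _]; apply/forallP => t; apply/forallP => u.
by have /forallP/(_ u) := sr t; rewrite !ffunE.
Qed.

(** The rows of a standard tableau, from the last to the first, form a chain
    below w, so this is the linear independence of products of minors over
    chains. *)
Theorem standard_free w (f : idx -> C) :
  increasing w -> (forall T, f T != 0 -> standard T && below w T) ->
  (forall Y, schubert w Y -> \sum_T f T * minors m Y T = 0) -> forall T, f T = 0.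
Proof.
move=> iw fS f0.
pose r T := [seq tableau_row T l | l <- rev (enum 'I_m)].
pose S := [seq T <- enum {: idx} | standard T && below w T].
have minorsE Y T : minors m Y T = \prod_(I <- r T) minor I Y.
  by rewrite big_map (perm_big (enum 'I_m)) ?perm_rev // big_enum minors_rows.
have mS T : (T \in S) = standard T && below w T by rewrite mem_filter mem_enum andbT.
have rS T : T \in S ->
    [/\ size (r T) = m, all increasing (r T) & path row_ge w (r T)].
  rewrite mS => /andP[sT /forallP bT]; have /andP[_ /forallP sc] := sT; split.
  - by rewrite size_map size_rev size_enum_ord.
  - by rewrite all_map all_rev; apply/allP => l _; apply: standard_increasing.
  - rewrite (path_sortedE row_ge_trans); apply/andP; split.
      by apply/allP => _ /mapP[l _ ->]; apply: bT.
    rewrite sorted_map rev_sorted; apply: (@sub_sorted _ (relpre val ltn)).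
      move=> l l' /= ll'; apply/forallP => t; rewrite !ffunE.
      by have /forallP/(_ l')/forallP/(_ t)/implyP := sc l; apply.
    by rewrite -sorted_map val_enum_ord iota_ltn_sorted.
move=> T; have [//|/fS] := eqVneq (f T) 0; rewrite -mS => TS.
apply: (@minor_chains_free _ f m w S r) => //.
- by rewrite filter_uniq ?enum_uniq.
- move=> T1 T2 _ _ /eq_in_map e; apply/ffunP => -[l t].
  have /e/ffunP/(_ t) : l \in rev (enum 'I_m) by rewrite mem_rev mem_enum.
  by rewrite !ffunE.
- move=> Y sY; rewrite -[RHS](f0 Y) // big_filter big_enum_cond big_mkcond.
  apply: eq_bigr => T' _; rewrite minorsE; case: ifPn => // nS.
  by have [->|/fS] := eqVneq (f T') 0; rewrite ?mul0r // => ok; rewrite ok in nS.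
Qed.

(** The straightening relations are relations on the Schubert cell, and so are
    the vanishings of the standard monomials that are not below w. *)
Theorem schubert_spanning w (x : idx -> C) :
  increasing w ->
  (forall f : idx -> C, (forall Y, schubert w Y -> \sum_T f T * minors m Y T = 0) ->
     \sum_T f T * x T = 0) ->
  (forall T, standard T -> below w T -> x T = 0) -> forall T, x T = 0.
Proof.
move=> iw relx x0.
have rel (I : finType) (P : pred I) (h : I -> C) (g : I -> idx) :
    (forall Y, schubert w Y -> \sum_(k | P k) h k * minors m Y (g k) = 0) -> \sum_(k | P k) h k * x (g k) = 0.
  move=> h0; pose f T := \sum_(k | P k && (g k == T)) h k.
  have E (z : idx -> C) : \sum_(k | P k) h k * z (g k) = \sum_T f T * z T.
    rewrite (partition_big g predT) //=; apply: eq_bigr => T _.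
    by rewrite mulr_suml; apply: eq_bigr => k /andP[_ /eqP ->].
  by rewrite E relx // => Y sY; rewrite -E h0.
apply: straightening => [T q r eqr nqr|T Q cQ|T sT].
- have := rel bool predT (fun b : bool => 1) (fun b : bool => if b then permute T (tperm q r) else T).
  rewrite big_bool /= !mul1r => H; apply/eqP; rewrite -addr_eq0 H // => Y _.
  by rewrite big_bool /= !mul1r minors_alternating // addNr.
- by apply: (rel _ _ (fun s : {perm 'I_m * 'I_i} => (-1) ^+ s)) => Y _; apply: minors_garnir.
have [|/forallPn[l nl]] := boolP (below w T); first exact: x0.
have := rel 'I_1 predT (fun => 1) (fun => T); rewrite big_ord1 mul1r; apply=> Y sY.
rewrite big_ord1 mul1r minors_rows (bigD1 l) //=.
by rewrite (minor_schubert0 (standard_increasing l sT) iw nl sY) mul0r.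
Qed.
End Independence.

(** * Dimensions of spaces of tensors *)

Section Masks.
Variables (C : fieldType) (I : finType).
Local Notation fct := {ffun I -> C^o}.
Implicit Types (U : {vspace fct}) (d : I -> C) (z : fct).

Definition mask (P : pred I) z : fct := [ffun T => if P T then z T else 0].

(** Lagrange interpolation: the projection onto an eigenspace of a diagonal
    operator is a polynomial in this operator. *)
Lemma mask_eigen U d c z :
  (forall z, z \in U -> ([ffun T => d T * z T] : fct) \in U) ->
  z \in U -> mask (fun T => d T == c) z \in U.
Proof.
move=> dU zU.
have prodU (s : seq C) : ([ffun T => \prod_(e <- s) (d T - e) * z T] : fct) \in U.
  elim: s => [|e s IH].
    by rewrite (_ : finfun _ = z) //; apply/ffunP => T; rewrite ffunE big_nil mul1r.
  rewrite (_ : finfun _ = ([ffun T => d T * ([ffun T => \prod_(e <- s) (d T - e) * z T] : fct) T] : fct)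
     - e *: ([ffun T => \prod_(e <- s) (d T - e) * z T] : fct)).
    by apply: memvB; [apply: dU | apply: memvZ].
  by apply/ffunP => T; rewrite !ffunE big_cons scaleoE; ring.
pose s := [seq e <- [seq d T | T <- enum I] | e != c].
pose q := \prod_(e <- s) (c - e).
have nzq : q != 0.
  rewrite prodf_seq_neq0; apply/allP => e; rewrite mem_filter => /andP[ne _].
  by rewrite subr_eq0 eq_sym.
have -> : mask (fun T => d T == c) z =
    q^-1 *: ([ffun T => \prod_(e <- s) (d T - e) * z T] : fct).
  apply/ffunP => T; rewrite !ffunE scaleoE; case: eqP => [->|/eqP ndT].
    by rewrite mulKf.
  rewrite (big_rem (d T)) /= ?subrr ?mul0r ?mulr0 // /s mem_filter ndT.
  by rewrite map_f ?mem_enum.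
exact: memvZ.
Qed.

Lemma mask_eigens U (J : finType) (d : J -> I -> C) (c : J -> C) z :
  (forall j z, z \in U -> ([ffun T => d j T * z T] : fct) \in U) ->
  z \in U -> mask (fun T => [forall j, d j T == c j]) z \in U.
Proof.
move=> dU zU.
have sU (s : seq J) : mask (fun T => all (fun j => d j T == c j) s) z \in U.
  elim: s => [|j s IH]; first by rewrite (_ : mask _ z = z) //; apply/ffunP => T; rewrite ffunE.
  rewrite (_ : mask _ z = mask (fun T => d j T == c j)
     (mask (fun T => all (fun j => d j T == c j) s) z)).
    by apply: (mask_eigen (d := d j)) => // z'; apply: dU.
  by apply/ffunP => T; rewrite !ffunE /=; case: eqP.
rewrite (_ : mask _ z = mask (fun T => all (fun j => d j T == c j) (enum J)) z) //.
apply/ffunP => T; rewrite !ffunE; congr (if _ then _ else _).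
apply/forallP/allP => [h j _ //|h j]; apply: h; exact: mem_enum.
Qed.

End Masks.

Section Dimension.
Variables (C : numFieldType) (N m i : nat).
Local Notation idx := {ffun 'I_m * 'I_i -> 'I_N}.
Local Notation tns := {ffun idx -> C^o}.

(** The coordinates at the good standard tableaux below w identify B with a
    coordinate space: they determine an element of B because standard
    monomials span, and a linear form that vanishes on the image of B would be
    a relation between standard monomials. *)
Theorem standard_dim (w : {ffun 'I_i -> 'I_N}) (U B : {vspace tns}) (good : pred idx) :
  increasing w ->
  (forall Y, schubert w Y -> minors m Y \in U) ->
  (forall f : idx -> C,
     (forall Y, schubert w Y -> \sum_T f T * minors m Y T = 0) ->
     forall z : tns, z \in U -> \sum_T f T * z T = 0) ->
  (forall z : tns, z \in U -> mask good z \in U) ->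
  (forall z : tns, z \in B <-> z \in U /\ forall T, ~~ good T -> z T = 0) ->
  \dim B = #|[set T : idx | [&& standard T, below w T & good T]]|.
Proof.
move=> iw sU relU maskU BE; set G := [set T | _].
pose res (z : tns) : 'rV[C]_#|G| := \row_k z (enum_val k).
have resL : linear res.
  by move=> a x y; apply/rowP => k; rewrite !mxE !ffunE.
pose resH := GRing.isLinear.Build _ _ _ _ res resL.
pose resf : {linear tns -> 'rV[C]_#|G|} := HB.pack res resH.
pose L := (linfun resf @: B)%VS.
have resE z : linfun resf z = res z by rewrite lfunE.
have <- : \dim L = \dim B.
  apply: limg_dim_eq; apply/eqP; rewrite -subv0; apply/subvP => z.
  rewrite memv_cap memv_ker resE memv0 => /andP[/BE[zU zB] /eqP rz].
  have z0 : forall T, z T = 0.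
    apply: (schubert_spanning iw) => [f f0|T sT bT]; first exact: relU.
    have [gT|/zB //] := boolP (good T).
    have TG : T \in G by rewrite inE sT bT.
    move/rowP/(_ (enum_rank_in TG T)): rz; rewrite !mxE enum_rankK_in //.
  by apply/eqP/ffunP => T; rewrite z0 ffunE.
suff -> : L = fullv by rewrite dimvf /dim /= mul1n.
apply/eqP; rewrite eqEsubv subvf; apply/subvP => b _.
apply: contraT => nb; have nphi : b - projv L b != 0.
  by apply: contra nb; rewrite subr_eq0 => /eqP ->; apply: memv_proj.
have [k0 nk0] : exists k0, (b - projv L b) 0 k0 != 0.
  by apply/existsP; apply: contraR nphi => /existsPn h; apply/eqP/rowP => k; rewrite [RHS]mxE; apply/eqP; rewrite -[_ == _]negbK; apply: h.
(* A linear form that vanishes on L but not at b. *)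
pose phi (y : 'rV[C]_#|G|) : C := (y - projv L y) 0 k0.
have phiE y : phi y = \sum_k y 0 k * phi (delta_mx 0 k).
  rewrite {1}/phi {1 2}[y]row_sum_delta linear_sum -sumrB summxE.
  by apply: eq_bigr => k _; rewrite linearZ -scalerBr mxE.
have phiL y : y \in L -> phi y = 0 by move=> yL; rewrite /phi projv_id // subrr mxE.
pose f (T : idx) := \sum_(k | enum_val k == T) phi (delta_mx 0 k).
have f0 T : f T = 0.
  apply: (@standard_free _ _ _ _ w) => // [T' |Y sY].
    apply: contraR => nT; rewrite /f big_pred0 // => k; apply: contraNF nT => /eqP <-.
    by have := enum_valP k; rewrite inE => /and3P[-> ->].
  pose z := mask good (minors m Y).
  have zB : z \in B.
    by apply/BE; split=> [|T' /negPf nT]; [apply/maskU/sU | rewrite ffunE nT].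
  transitivity (phi (res z)); last by rewrite phiL // -resE memv_img.
  rewrite phiE; under eq_bigr do rewrite mulr_suml.
  rewrite (exchange_big_dep predT) //=; apply: eq_bigr => k _.
  rewrite (big_pred1 (enum_val k)) => [|T']; last by rewrite /= eq_sym.
  rewrite [res z 0 k]mxE [z _]ffunE mulrC; have := enum_valP k.
  by rewrite inE => /and3P[_ _ ->].
case/eqP: nk0; rewrite -/(phi b) phiE big1 // => k _.
have <- : f (enum_val k) = phi (delta_mx 0 k).
  by rewrite /f (big_pred1 k) // => k'; rewrite (inj_eq enum_val_inj).
by rewrite f0 mulr0.
Qed.

End Dimension.

(** * Highest weight vectors *)

(** A subspace of maximal dimension inside Q exhausts Q. *)
Lemma vspace_of_pred (K : fieldType) (V : vectType K) (Q : V -> Prop) :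
  Q 0 -> (forall a x y, Q x -> Q y -> Q (a *: x + y)) ->
  exists U : {vspace V}, forall x, x \in U <-> Q x.
Proof.
move=> Q0 Ql.
pose ok k := `[< exists2 U : {vspace V}, \dim U = k & forall x, x \in U -> Q x >].
have ok0 : exists k, ok k.
  by exists 0%N; apply/asboolP; exists 0%VS; rewrite ?dimv0 // => x; rewrite memv0 => /eqP->.
have okB k : ok k -> (k <= \dim {:V})%N by move=> /asboolP[U <- _]; rewrite dimvS ?subvf.
case: (ex_maxnP ok0 okB) => k /asboolP[U dU UQ] kmax; exists U => x; split=> [/UQ //|Qx].
apply: contraT => nxU; have /kmax : ok (\dim (U + <[x]>)).
  apply/asboolP; exists (U + <[x]>)%VS => // y /memv_addP[u uU [_ /vlineP[a ->] ->]].
  by rewrite addrC; apply/Ql/UQ.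
rewrite -dU leqNgt ltn_neqAle dimvS ?addvSl // andbT negbK => /eqP e.
case/negP: nxU; have -> : U = (U + <[x]>)%VS by apply/eqP; rewrite eqEdim addvSl -e leqnn.
by rewrite (subvP (addvSr U <[x]>)) ?memv_line.
Qed.

Section Generated.
Variables (K : fieldType) (n : nat) (X : lmodType K) (op : 'M[K]_n.+1 -> X -> X).
Hypothesis opL : forall A a x y, op A (a *: x + y) = a *: op A x + op A y.

(** The analogue of in_Ub for any set P of generators and any linear action.
    *)
Definition generated (P : 'M[K]_n.+1 -> Prop) (v x : X) : Prop :=
  exists ws : seq (K * seq 'M[K]_n.+1),
    (forall p, p \in ws -> forall A, A \in p.2 -> P A) /\
    x = \sum_(p <- ws) p.1 *: foldr op v p.2.

Variables (P : 'M[K]_n.+1 -> Prop) (v : X).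

Lemma op0 A : op A 0 = 0.
Proof. by have := opL A (-1) 0 0; rewrite scaler0 addr0 scaleN1r addNr. Qed.

Lemma opD A x y : op A (x + y) = op A x + op A y.
Proof. by have := opL A 1 x y; rewrite !scale1r. Qed.

Lemma opZ A a x : op A (a *: x) = a *: op A x.
Proof. by have := opL A a x 0; rewrite !addr0 op0 addr0. Qed.

Lemma generated_id : generated P v v.
Proof.
exists [:: (1, [::])]; split; last by rewrite big_seq1 scale1r.
by move=> p; rewrite inE => /eqP-> A.
Qed.

Lemma generatedL a x y : generated P v x -> generated P v y -> generated P v (a *: x + y).
Proof.
move=> [s [sP ->]] [t [tP ->]]; exists ([seq (a * p.1, p.2) | p <- s] ++ t); split.
  move=> p; rewrite mem_cat => /orP[/mapP[q qs ->]|]; [exact: sP qs | exact: tP].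
rewrite big_cat big_map scaler_sumr; congr (_ + _).
by apply: eq_bigr => p _; rewrite scalerA.
Qed.

Lemma generated0 : generated P v 0.
Proof. by exists [::]; rewrite big_nil. Qed.

Lemma generated_op A x : P A -> generated P v x -> generated P v (op A x).
Proof.
move=> PA [s [sP ->]]; exists [seq (p.1, A :: p.2) | p <- s]; split.
  by move=> _ /mapP[q qs ->] B; rewrite inE => /orP[/eqP-> //|]; apply: sP qs B.
rewrite big_map; elim: s {sP} => [|p s IH]; first by rewrite !big_nil op0.
by rewrite !big_cons opL IH.
Qed.

Lemma generated_ind (Q : X -> Prop) :
  Q v -> (forall a x y, Q x -> Q y -> Q (a *: x + y)) ->
  (forall A x, P A -> Q x -> Q (op A x)) -> forall x, generated P v x -> Q x.
Proof.
move=> Qv QL Qop _ [s [sP ->]].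
have Q0 : Q 0 by have := QL (-1) v v Qv Qv; rewrite scaleN1r addNr.
elim: s sP => [|[a l] s IH] sP; first by rewrite big_nil.
rewrite big_cons; apply: QL; last first.
  by apply: IH => p ps; apply: sP; rewrite inE ps orbT.
have {sP} /= := sP (a, l) (mem_head _ _).
elim: l => //= A l IHl lP; apply: Qop; first by apply: lP; rewrite mem_head.
by apply: IHl => B Bl; apply: lP; rewrite inE Bl orbT.
Qed.

End Generated.

Section Cartan.
Variables (K : fieldType) (n : nat).
Implicit Types (H : 'M[K]_n.+1) (lam : 'rV[K]_n.+1).

Lemma mxtrace_delta (a b : 'I_n.+1) : \tr (delta_mx a b : 'M[K]_n.+1) = (a == b)%:R.
Proof.
rewrite /mxtrace (bigD1 a) //= big1 => [|k nk]; first by rewrite mxE eqxx addr0.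
by rewrite mxE (negPf nk).
Qed.

Lemma in_sl_lin (a : K) (A B : 'M[K]_n.+1) : in_sl A -> in_sl B -> in_sl (a *: A + B).
Proof. by rewrite /in_sl linearD linearZ /= => -> ->; rewrite addr0; exact: mulr0. Qed.

Lemma in_sl_bracket (A B : 'M[K]_n.+1) : in_sl (A *m B - B *m A).
Proof. by rewrite /in_sl linearB /= mxtrace_mulC subrr. Qed.

Lemma wt_eval_lin lam a H H' :
  wt_eval lam (a *: H + H') = a * wt_eval lam H + wt_eval lam H'.
Proof.
rewrite /wt_eval mulr_sumr -big_split; apply: eq_bigr => k _ /=.
by rewrite !mxE; ring.
Qed.

Lemma wt_eval0 lam : wt_eval lam 0 = 0.
Proof. by rewrite /wt_eval big1 // => k _; rewrite mxE mulr0. Qed.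

Lemma coroot_in_h r : in_h (coroot K r : 'M_n.+1).
Proof.
split; first by rewrite /in_sl linearB /= !mxtrace_delta !eqxx subrr.
apply/is_diag_mxP => a b nab; rewrite !mxE.
have ne (c : 'I_n.+1) : (a == c) && (b == c) = false.
  by apply: contraNF nab => /andP[/eqP-> /eqP->].
by rewrite !ne subrr.
Qed.

(** The coroots span h: the coordinates of H are the partial traces. *)
Lemma in_h_coroots H : in_h H ->
  H = \sum_(r < n) (\sum_(k < n.+1 | (k <= r)%N) H k k) *: coroot K r.
Proof.
move=> [slH /is_diag_mxP dH]; apply/matrixP => a b; rewrite summxE.
have [ab|nab] := eqVneq a b; last first.
  rewrite dH // big1 // => r _; rewrite mxE.
  by have [_ /is_diag_mxP ->] := coroot_in_h r; rewrite ?mulr0.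
pose c (j : nat) := \sum_(k < n.+1 | (k < j)%N) H k k.
rewrite -{b}ab (eq_bigr (fun r : 'I_n =>
   (r == a :> nat)%:R * c r.+1 - (r.+1 == a :> nat)%:R * c r.+1)) => [|r _]; last first.
  by rewrite !mxE !andbb -!val_eqE /= mulrC mulrBl ![(val a) == _]eq_sym.
have cn : c n.+1 = 0.
  by rewrite -[RHS]slH; apply: eq_bigl => k; rewrite ltn_ord.
have cS (k : 'I_n.+1) : c k.+1 = H k k + c k.
  rewrite /c (bigD1 k) //=; congr (_ + _); apply: eq_bigl => j.
  by rewrite ltnS andbC ltn_neqAle.
rewrite sumrB.
have E1 : \sum_(r < n) (r == a :> nat)%:R * c r.+1 = c a.+1.
  have [an|na] := ltnP a n.
    rewrite (bigD1 (Ordinal an)) //= eqxx mul1r big1 ?addr0 // => r.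
    by rewrite -val_eqE /= => /negPf ->; rewrite mul0r.
  have -> : c a.+1 = 0 by have -> : nat_of_ord a = n by have := ltn_ord a; lia.
  by rewrite big1 // => r _; rewrite ltn_eqF ?mul0r // (leq_trans (ltn_ord r)).
have E2 : \sum_(r < n) (r.+1 == a :> nat)%:R * c r.+1 = c a.
  case: a {E1} => -[|a] /= an.
    by rewrite /c !big1 // => r _; rewrite mul0r.
  rewrite (bigD1 (Ordinal (an : (a < n)%N))) //= eqxx mul1r big1 ?addr0 // => r.
  by rewrite -val_eqE eqSS /= => /negPf ->; rewrite mul0r.
by rewrite E1 E2 cS addrK.
Qed.

End Cartan.

Lemma sum_ord_double n : (2 * \sum_(k < n.+1) k = n * n.+1)%N.
Proof.
by elim: n => [|n IH]; rewrite ?big_ord1 // big_ord_recr /= mulnDr IH; lia.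
Qed.

Section HighestWeight.
Variables (K : numFieldType) (n : nat) (X : lmodType K) (op : 'M[K]_n.+1 -> X -> X).
Hypothesis opL : forall A a x y, op A (a *: x + y) = a *: op A x + op A y.
Hypothesis opM : forall a A B x, in_sl A -> in_sl B ->
  op (a *: A + B) x = a *: op A x + op B x.
Hypothesis op_bracket : forall A B x, in_sl A -> in_sl B ->
  op (A *m B - B *m A) x = op A (op B x) - op B (op A x).

Lemma in_sl0 : in_sl (0 : 'M[K]_n.+1).
Proof. by rewrite /in_sl linear0. Qed.

Lemma op0m x : op 0 x = 0.
Proof. by have := opM (-1) x in_sl0 in_sl0; rewrite scaler0 addr0 scaleN1r addNr. Qed.

Lemma op_sum (I : finType) (c : I -> K) (F : I -> 'M[K]_n.+1) x :
  (forall k, in_sl (F k)) ->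
  in_sl (\sum_k c k *: F k) /\ op (\sum_k c k *: F k) x = \sum_k c k *: op (F k) x.
Proof.
move=> slF; elim/big_rec2: _ => [|k y A _ [slA <-]]; first by split; [exact: in_sl0 | exact: op0m].
by split; [apply: in_sl_lin | apply: opM].
Qed.

Lemma op_weight lam x :
  (forall r : 'I_n, op (coroot K r) x = wt_eval lam (coroot K r) *: x) ->
  forall H, in_h H -> op H x = wt_eval lam H *: x.
Proof.
move=> hx H hH; rewrite (in_h_coroots hH).
have -> : forall c : 'I_n -> K, wt_eval lam (\sum_r c r *: coroot K r) =
    \sum_r c r * wt_eval lam (coroot K r).
  by move=> c; elim/big_rec2: _ => [|r y A _ <-]; rewrite ?wt_eval0 ?wt_eval_lin.
rewrite (op_sum _ _ _).2 => [|r]; last by case: (coroot_in_h K r).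
by rewrite scaler_suml; apply: eq_bigr => r _; rewrite hx scalerA.
Qed.

Definition lowering (A : 'M[K]_n.+1) :=
  exists a b : 'I_n.+1, (b < a)%N /\ A = delta_mx a b.

Lemma lowering_sl A : lowering A -> in_sl A.
Proof.
by move=> [a [b [ba ->]]]; rewrite /in_sl mxtrace_delta -val_eqE (gtn_eqF ba).
Qed.

Variables (lam : 'rV[K]_n.+1) (x0 : X).
Hypothesis x0_upper : forall A, in_nplus A -> op A x0 = 0.
Hypothesis x0_weight : forall H, in_h H -> op H x0 = wt_eval lam H *: x0.

(** A highest weight vector generates its module under lowering operators
    alone: sl x0 only involves lowering operators, and a bracket of a lowering
    operator with sl stays in sl. *)
Lemma generated_lowering x :
  generated op (@in_sl K n) x0 x -> generated op lowering x0 x.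
Proof.
have gL := generatedL (op := op) (P := lowering) (v := x0).
have base A : in_sl A -> generated op lowering x0 (op A x0).
  move=> slA.
  pose L := \sum_(k : 'I_n.+1 * 'I_n.+1)
    (if (k.2 < k.1)%N then A k.1 k.2 else 0) *:
    (if (k.2 < k.1)%N then delta_mx k.1 k.2 else 0 : 'M[K]_n.+1).
  have slk (k : 'I_n.+1 * 'I_n.+1) :
      in_sl (if (k.2 < k.1)%N then delta_mx k.1 k.2 else 0 : 'M[K]_n.+1).
    case: ifP => lk; last exact: in_sl0.
    by apply: lowering_sl; exists k.1, k.2.
  have LE a b : L a b = if (b < a)%N then A a b else 0.
    rewrite summxE (bigD1 (a, b)) //= big1 => [|[c d] ncd]; last first.
      rewrite mxE /=; case: ifP => _; rewrite ?mul0r // mxE.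
      rewrite (_ : _ && _ = false) ?mulr0 //.
      by apply: contraNF ncd => /andP[/eqP-> /eqP->].
    by rewrite addr0 mxE; case: ifP; rewrite ?mul0r // mxE !eqxx mulr1.
  pose D : 'M[K]_n.+1 := \matrix_(a, b) (if a == b then A a b else 0).
  pose U : 'M[K]_n.+1 := \matrix_(a, b) (if (a < b)%N then A a b else 0).
  have [slL opL0] := op_sum (fun k : 'I_n.+1 * 'I_n.+1 => if (k.2 < k.1)%N then A k.1 k.2 else 0) x0 slk.
  have AE : A = 1 *: L + (1 *: D + U).
    rewrite !scale1r; apply/matrixP => a b; rewrite [RHS]mxE LE !mxE -val_eqE /=.
    by case: ltngtP; rewrite ?addr0 ?add0r.
  have slU : in_sl U.
    by rewrite /in_sl /mxtrace big1 // => k _; rewrite mxE ltnn.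
  have hD : in_h D.
    split; last by apply/is_diag_mxP => a b nab; rewrite mxE -[a == b]val_eqE (negPf nab).
    by rewrite /in_sl -[RHS](slA : \tr A = 0); apply: eq_bigr => k _; rewrite mxE eqxx.
  have nU : in_nplus U by move=> a b ba; rewrite mxE ltnNge ba.
  have slDU : in_sl (1 *: D + U) by apply: in_sl_lin => //; case: hD.
  rewrite AE opM // opM //; last by case: hD.
  rewrite (x0_weight hD) (x0_upper nU) addr0 !scale1r.
  rewrite addrC; apply: (gL); first exact: generated_id.
  rewrite opL0; elim/big_rec: _ => [|k y _ IH]; first exact: generated0.
  apply: (gL) => //; case: ifP => lk; last by rewrite op0m; apply: generated0.
  by apply: generated_op => //; [exists k.1, k.2 | apply: generated_id].
have closed y : generated op lowering x0 y ->
    generated op lowering x0 y /\ forall A, in_sl A -> generated op lowering x0 (op A y).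
  elim/generated_ind: y / => [|a y z [gy Hy] [gz Hz]|E y lE [gy Hy]].
  - by split; [apply: generated_id | apply: base].
  - by split=> [|A slA]; [apply: (gL) | rewrite opL; apply: gL; [apply: Hy | apply: Hz]].
  split=> [|A slA]; first exact: generated_op.
  have := op_bracket y slA (lowering_sl lE) => /eqP; rewrite eq_sym subr_eq => /eqP ->.
  rewrite -[X in X + _]scale1r; apply: (gL); first by apply: Hy; apply: in_sl_bracket.
  by apply: generated_op => //; apply: Hy.
elim/generated_ind: x / => [|a y z gy gz|A y slA gy]; first exact: generated_id.
  exact: gL.
by case: (closed y gy) => _; apply.
Qed.

(** The sum of the positive coroots: bracketing with it multiplies every
    lowering operator by a negative number. *)
Definition grading : 'M[K]_n.+1 := \matrix_(a, b) ((a == b)%:R * (n%:R - 2 * a%:R)).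

Lemma grading_in_h : in_h grading.
Proof.
split; last first.
  by apply/is_diag_mxP => a b nab; rewrite mxE -[a == b]val_eqE (negPf nab) mul0r.
rewrite /in_sl /mxtrace (eq_bigr (fun k : 'I_n.+1 => n%:R - 2 * k%:R)) => [|k _].
  by rewrite sumrB sumr_const card_ord -mulr_sumr -natr_sum -natrM sum_ord_double mulnC natrM mulr_natl subrr.
by rewrite mxE eqxx mul1r.
Qed.

Lemma grading_bracket a b :
  grading *m delta_mx a b - delta_mx a b *m grading = (2 * b%:R - 2 * a%:R) *: delta_mx a b.
Proof.
have dg : grading = diag_mx (\row_k (n%:R - 2 * (k : 'I_n.+1)%:R)).
  by apply/matrixP => c d; rewrite !mxE mulr_natl.
rewrite dg mul_diag_mx mul_mx_diag; apply/matrixP => c d; rewrite !mxE.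
by case: (c =P a) => [->|]; case: (d =P b) => [->|]; rewrite ?mulr0 ?mul0r ?subrr //=; ring.
Qed.

Local Notation top := (wt_eval lam grading).

Definition annihilate (s : seq nat) (y : X) : X :=
  foldr (fun k z => op grading z - (top - k%:R) *: z) y s.

(** y is a sum of generalised eigenvectors of the grading element that lie at
    least k below the highest weight. *)
Definition graded k y := exists2 s : seq nat, all (leq k) s & annihilate s y = 0.

Lemma annihilateL s a y z :
  annihilate s (a *: y + z) = a *: annihilate s y + annihilate s z.
Proof.
elim: s => //= k s ->; rewrite opL scalerBr !scalerDr !scalerA.
by rewrite [a * _]mulrC opprD addrACA.
Qed.

Lemma annihilate0 s : annihilate s 0 = 0.
Proof. by have := annihilateL s (-1) 0 0; rewrite scaler0 addr0 scaleN1r addNr. Qed.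

Lemma annihilate1C k s y :
  annihilate s (op grading y - (top - k%:R) *: y) =
  op grading (annihilate s y) - (top - k%:R) *: annihilate s y.
Proof.
elim: s => //= j s ->; set z := annihilate s y.
rewrite !(opD opL) -!scaleNr !(opZ opL) !scalerDr !scalerA.
rewrite -!addrA; congr (_ + _); rewrite !addrA [X in X + _]addrC.
by congr (_ + _ *: _); rewrite mulrC.
Qed.

Lemma annihilate_cat s t y : annihilate (s ++ t) y = annihilate s (annihilate t y).
Proof. exact: foldr_cat. Qed.

Lemma annihilateC s t y : annihilate s (annihilate t y) = annihilate t (annihilate s y).
Proof. by elim: t => //= k t <-; rewrite annihilate1C. Qed.

Lemma gradedL k a y z : graded k y -> graded k z -> graded k (a *: y + z).
Proof.
move=> [s ks sy] [t kt tz]; exists (s ++ t); first by rewrite all_cat ks.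
rewrite annihilate_cat annihilateL annihilateL annihilateC sy annihilate0 tz.
by rewrite annihilate0 scaler0 addr0.
Qed.

(** A lowering operator shifts the eigenvalues of the grading element down by
    2 (a - b) >= 2. *)
Lemma graded_lower k (a b : 'I_n.+1) y : (b < a)%N -> graded k y -> graded k.+1 (op (delta_mx a b) y).
Proof.
move=> ba [s ks sy]; pose d := (2 * (a - b))%N.
have sld : in_sl (delta_mx a b : 'M[K]_n.+1) by apply: lowering_sl; exists a, b.
exists [seq (j + d)%N | j <- s].
  apply/allP => _ /mapP[j /(allP ks) kj ->]; rewrite /d; lia.
have E z : op grading (op (delta_mx a b) z) =
    op (delta_mx a b) (op grading z) - d%:R *: op (delta_mx a b) z.
  have := op_bracket z grading_in_h.1 sld; rewrite grading_bracket.
  have := opM (2 * b%:R - 2 * a%:R) z sld in_sl0; rewrite addr0 op0m addr0 => ->.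
  move/eqP; rewrite eq_sym subr_eq => /eqP ->; rewrite addrC; congr (_ + _).
  by rewrite -scaleNr /d natrM natrB ?(ltnW ba) // mulrBr opprB.
suff -> : annihilate [seq (j + d)%N | j <- s] (op (delta_mx a b) y) =
    op (delta_mx a b) (annihilate s y) by rewrite sy (op0 opL).
elim: s {ks sy} => //= j s ->; rewrite E (opD opL) -!scaleNr (opZ opL) -addrA.
by congr (_ + _); rewrite -scalerDl natrD; congr (_ *: _); ring.
Qed.

(** Lowering operators suffice to generate x, and each of them leads strictly
    below x0. The predicate Q records any further linear property of the
    images of lowering operators. *)
Lemma generated_split (Q : X -> Prop) x :
  Q 0 -> (forall a y z, Q y -> Q z -> Q (a *: y + z)) ->
  (forall A y, lowering A -> Q (op A y)) ->
  generated op (@in_sl K n) x0 x ->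
  exists a y, [/\ x = a *: x0 + y, graded 1 y & Q y].
Proof.
move=> Q0 QL Qop /generated_lowering gx.
have graded0 k : graded k 0 by exists [::].
suff : graded 0 x /\ exists a y, [/\ x = a *: x0 + y, graded 1 y & Q y] by case.
have gx0 : graded 0 x0.
  by exists [:: 0%N] => //=; rewrite subr0 (x0_weight grading_in_h) subrr.
elim/generated_ind: x / gx => [|a y z [gy [b [y' [Ey hy Qy]]]] [gz [c [z' [Ez hz Qz]]]]|A y lA [gy _]].
- by split=> //; exists 1, 0; rewrite scale1r addr0.
- split; first exact: gradedL.
  exists (a * b + c), (a *: y' + z'); split; [|exact: gradedL|exact: QL].
  by rewrite Ey Ez scalerDr scalerA scalerDl addrACA.
have [a [b [ba EA]]] := lA; split.
  have [s _ sy] := graded_lower ba gy; rewrite EA; exists s => //.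
  exact/allP.
exists 0, (op A y); rewrite scale0r add0r; split=> //; last exact: Qop.
by rewrite EA; apply: graded_lower.
Qed.

(** On x0 the annihilator of y acts by a product of positive numbers. *)
Lemma graded_top a y : a *: x0 + y = 0 -> graded 1 y -> x0 != 0 -> a = 0.
Proof.
move=> ay [s /allP s1 sy] nx0; have := annihilateL s a x0 y.
rewrite ay annihilate0 sy addr0.
have -> : annihilate s x0 = (\prod_(k <- s) k%:R) *: x0.
  elim: s {s1 sy} => [|k s IH]; rewrite ?big_nil ?scale1r // big_cons /= IH.
  by rewrite (opZ opL) (x0_weight grading_in_h) !scalerA -scalerBl; congr (_ *: _); ring.
rewrite scalerA => /esym/eqP; rewrite scaler_eq0 (negPf nx0) orbF mulf_eq0.
case/orP=> [/eqP //|]; rewrite prodf_seq_eq0 => /hasP[k /s1 k1].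
by rewrite pnatr_eq0 => /eqP k0; rewrite k0 in k1.
Qed.

End HighestWeight.

(** * Embedding an irreducible module into the tensors *)

Section Comparison.
Variables (C : numClosedFieldType) (n : nat) (P : finType).
Local Notation idx := {ffun P -> 'I_n.+1}.
Local Notation tns := {ffun idx -> C^o}.
Variables (V : vectType C) (rho : 'M[C]_n.+1 -> 'End(V)) (lam : 'rV[C]_n.+1).
Hypotheses (slV : sl_module rho) (irrV : irreducible_module rho).
Variables (v : V) (t : tns).
Hypotheses (nz_v : v != 0) (v_upper : forall A, in_nplus A -> rho A v = 0)
  (v_weight : v \in weight_space rho lam).
Hypotheses (nz_t : t != 0) (t_upper : forall A, in_nplus A -> act A t = 0)
  (t_weight : forall H, in_h H -> act H t = wt_eval lam H *: t)
  (t_real : forall T, (t T)^* = t T).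

Let X : lmodType C := (V * tns)%type.
Let op (A : 'M[C]_n.+1) (z : X) : X := (rho A z.1, act A z.2).

Lemma weight_spaceP mu x : reflect
  (forall r : 'I_n, rho (coroot C r) x = wt_eval mu (coroot C r) *: x)
  (x \in weight_space rho mu).
Proof.
have lE r : x \in passmx.leigenspace (rho (coroot C r)) (wt_eval mu (coroot C r)) =
    (rho (coroot C r) x == wt_eval mu (coroot C r) *: x).
  by rewrite memv_ker !lfunE /= !lfunE /= lfunE /= id_lfunE subr_eq0.
rewrite memvE; apply: (iffP subv_bigcapP) => h r; first by apply/eqP; rewrite -lE memvE h.
by rewrite -memvE lE h.
Qed.

Let opL A a x y : op A (a *: x + y) = a *: op A x + op A y.
Proof. by apply: injective_projections => /=; [exact: linearP | exact: act_linear]. Qed.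

Let opM a A B x : in_sl A -> in_sl B -> op (a *: A + B) x = a *: op A x + op B x.
Proof.
by move=> sA sB; apply: injective_projections => /=; [rewrite slV.1 // !lfunE /= lfunE | exact: act_linearl].
Qed.

Let op_bracket A B x : in_sl A -> in_sl B ->
  op (A *m B - B *m A) x = op A (op B x) - op B (op A x).
Proof.
by move=> sA sB; apply: injective_projections => /=; [rewrite slV.2 // !lfunE /= !lfunE /= !lfunE | exact: act_bracket].
Qed.

Let op_upper A : in_nplus A -> op A (v, t) = 0.
Proof. by move=> uA; rewrite /op /= v_upper // t_upper. Qed.

Let op_top H : in_h H -> op H (v, t) = wt_eval lam H *: ((v, t) : X).
Proof.
move=> hH; apply: injective_projections => /=; last exact: t_weight.
apply: (@op_weight C n V (fun A x => rho A x)) => [a A B x sA sB|r|//].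
  by rewrite slV.1 // !lfunE /= lfunE.
exact/weight_spaceP.
Qed.

Let gen (u : V) (x : tns) := generated op (@in_sl C n) (v, t) (u, x).

Let genL a u x u' x' : gen u x -> gen u' x' -> gen (a *: u + u') (a *: x + x').
Proof. exact: (@generatedL C n X op (@in_sl C n) (v, t) a (u, x) (u', x')). Qed.

Let gen_op A u x : in_sl A -> gen u x -> gen (rho A u) (act A x).
Proof. exact: (generated_op opL (x := (u, x))). Qed.

Let gen0 : gen 0 0.
Proof. exact: (generated0 (X := X)). Qed.

(** The transpose of a matrix is its adjoint for this bilinear form. *)
Let form (x y : tns) : C := \sum_T x T * y T.

Let formR a (x y z : tns) : form x (a *: y + z) = a * form x y + form x z.
Proof.
rewrite /form mulr_sumr -big_split; apply: eq_bigr => T _.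
by rewrite !ffunE scaleoE /=; ring.
Qed.

(** A pair generated by (v, t) has the same coefficient on v and on t, up to
    vectors strictly below v and tensors orthogonal to t. *)
Let gen_split u x : gen u x ->
  exists a u' x', [/\ u = a *: v + u', x = a *: t + x', form t x' = 0 &
    forall b, b *: v + u' = 0 -> b = 0].
Proof.
move=> guv; have := generated_split opL opM op_bracket op_upper op_top
  (Q := fun z => form t z.2 = 0) _ _ _ guv.
case=> [|b y z Qy Qz|A z [a [b [ba ->]]]|a [[u' x'] [[-> ->] gr /= tx']]].
- by rewrite /form big1 // => T _; rewrite ffunE mulr0.
- by rewrite /= formR Qy Qz mulr0 addr0.
- rewrite /form /= act_adjoint t_upper ?big1 // => [T _|c d dc].
    by rewrite ffunE mul0r.
  by rewrite !mxE; case: andP => // -[/eqP da /eqP cb]; rewrite da cb leqNgt ba in dc.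
exists a, u', x'; split=> // b e.
case: gr => s s1 sy; apply: (@graded_top C n V (fun A x => rho A x) _ lam v _ b u' e) => //.
- by move=> A c y z; rewrite linearP.
- by move=> H hH; have /(congr1 fst) := op_top hH.
exists s => //; have /(congr1 fst) /= <- := sy.
by elim: (s) => //= k s' IH; rewrite -IH.
Qed.

(** If 0 is related to k, then k is orthogonal to the whole submodule
    generated by t for the Hermitian form: it is orthogonal to t because 0 has
    no component on v, and the form is contravariant for the conjugate
    transpose. In particular k is orthogonal to itself. *)
Let gen_radical k : gen 0 k -> k = 0.
Proof.
move=> g0k; pose cj (x : tns) : tns := [ffun T => (x T)^*].
pose herm (x y : tns) := form (cj x) y.
have top0 x : gen 0 x -> form t x = 0.
  move=> /gen_split[a [u' [x' [/esym e -> tx' /(_ _ e) ->]]]].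
  by rewrite scale0r add0r.
have rad z : generated op (@in_sl C n) (v, t) z -> forall x, gen 0 x -> herm x z.2 = 0.
  elim/generated_ind: z / => [|a y z Qy Qz|A z sA Qz] x g0x.
  - rewrite -[RHS](conjC0 C) -(top0 x g0x) rmorph_sum /=; apply: eq_bigr => T _.
    by rewrite rmorphM /= t_real mulrC ffunE.
  - by rewrite /herm /= formR [form _ _]Qy // [form _ _]Qz // mulr0 addr0.
  rewrite /herm /form /= act_adjoint.
  pose B := map_mx Num.conj A^T.
  have sB : in_sl B by rewrite /in_sl /B trace_map_mx mxtrace_tr sA rmorph0.
  have <- : cj (act B x) = act A^T (cj x).
    apply/ffunP => T; rewrite ffunE !actE rmorph_sum.
    apply: eq_bigr => q _; rewrite rmorph_sum; apply: eq_bigr => b _.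
    by rewrite rmorphM /= !mxE conjCK ffunE.
  by apply: Qz; have := gen_op sB g0x; rewrite linear0.
have := rad _ g0k k g0k; rewrite /herm /form /= => /psumr_eq0P h.
apply/ffunP => T; rewrite ffunE; apply/eqP; rewrite -mul_conjC_eq0 mulrC.
have := h _ T isT; rewrite ffunE => -> // S _.
by rewrite ffunE mulrC mul_conjC_ge0.
Qed.

(** V is isomorphic to the submodule of the tensors generated by t, since the
    submodule of V * tensors generated by (v, t) is the graph of a linear map. *)
Theorem highest_weight_embedding : exists psi : 'Hom(V, tns),
  [/\ lker psi = 0%VS, forall A x, in_sl A -> psi (rho A x) = act A (psi x)
     & psi v = t].
Proof.
have ftt : form t t != 0.
  apply: contraNneq nz_t => ft0; apply/eqP/ffunP => T; rewrite ffunE.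
  apply/eqP; rewrite -mul_conjC_eq0 t_real; move: ft0; rewrite /form => /psumr_eq0P.
  by move=> -> // S _; rewrite -{2}(t_real S) mul_conjC_ge0.
have [U1 U1P] := @vspace_of_pred C V (fun u => gen u 0) gen0
  (fun a x y gx gy => eq_ind _ (fun z => gen (a *: x + y) z) (genL a gx gy) _ (etrans (addr0 _) (scaler0 _ a))).
have [U2 U2P] := @vspace_of_pred C V (fun u => exists x, gen u x) (ex_intro _ 0 gen0)
  (fun a x y gx gy => let: ex_intro x' gx' := gx in let: ex_intro y' gy' := gy in
     ex_intro _ _ (genL a gx' gy')).
have gid : gen v t by exact: generated_id.
(* The u related to 0 form a submodule of V, which does not contain v, hence
   is 0 by irreducibility. *)
have inj u : gen u 0 -> u = 0.
  move=> gu; have sU1 A : in_sl A -> (rho A @: U1 <= U1)%VS.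
    move=> sA; apply/subvP => _ /memv_imgP[x /U1P gx ->]; apply/U1P.
    by have := gen_op sA gx; rewrite (op0 (op := @act C n.+1 P) (fun A => act_linear A)).
  have [U10|U1T] := irrV.2 U1 sU1; first by apply/eqP; rewrite -memv0 -U10; apply/U1P.
  have /U1P/gen_split[a [u' [x' [e1 e2 tx' a0]]]] : v \in U1 by rewrite U1T memvf.
  have ea : a = 1.
    apply/eqP; rewrite -subr_eq0; apply/eqP/a0.
    by rewrite scalerBl scale1r addrAC -e1 subrr.
  case/eqP: ftt; have : form t (a *: t + x') = 0.
    by rewrite -e2 /form big1 // => T _; rewrite ffunE mulr0.
  by rewrite ea formR tx' mul1r addr0.
(* The u related to some tensor form a submodule of V, which contains v, hence
   is V. *)
have tot u : exists x, gen u x.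
  suff : u \in U2 by move/U2P.
  have sU2 A : in_sl A -> (rho A @: U2 <= U2)%VS.
    move=> sA; apply/subvP => _ /memv_imgP[x /U2P [y gy] ->]; apply/U2P.
    by exists (act A y); apply: gen_op.
  have [U20|->] := irrV.2 U2 sU2; last exact: memvf.
  have : v \in U2 by apply/U2P; exists t.
  by rewrite U20 memv0 (negPf nz_v).
have [psi psiP] := boolp.choice tot.
have uni u x y : gen u x -> gen u y -> x = y.
  move=> gx gy; apply/eqP; rewrite -subr_eq0; apply/eqP/gen_radical.
  by have := genL (-1) gy gx; rewrite !scaleN1r addNr addrC.
have psiL : linear psi by move=> a x y; apply: uni (psiP _) (genL _ (psiP x) (psiP y)).
pose psiH := GRing.isLinear.Build _ _ _ _ psi psiL.
pose psif : {linear V -> tns} := HB.pack psi psiH.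
exists (linfun psif); split.
- apply/eqP; rewrite -subv0; apply/subvP => u; rewrite memv_ker lfunE /= => /eqP e.
  by rewrite memv0; apply/eqP/inj; rewrite -e.
- by move=> A x sA; rewrite !lfunE /=; apply: uni (psiP _) (gen_op sA (psiP x)).
- by rewrite lfunE /=; apply: uni (psiP _) gid.
Qed.

End Comparison.

(** * The dimensions of the weight spaces of a Demazure module *)

Section DemazureDimension.
Variables (C : numClosedFieldType) (n i m : nat) (le_iN : (i <= n.+1)%N).
Local Notation idx := {ffun 'I_m * 'I_i -> 'I_n.+1}.
Local Notation tns := {ffun idx -> C^o}.
Local Notation inj := (widen_ord le_iN).
Local Notation lam := (m%:R *: omega C n i).

Lemma fund_weightE (a : 'I_n.+1) : lam 0 a = m%:R * (a < i)%:R.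
Proof.
rewrite mxE summxE; congr (_ * _).
rewrite (eq_bigr (fun k => (a.+1 == k)%:R)) => [|k _]; last by rewrite mxE.
have [ai|ia] := ltnP a i.
  rewrite (bigD1_seq a.+1) ?mem_index_iota ?iota_uniq //= eqxx big1 ?addr0 // => k.
  by rewrite eq_sym => /negPf ->.
rewrite big_seq big1 // => k; rewrite mem_index_iota => /andP[_ ki].
by rewrite gtn_eqF // (leq_trans ki).
Qed.

Lemma wt_eval_fund (w : 'S_n.+1) (H : 'M[C]_n.+1) :
  wt_eval (wact w lam) H = (\sum_(t < i) H (w (inj t)) (w (inj t))) *+ m.
Proof.
rewrite /wt_eval (reindex_inj (@perm_inj _ w)) /= -[RHS]mulr_natl mulr_sumr.
rewrite -(big_ord_narrow le_iN (F := fun a => m%:R * H (w a) (w a))) [RHS]big_mkcond.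
apply: eq_bigr => a _; rewrite mxE permK fund_weightE.
by case: ifP; rewrite ?mulr1 // mulr0 mul0r.
Qed.

Lemma act_frame_diag (w : 'I_i -> 'I_n.+1) (H : 'M[C]_n.+1) : is_diag_mx H ->
  act H (minors m (frame C w)) = ((\sum_t H (w t) (w t)) *+ m) *: minors m (frame C w).
Proof.
move=> /is_diag_mxP dH; pose B : 'M[C]_i := diag_mx (\row_t H (w t) (w t)).
rewrite (@act_minors_trig _ _ _ _ _ _ B).
- by rewrite mxtrace_diag; under eq_bigr do rewrite mxE.
- rewrite mul_mx_diag; apply/matrixP => a t; rewrite !mxE (bigD1 (w t)) //= mxE eqxx mulr1.
  rewrite big1 ?addr0 => [|c nc]; last by rewrite mxE (negPf nc) mulr0.
  by case: (a =P w t) => [->|/eqP na]; rewrite ?mul1r // mul0r dH.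
- by rewrite tr_diag_mx diag_mx_is_trig.
Qed.

(** A strictly upper triangular matrix maps the standard frame to itself times
    a strictly upper triangular matrix. *)
Lemma act_frame_upper (A : 'M[C]_n.+1) : in_nplus A -> act A (minors m (frame C inj)) = 0.
Proof.
move=> nA; pose B : 'M[C]_i := \matrix_(s, t) A (inj s) (inj t).
rewrite (@act_minors_trig _ _ _ _ _ _ B).
- by rewrite /mxtrace big1 ?mul0rn ?scale0r // => t _; rewrite mxE nA.
- apply/matrixP => a t; rewrite !mxE (bigD1 (inj t)) //= mxE eqxx mulr1.
  rewrite big1 ?addr0 => [|c nc]; last by rewrite mxE (negPf nc) mulr0.
  have [ai|ia] := ltnP a i.
    rewrite (bigD1 (Ordinal ai)) //= !mxE -val_eqE /= eqxx mul1r big1 ?addr0.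
      by congr (A _ _); apply: ord_inj.
    move=> s; rewrite -val_eqE mxE -[a == _]val_eqE eq_sym /= => /negPf ->.
    by rewrite mul0r.
  rewrite nA /= ?(ltnW (leq_trans _ ia)) // big1 // => s _.
  by rewrite mxE -val_eqE /= gtn_eqF ?mul0r // (leq_trans (ltn_ord s)).
- by apply/is_trig_mxP => s t st; rewrite !mxE nA //= ltnW.
Qed.

Lemma frame_real (w : 'I_i -> 'I_n.+1) T :
  (minors m (frame C w) T)^* = minors m (frame C w) T.
Proof.
rewrite -[LHS]/(Num.conj _) map_minors; congr (minors _ _ _).
by apply/matrixP => a t; rewrite !mxE rmorph_nat.
Qed.

(** Scalar matrices act by scalars, so stability under gl reduces to stability
    under sl. *)
Lemma stable_gl (U : {vspace tns}) (A : 'M[C]_n.+1) :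
  (forall c, in_sl (A - c%:M) -> stable_under U (A - c%:M)) -> stable_under U A.
Proof.
move=> sU z zU; pose c := \tr A / n.+1%:R.
have slA : in_sl (A - c%:M).
  by rewrite /in_sl linearB /= mxtrace_scalar -mulr_natr divfK ?pnatr_eq0 // subrr.
have -> : act A z = act (A - c%:M) z + (c *+ #|{: 'I_m * 'I_i}|) *: z.
  apply/ffunP => T; rewrite [RHS]ffunE [X in _ = _ + X]ffunE scaleoE -act_scalar.
  rewrite -{1}(subrK c%:M A) -[A - _]scale1r act_linearl !scale1r.
  by rewrite ffunE.
by apply: memvD; [apply: sU | apply: memvZ].
Qed.

Variables (V : vectType C) (rho : 'M[C]_n.+1 -> 'End(V)).

Definition has_weight (mu : 'rV[C]_n.+1) (T : idx) :=
  [forall r : 'I_n, \sum_q coroot C r (T q) (T q) == wt_eval mu (coroot C r)].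

(** Under the embedding of V into the tensors, the generator of D becomes a
    multiple of the vector of minors of the frame of w, since its weight space
    is a line. The image of D then contains the vectors of minors of the whole
    Schubert cell, and satisfies every linear relation that they satisfy;
    hence standard monomials give its dimension, weight by weight. *)
Theorem demazure_dim (w : 'S_n.+1) (W : {ffun 'I_i -> 'I_n.+1}) (D : {vspace V}) mu :
  sl_module rho -> irreducible_module rho -> highest_weight rho lam ->
  (forall t, W t = w (inj t)) -> increasing W ->
  demazure_module rho w lam D ->
  \dim (D :&: weight_space rho mu) =
    #|[set T : idx | [&& standard T, below W T & has_weight mu T]]|.
Proof.
move=> slV irrV [v0 nz_v0 [v0_wt v0_up]] WE incW [vD vD_wt DP].
have injP : injective inj by move=> a b /(congr1 val) /= /ord_inj.
have t_wt H : in_h H -> act H (minors m (frame C inj)) = wt_eval lam H *: minors m (frame C inj).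
  move=> [_ dH]; rewrite act_frame_diag //; congr (_ *: _).
  have -> : lam = wact 1%g lam by apply/rowP => a; rewrite !mxE invg1 perm1.
  by rewrite wt_eval_fund; congr (_ *+ _); apply: eq_bigr => t _; rewrite !perm1.
have nz_t : minors m (frame C inj) != 0.
  apply/eqP => /ffunP /(_ [ffun q => inj q.2]).
  by rewrite minors_frame_self // ffunE => /eqP; rewrite oner_eq0.
have [psi [kerpsi psi_op psi_v0]] :=
  highest_weight_embedding slV irrV nz_v0 v0_up v0_wt nz_t act_frame_upper t_wt (frame_real _).
have psiI : injective psi by apply/lker0P/eqP.
have psi_mem x (U : {vspace V}) : psi x \in (psi @: U)%VS -> x \in U.
  by move=> /memv_imgP[y yU /psiI ->].
pose Full := (psi @: fullv)%VS.
have sFull A : stable_under Full A.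
  apply: stable_gl => c slA _ /memv_imgP[x _ ->].
  by rewrite -psi_op // memv_img ?memvf.
have FW : minors m (frame C W) \in Full.
  apply: (minors_frame (le_iN := le_iN)) => //; first exact/increasingP.
  by rewrite -psi_v0 memv_img ?memvf.
have /memv_imgP[u _ psi_u] := FW.
have nz_FW : minors m (frame C W) != 0.
  apply/eqP => /ffunP /(_ [ffun q => W q.2]).
  by rewrite minors_frame_self ?ffunE; [move/eqP; rewrite oner_eq0 | apply: increasing_inj].
have : u \in <[vD]>%VS.
  rewrite vD_wt; apply/weight_spaceP => r; apply: psiI.
  have [slr dr] := coroot_in_h C r.
  rewrite psi_op // linearZ /= -psi_u act_frame_diag // wt_eval_fund.
  by congr ((_ *+ _) *: _); apply: eq_bigr => t _; rewrite !WE.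
case/vlineP=> c uc.
have nzc : c != 0.
  by apply: contraNneq nz_FW => c0; rewrite psi_u uc c0 scale0r linear0.
have psi_vD : psi vD = c^-1 *: minors m (frame C W).
  by rewrite psi_u uc linearZ /= scalerA mulVf ?scale1r.
pose rop A x := rho A x.
have ropL A a x y : rop A (a *: x + y) = a *: rop A x + rop A y by apply: linearP.
have DgenP x : x \in D <-> generated rop (@in_b C n) vD x by apply: DP.
pose U := (psi @: D)%VS.
have upper_b A : upper_triangular A -> in_sl A -> in_b A by [].
have sU A : upper_triangular A -> stable_under U A.
  move=> uA; apply: stable_gl => d slA _ /memv_imgP[x xD ->].
  rewrite -psi_op // memv_img //; apply/DgenP/(generated_op ropL); last exact/DgenP.
  split=> // a b ba; rewrite !mxE uA // sub0r.
  by rewrite -val_eqE /= gtn_eqF // oppr0.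
have vDD : vD \in D by apply/DgenP/generated_id.
have relU (f : idx -> C) :
     (forall Y, schubert W Y -> \sum_T f T * minors m Y T = 0) ->
     forall z : tns, z \in U -> \sum_T f T * z T = 0.
  move=> f0 _ /memv_imgP[x /DgenP gx ->].
  elim/generated_ind: x / gx f f0 => [|a x y Qx Qy|A x [slA uA] Qx] f f0.
  - rewrite psi_vD; under eq_bigr do rewrite ffunE scaleoE mulrCA.
    rewrite -mulr_sumr f0 ?mulr0 // => a t Wa.
    by rewrite mxE -val_eqE /= gtn_eqF.
  - rewrite linearP; under eq_bigr do rewrite !ffunE scaleoE mulrDr mulrCA.
    by rewrite big_split /= -mulr_sumr Qx // Qy // mulr0 addr0.
  - rewrite psi_op //; pose g : tns := [ffun T => f T].
    have gE (h : idx -> C) : \sum_T f T * h T = \sum_T g T * h T.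
      by apply: eq_bigr => T _; rewrite ffunE.
    rewrite gE act_adjoint; apply: Qx => Y sY; rewrite -act_adjoint -gE.
    exact: (schubert_relation f0).
have coroot_upper r : upper_triangular (coroot C r : 'M_n.+1).
  move=> a b ba; have [_ /is_diag_mxP -> //] := coroot_in_h C r.
  by rewrite gtn_eqF.
pose d r (T : idx) := \sum_q coroot C r (T q) (T q).
have act_coroot r (z : tns) : act (coroot C r) z = [ffun T => d r T * z T].
  by apply/ffunP => T; rewrite act_diag ?ffunE //; case: (coroot_in_h C r).
pose B := (psi @: (D :&: weight_space rho mu))%VS.
have <- : \dim B = \dim (D :&: weight_space rho mu).
  by apply: limg_dim_eq; rewrite kerpsi capv0.
apply: (standard_dim (U := U)) => // [Y sY|z zU|z].
- apply: (minors_schubert (w := W)) => //; first exact/increasingP.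
  have -> : minors m (frame C W) = c *: psi vD by rewrite psi_vD scalerA divff ?scale1r.
  by rewrite memvZ // memv_img.
- apply: (mask_eigens (d := d)) => // r y yU.
  by rewrite -act_coroot; apply: sU.
- split.
    case/memv_imgP=> x; rewrite memv_cap => /andP[xD /weight_spaceP xw] ->.
    split=> [|T /forallPn[r nr]]; first exact: memv_img.
    have := psi_op _ x (coroot_in_h C r).1; rewrite xw linearZ act_coroot /=.
    move/ffunP/(_ T); rewrite !ffunE scaleoE => /eqP.
    by rewrite -subr_eq0 -mulrBl mulf_eq0 subr_eq0 eq_sym (negPf nr) => /eqP.
  case=> /memv_imgP[x xD ->] zg; apply: memv_img; rewrite memv_cap xD.
  apply/weight_spaceP => r; apply: psiI.
  rewrite psi_op; last by case: (coroot_in_h C r).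
  rewrite linearZ act_coroot /=; apply/ffunP => T; rewrite !ffunE scaleoE.
  have [/forallP/(_ r)/eqP e|/zg ->] := boolP (has_weight mu T); first by rewrite -e.
  by rewrite !mulr0.
Qed.

End DemazureDimension.

(** * Length and inversions *)

Section Length.
Variable n : nat.
Implicit Types (w v : 'S_n.+1) (a b : 'I_n.+1).

Definition inversions w : {set 'I_n.+1 * 'I_n.+1} :=
  [set x : 'I_n.+1 * 'I_n.+1 | (x.1 < x.2)%N && (w x.2 < w x.1)%N].

Lemma tperm_succ_lt a b x y : b = a.+1 :> nat -> (x, y) != (a, b) ->
  (x < y)%N -> (tperm a b x < tperm a b y)%N.
Proof.
rewrite -pair_eqE /pair_eq /= -!val_eqE !permE /= -!val_eqE /= => ab nxy xy.
by do 4?[case: eqP => ?] => /=; lia.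
Qed.

(** Exchanging two adjacent positions preserves the order of every other pair
    of positions. *)
Lemma card_inversions_up w a b : b = a.+1 :> nat -> (w a < w b)%N ->
  #|inversions (tperm a b * w)| = #|inversions w|.+1.
Proof.
move=> ab wab; set s := tperm a b; pose h (x : 'I_n.+1 * 'I_n.+1) := (s x.1, s x.2).
have hK : involutive h by case=> x y; rewrite /h /= !tpermK.
have abI : (a, b) \in inversions (s * w).
  by rewrite inE /= !permM tpermL tpermR wab ab ltnSn.
rewrite (cardsD1 (a, b)) abI add1n; congr _.+1.
rewrite -[RHS](on_card_preimset (f := h)); last by exists h => ? _; apply: hK.
apply: eq_card => -[x y]; rewrite !inE /= !permM andbA.
have [wyx|_] := boolP (w (s y) < w (s x))%N; rewrite ?andbF // !andbT.
apply/andP/idP => [[nxy xy]|xy]; first exact: tperm_succ_lt.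
have nsxy : (s x, s y) != (a, b).
  by apply: contraTneq wyx => -[-> ->]; rewrite -leqNgt ltnW.
have := tperm_succ_lt ab nsxy xy; rewrite !tpermK => ltxy; split=> //.
by apply: contraTneq xy => -[-> ->]; rewrite /s tpermL tpermR ab ltnNge leqnSn.
Qed.

Lemma card_inversions_down w a b : b = a.+1 :> nat -> (w b < w a)%N ->
  #|inversions w| = #|inversions (tperm a b * w)|.+1.
Proof.
move=> ab wba; rewrite -(card_inversions_up (w := tperm a b * w) ab).
  by rewrite mulgA tperm2 mul1g.
by rewrite !permM tpermL tpermR.
Qed.

Lemma increasing_ge (f : 'I_n.+1 -> 'I_n.+1) : {homo f : x y / (x < y)%N} ->
  forall x : 'I_n.+1, (x <= f x)%N.
Proof.
move=> fI [x]; elim: x => // x IH xn; have /= := IH (ltnW xn).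
by move/leq_ltn_trans; apply; apply: fI.
Qed.

Lemma increasing_id (f : 'I_n.+1 -> 'I_n.+1) : {homo f : x y / (x < y)%N} -> f =1 id.
Proof.
move=> fI x; apply/ord_inj/eqP; rewrite eqn_leq increasing_ge // andbT.
pose g y := rev_ord (f (rev_ord y)).
have gI : {homo g : y z / (y < z)%N}.
  move=> y z yz; have /= : (f (rev_ord z) < f (rev_ord y))%N.
    by apply: fI => /=; have := ltn_ord z; lia.
  by have := ltn_ord (f (rev_ord y)); rewrite /g /=; lia.
have := increasing_ge gI (rev_ord x); rewrite /g rev_ordK /=.
by have := ltn_ord x; have := ltn_ord (f x); lia.
Qed.

Lemma adjacent_increasing (T : Type) (r : rel T) (lo hi : nat) (f : 'I_n.+1 -> T) :
  transitive r ->
  (forall a b, b = a.+1 :> nat -> (lo <= a)%N -> (b < hi)%N -> r (f a) (f b)) ->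
  forall x y : 'I_n.+1, (lo <= x)%N -> (x < y)%N -> (y < hi)%N -> r (f x) (f y).
Proof.
move=> trr adj x [y yn]; elim: y yn => //= y IH yn lox; rewrite ltnS => xy yhi.
have yn' := ltnW yn; have step : r (f (Ordinal yn')) (f (Ordinal yn)).
  by apply: adj => //=; apply: leq_trans xy.
move: xy; rewrite leq_eqVlt => /orP[/eqP xy|xy].
  by have -> : x = Ordinal yn' by apply: ord_inj.
by apply: trr step; apply: (IH yn') => //; apply: ltnW.
Qed.

Lemma word_elt_rcons s r : word_elt n (rcons s r) = wmul (word_elt n s) (simple_refl n r).
Proof. by rewrite /word_elt foldl_rcons. Qed.

Lemma simple_reflE a b : b = a.+1 :> nat -> simple_refl n b = tperm a b.
Proof.
move=> ab; rewrite /simple_refl inord_val; congr tperm; apply: ord_inj.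
by rewrite ab /= inordK // ltnW // -ab.
Qed.

Lemma inversions_word (s : seq 'I_n) :
  (#|inversions (word_elt n [seq (val r).+1 | r <- s])| <= size s)%N.
Proof.
elim/last_ind: s => [|s r IH].
  rewrite leqn0 cards_eq0; apply/eqP/setP => x; rewrite !inE /word_elt /= !perm1.
  by case: ltngtP.
rewrite map_rcons word_elt_rcons size_rcons /wmul.
have lr : (r.+1 < n.+1)%N by rewrite ltnS.
have ab : Ordinal lr = (Ordinal (ltnW lr)).+1 :> nat by [].
rewrite (simple_reflE ab); set w := word_elt _ _ in IH *.
have [wab|wba] := ltnP (w (Ordinal (ltnW lr))) (w (Ordinal lr)).
  by rewrite card_inversions_up.
apply: leq_trans (leqnSn _); apply: leq_trans IH.
rewrite [in X in (_ <= X)%N](card_inversions_down ab) // ltn_neqAle wba andbT val_eqE.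
by rewrite (inj_eq perm_inj) -val_eqE /= gtn_eqF.
Qed.

(** A permutation without descents is the identity, and a simple reflection at
    a descent removes exactly one inversion. *)
Lemma has_word_inversions w : has_word w #|inversions w|.
Proof.
suff main k : #|inversions w| = k -> exists2 s : seq 'I_n, size s = k &
    word_elt n [seq (val r).+1 | r <- s] = w.
  have [s ss sw] := main _ erefl; apply/existsP.
  by exists (tcast ss (in_tuple s)); rewrite val_tcast sw.
elim: k => [|k IH] in w *.
  move/eqP; rewrite cards_eq0 => /eqP inv0; exists [::] => //.
  apply/permP => x; rewrite perm1; apply/esym; apply: (increasing_id (f := w)) => {}x y xy.
  move/setP/(_ (x, y)): inv0; rewrite !inE /= xy /= => /negbT; rewrite -leqNgt.
  by rewrite leq_eqVlt => /orP[/eqP/ord_inj/perm_inj e|//]; rewrite e ltnn in xy.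
move=> wk; have [/existsP[r wr]|/existsPn no] := boolP
    [exists r : 'I_n, (w (lift ord0 r) < w (widen_ord (leqnSn n) r))%N].
  have ab : lift ord0 r = (widen_ord (leqnSn n) r).+1 :> nat by [].
  have := card_inversions_down ab wr; rewrite wk => -[/esym/IH[s ss sw]].
  exists (rcons s r); first by rewrite size_rcons ss.
  rewrite map_rcons word_elt_rcons sw /wmul.
  have -> : simple_refl n (val r).+1 = tperm (widen_ord (leqnSn n) r) (lift ord0 r).
    by rewrite -(simple_reflE ab).
  by rewrite mulgA tperm2 mul1g.
suff inv0 : #|inversions w| = 0 by rewrite inv0 in wk.
apply/eqP; rewrite cards_eq0; apply/eqP/setP => -[x y]; rewrite !inE /=.
apply/negP => /andP[xy]; apply/negP; rewrite -leqNgt ltnW //.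
apply: (@adjacent_increasing _ (fun a b : 'I_n.+1 => (a < b)%N) 0 n.+1 w) => //.
  by move=> ? ? ?; apply: ltn_trans.
move=> a b ab _ _; have an : (a < n)%N by rewrite -ltnS -ab.
have := no (Ordinal an); rewrite -leqNgt leq_eqVlt.
have -> : widen_ord (leqnSn n) (Ordinal an) = a by apply: ord_inj.
have -> : lift ord0 (Ordinal an) = b by apply: ord_inj; rewrite /= ab.
by case/orP=> // /eqP/ord_inj/perm_inj e; move: ab; rewrite e => /n_Sn.
Qed.

Lemma wlengthE w : wlength w = #|inversions w|.
Proof.
rewrite /wlength; case: ex_minnP => l /existsP[t /eqP tw] min_l.
apply/eqP; rewrite eqn_leq min_l ?has_word_inversions // -tw.
by rewrite (leq_trans (inversions_word t)) // size_tuple.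
Qed.

(** A descent inside a block could be removed by a simple reflection of the
    parabolic subgroup. *)
Lemma min_coset_rep_lt i w a b : min_coset_rep i w -> b = a.+1 :> nat ->
  (b < i)%N || (i <= a)%N -> (w a < w b)%N.
Proof.
move=> minw ab bi; rewrite ltnNge leq_eqVlt; apply/negP => /orP[/eqP/ord_inj/perm_inj e|wba].
  by move: ab; rewrite e => /n_Sn.
have : tperm a b \in parabolic n i.
  rewrite inE; apply/forallP => x; apply/eqP.
  by case: tpermP => // ->; apply/idP/idP; move: bi; rewrite ab; lia.
by move/minw; rewrite /wmul !wlengthE (card_inversions_down ab wba) ltnn.
Qed.

Lemma min_coset_rep_homo i w : min_coset_rep i w ->
  forall x y : 'I_n.+1, (y < i)%N || (i <= x)%N -> (x < y)%N -> (w x < w y)%N.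
Proof.
move=> minw x y /orP[yi|ix] xy.
  apply: (@adjacent_increasing _ (fun a b : 'I_n.+1 => (a < b)%N) 0 i w) => //.
    by move=> ? ? ?; apply: ltn_trans.
  by move=> a b ab _ bi; apply: min_coset_rep_lt minw ab _; rewrite bi.
apply: (@adjacent_increasing _ (fun a b : 'I_n.+1 => (a < b)%N) i n.+1 w) => //.
  by move=> ? ? ?; apply: ltn_trans.
by move=> a b ab ia _; apply: min_coset_rep_lt minw ab _; rewrite ia orbT.
Qed.

(** A longest element descends everywhere, since a simple reflection at an
    ascent would lengthen it. *)
Lemma longestE v x : longest v -> v x = rev_ord x.
Proof.
move=> lv; rewrite -[v x]rev_ordK; congr rev_ord.
apply: (increasing_id (f := fun x => rev_ord (v x))) => {}x y xy.
suff : (v y < v x)%N by have := ltn_ord (v x); rewrite /=; lia.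
apply: (@adjacent_increasing _ (fun a b : 'I_n.+1 => (b < a)%N) 0 n.+1 v) => //.
  by move=> ? ? ? h1 h2; apply: ltn_trans h2 h1.
move=> a b ab _ _; rewrite ltnNge leq_eqVlt; apply/negP => /orP[/eqP/ord_inj/perm_inj e|vab].
  by move: ab; rewrite e => /n_Sn.
by have := lv (tperm a b * v)%g; rewrite !wlengthE (card_inversions_up ab vab) ltnn.
Qed.

End Length.

(** * Grassmannian permutations *)

Lemma card_ord_interval (N lo up : nat) : (up <= N)%N ->
  #|[set x : 'I_N | (lo <= x < up)%N]| = (up - lo)%N.
Proof.
move=> upN; rewrite -sum1_card -[RHS]muln1 -sum_nat_const_nat.
rewrite (eq_bigl (fun x : 'I_N => (lo <= x < up)%N)) => [|x]; last by rewrite inE.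
rewrite (big_nat_widen _ _ N) // (big_nat_widenl _ 0) // big_mkord.
by apply: eq_bigl => x; rewrite andbC.
Qed.

Section Grassmannian.
Variables (n i : nat).
Hypothesis hi : (1 <= i <= n)%N.
Local Notation p := (n.+1 - i)%N.
Implicit Types (w v : 'S_n.+1) (a b t x y : 'I_n.+1).

Definition homo_block (f : 'I_n.+1 -> 'I_n.+1) (lo up : nat) :=
  forall x y, (lo <= x)%N -> (x < y)%N -> (y < up)%N -> (f x < f y)%N.

Lemma homo_block_ge f (lo up c : nat) : homo_block f lo up ->
  (forall x, (lo <= x < up)%N -> (c <= f x)%N) ->
  forall x, (lo <= x < up)%N -> (c + (x - lo) <= f x)%N.
Proof.
move=> fI fc [x]; elim: x => [|x IH] xn /= /andP[lox xup].
  by rewrite sub0n addn0 fc /= ?lox.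
have := lox; rewrite leq_eqVlt => /orP[/eqP elo|ltlo].
  by rewrite elo subnn addn0 fc /= ?lox.
have := IH (ltnW xn); rewrite /= -ltnS ltlo (ltnW xup) => /(_ isT) h.
have /= h' := fI (Ordinal (ltnW xn)) (Ordinal xn) ltlo (ltnSn _) xup.
by rewrite subSn // addnS (leq_ltn_trans h h').
Qed.

Lemma homo_block_le f (lo up c : nat) : homo_block f lo up -> (up <= n.+1)%N ->
  (forall x, (lo <= x < up)%N -> (f x < c)%N) ->
  forall x, (lo <= x < up)%N -> (f x + (up - x) <= c)%N.
Proof.
move=> fI upn fc x; have [k] := ubnP (up - x)%N; elim: k x => // k IH x.
rewrite ltnS => xk lxu; have fxc := fc x lxu; have /andP[lox xup] := lxu.
have [xup'|upx] := ltnP x.+1 up; last first.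
  have -> : (up - x = 1)%N by lia.
  by rewrite addn1.
have xn : (x.+1 < n.+1)%N by apply: leq_trans upn.
have h : (f (Ordinal xn) + (up - x.+1) <= c)%N by apply: IH => /=; lia.
have h' := fI x (Ordinal xn) lox (ltnSn _) xup'.
by move: (nat_of_ord (f x)) (nat_of_ord (f (Ordinal xn))) h h' => u v h h'; lia.
Qed.

Lemma min_coset_rep_block w : min_coset_rep i w ->
  homo_block w 0 i /\ homo_block w i n.+1.
Proof.
move=> minw; split=> x y lox xy yup; apply: (min_coset_rep_homo minw) xy.
  by rewrite yup.
by rewrite lox orbT.
Qed.

(** The longest element reverses all positions and differs from w0 by a
    permutation that preserves the two blocks, so w0 exchanges the blocks; and
    it is increasing on each of them. *)
Lemma longest_min_repE w0 t : longest_min_rep i w0 ->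
  w0 t = (if (t < i)%N then p + t else t - i)%N :> nat.
Proof.
move=> [min0 [u /[!inE] /forallP pu lu]].
have w0E x : w0 (u x) = rev_ord x.
  by rewrite -(longestE x lu) /wmul permM.
have blockE x : exists2 y : 'I_n.+1, w0 x = rev_ord y & (y < i)%N = (x < i)%N.
  exists ((u^-1)%g x); first by rewrite -w0E permKV.
  by rewrite -(eqP (pu ((u^-1)%g x))) permKV.
have [h1 h2] := min_coset_rep_block min0.
have tn := ltn_ord t; apply/eqP; rewrite eqn_leq; case: ifPn => [ti|]; last rewrite -leqNgt => ti.
  have ge : (p + (t - 0) <= w0 t)%N.
    apply: (homo_block_ge h1) => // x /= xi; have [y -> /=] := blockE x.
    by rewrite xi => yi; lia.
  have le : (w0 t + (i - t) <= n.+1)%N by apply: (homo_block_le h1) => //; lia.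
  by move: (nat_of_ord (w0 t)) ge le => u0 ge le; lia.
have ge : (0 + (t - i) <= w0 t)%N by apply: (homo_block_ge h2); rewrite ?ti.
have le : (w0 t + (n.+1 - t) <= p)%N.
  apply: (homo_block_le h2) => // [x /andP[xi _]|]; last by rewrite ti.
  have [y -> /=] := blockE x; rewrite (leq_gtF xi) => /negbT; rewrite -leqNgt => yi.
  by have := ltn_ord y; lia.
by move: (nat_of_ord (w0 t)) ge le => u0 ge le; lia.
Qed.

Variables (w w0 : 'S_n.+1).
Hypotheses (hw : min_coset_rep i w) (hw0 : longest_min_rep i w0).

Lemma tau_large t x : (t < i)%N -> x = (p + t)%N :> nat -> wmul w (w0^-1)%g x = w t.
Proof.
move=> ti xt; rewrite /wmul permM; congr (w _); apply: (@perm_inj _ w0); rewrite permKV.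
by apply: ord_inj; rewrite longest_min_repE // ti.
Qed.

Lemma tau_small x y : (x < p)%N -> y = (x + i)%N :> nat -> wmul w (w0^-1)%g x = w y.
Proof.
move=> xp yx; rewrite /wmul permM; congr (w _); apply: (@perm_inj _ w0); rewrite permKV.
by apply: ord_inj; rewrite longest_min_repE // yx ltnNge leq_addl /= addnK.
Qed.

Lemma min_rep_ge t : (t < i)%N -> (t <= w t)%N.
Proof.
move=> ti; have [h1 _] := min_coset_rep_block hw.
by have := @homo_block_ge w 0 i 0 h1 (fun=> fun=> isT) t ti; rewrite subn0.
Qed.

Lemma min_rep_le t : (t < i)%N -> (w t <= p + t)%N.
Proof.
move=> ti; have [h1 _] := min_coset_rep_block hw.
have h : (w t + (i - t) <= n.+1)%N by apply: (homo_block_le h1) => //; lia.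
by move: (nat_of_ord (w t)) h => u h; lia.
Qed.

(** Below w t lie t values of the first block and an initial segment of the
    second one. *)
Lemma min_rep_lt_iff t y : (t < i)%N -> (i <= y)%N -> (w y < w t)%N = (y < i + (w t - t))%N.
Proof.
move=> ti iy; have [h1 h2] := min_coset_rep_block hw.
pose A := [set z : 'I_n.+1 | (i <= z)%N && (w z < w t)%N].
have cardA : #|A| = (w t - t)%N.
  pose B := [set z : 'I_n.+1 | (w z < w t)%N].
  have cB : #|B| = w t.
    rewrite -[RHS]subn0 -(card_ord_interval 0 (ltnW (ltn_ord (w t)))) -(card_imset _ (@perm_inj _ w)).
    apply: eq_card => z; rewrite inE /=; apply/imsetP/idP => [[z' + ->]|zt]; first by rewrite inE.
    by exists ((w^-1)%g z); rewrite ?inE permKV.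
  rewrite -cB -(cardsID [set z : 'I_n.+1 | (i <= z)%N] B).
  have -> : B :&: [set z : 'I_n.+1 | (i <= z)%N] = A by apply/setP => z; rewrite !inE andbC.
  have -> : #|B :\: [set z : 'I_n.+1 | (i <= z)%N]| = t.
    rewrite -[RHS]subn0 -(card_ord_interval 0 (ltnW (ltn_ord t))); apply: eq_card => z.
    rewrite !inE /= -ltnNge; apply/andP/idP => [[zi wzt]|zt].
      rewrite ltnNge leq_eqVlt; apply/negP => /orP[/eqP/ord_inj e|tz].
        by rewrite e ltnn in wzt.
      by have := h1 t z isT tz zi; rewrite ltnNge ltnW.
    by rewrite (ltn_trans zt ti) h1.
  by rewrite addnK.
apply/idP/idP => [wyt|yt].
  have : (#|[set z : 'I_n.+1 | (i <= z < y.+1)%N]| <= #|A|)%N.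
    apply/subset_leq_card/fintype.subsetP => z; rewrite !inE ltnS => /andP[iz zy].
    rewrite iz; apply: leq_ltn_trans wyt.
    by move: zy; rewrite leq_eqVlt => /orP[/eqP/ord_inj->//|zy]; rewrite ltnW // h2.
  by rewrite cardA card_ord_interval; [lia | exact: ltn_ord].
rewrite ltnNge leq_eqVlt; apply/negP => /orP[/eqP/ord_inj/perm_inj e|wty].
  by rewrite e ltnNge iy in ti.
have : (#|A| <= #|[set z : 'I_n.+1 | (i <= z < y)%N]|)%N.
  apply/subset_leq_card/fintype.subsetP => z; rewrite !inE => /andP[iz wzt].
  rewrite iz ltnNge leq_eqVlt; apply/negP => /orP[/eqP/ord_inj e|yz].
    by rewrite e in wty; have := ltn_trans wty wzt; rewrite ltnn.
  by have := ltn_trans wzt (ltn_trans wty (h2 y z iy yz (ltn_ord z))); rewrite ltnn.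
by rewrite cardA card_ord_interval; [lia | exact: ltnW].
Qed.

Lemma alphaE (k j : nat) : (k <= j)%N -> alpha int n k j = eps int n k - eps int n j.+1.
Proof.
move=> kj; rewrite /alpha /simple_root -opprB -(telescope_sumr _ (leqW kj)) -sumrN.
by apply: eq_bigr => r _; rewrite opprB.
Qed.

Lemma pos_root_eps x y : x != y -> pos_root (eps int n y.+1 - eps int n x.+1) = (y < x)%N.
Proof.
move=> nxy; apply/existsP/idP => [[k /existsP[j /and3P[k0 kj /eqP]]]|yx]; last first.
  have yn : (y.+1 < n.+1)%N by rewrite (leq_ltn_trans yx).
  by exists (Ordinal yn); apply/existsP; exists x; apply/and3P; split=> //; rewrite alphaE.
rewrite alphaE // => /rowP e.
have := e y; rewrite !mxE eqxx eqSS (negPf (_ : y != x :> nat)) 1?eq_sym ?val_eqE //.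
have := e x; rewrite !mxE !eqSS eqxx (negPf (_ : x != y :> nat)) ?val_eqE //.
case: eqP => // _; case: eqP => // xj; case: eqP => // ky; case: eqP => // _ _ _.
by rewrite xj; apply: leq_trans kj; rewrite ky.
Qed.

Lemma Rw_minusE (k j : nat) t y : k = t.+1 -> j = y -> (t < y)%N ->
  Rw_minus w (alpha int n k j) = (w y < w t)%N.
Proof.
move=> -> -> ty; have nty : t != y by rewrite -val_eqE (ltn_eqF ty).
rewrite /Rw_minus /neg_root alphaE // pos_root_eps 1?eq_sym // ty andbT.
have -> : wact w (eps int n t.+1 - eps int n y.+1) = eps int n (w t).+1 - eps int n (w y).+1.
  by apply/rowP => a; rewrite !mxE !eqSS !val_eqE !(canF_eq (permKV w)).
by rewrite opprB pos_root_eps // (inj_eq perm_inj).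
Qed.

(** The root alpha_{k,j} is an inversion of w when w j < w t, with 0-based
    positions t = k - 1 and j; by min_rep_lt_iff these j form an interval of
    length w t - t. *)
Lemma ellE (k : nat) t : k = t.+1 -> (t < i)%N -> ell i w k = (i.-1 + (w t - t))%N.
Proof.
move=> kt ti; rewrite /ell; have wt := min_rep_le ti; have wg := min_rep_ge ti.
have EP j : (i <= j < n.+1)%N -> Rw_minus w (alpha int n k j) = (j < i + (w t - t))%N.
  move=> /andP[ij jn]; rewrite -(min_rep_lt_iff (y := Ordinal jn) ti ij).
  by apply: Rw_minusE => //; apply: leq_trans ti ij.
have -> : (\max_(i <= j < n.+1 | Rw_minus w (alpha int n k j)) j =
    \max_(i <= j < n.+1 | (j < i + (w t - t))%N) j)%N.
  rewrite big_seq_cond [RHS]big_seq_cond; apply: eq_bigl => j.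
  by case: (boolP (_ \in _)) => //; rewrite mem_index_iota => /EP ->.
apply/eqP; rewrite eqn_leq geq_max; apply/andP; split.
  rewrite leq_addr /=; apply/bigmax_leqP_seq => j _; lia.
have [c0|cpos] := posnP (w t - t)%N; first by rewrite c0 addn0 leq_maxl.
rewrite leq_max; apply/orP; right.
apply: (@bigop.leq_bigmax_seq _ _ _ id (i.-1 + (w t - t))%N); last by lia.
rewrite mem_index_iota; move: (nat_of_ord (w t)) wt wg cpos => u; have := ltn_ord t; lia.
Qed.

End Grassmannian.

(** * Tokens and types of Kogan faces *)

Section Tokens.
Implicit Types (D : pred (nat * nat)) (r a b k j c : nat).

(** The positions 1, 2, ... under s_r. *)
Definition step r a := if a == r then r.+1 else if a == r.+1 then r else a.

(** A token crossing the cells j, ..., j + c - 1 of row k, from right to left. *)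
Fixpoint run D k j c b := if c is c'.+1 then
  let b' := run D k j.+1 c' b in if D (k, j) then step (k + j) b' else b' else b.

(** A token crossing the rows 0, ..., k - 1. *)
Fixpoint cross n D k b := if k is k'.+1 then run D k' 1 (n - k') (cross n D k' b) else b.

Lemma foldr_run D k j c b :
  foldr step b [seq (k + j')%N | j' <- iota j c & D (k, j')] = run D k j c b.
Proof. by elim: c j => //= c IH j; case: ifP => _ /=; rewrite IH. Qed.

(** The type of a face is a product of functions, so its last letters act
    first: a token crosses the rows from the top row down, and each row from
    right to left. *)
Lemma foldr_cross n D K b :
  foldr step b (flatten [seq [seq (k + j)%N | j <- iota 1 (n - k) & D (k, j)] | k <- rev (iota 0 K)]) =
  cross n D K b.
Proof.
elim: K => [//|K IH]; rewrite [cross _ _ _ _]/= -IH -foldr_run.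
by rewrite -[in LHS](addn1 K) iotaD rev_cat map_cat flatten_cat foldr_cat /= cats0.
Qed.

Lemma simple_refl_step n r (x : 'I_n.+1) : (0 < r <= n)%N ->
  (simple_refl n r x).+1 = step r x.+1.
Proof.
case: r => //= r rn; rewrite /simple_refl /step permE /= -!val_eqE /= !inordK ?eqSS //; last exact: ltnW.
by case: ifP => _; [rewrite inordK | case: ifP => _ //; rewrite inordK // ltnW].
Qed.

Lemma word_elt_step n s (x : 'I_n.+1) : all (fun r => 0 < r <= n)%N s ->
  (word_elt n s x).+1 = foldr step x.+1 s.
Proof.
elim/last_ind: s x => [|s r IH] x; first by rewrite /word_elt /= perm1.
rewrite all_rcons => /andP[rn sn]; rewrite foldr_rcons -simple_refl_step //.
by rewrite word_elt_rcons /wmul permM IH.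
Qed.

Lemma kogan_type_cross n D (x : 'I_n.+1) : (kogan_type n D x).+1 = cross n D n x.+1.
Proof.
rewrite /kogan_type word_elt_step ?foldr_cross //; apply/allP => r.
case/flattenP=> l /mapP[k]; rewrite mem_rev mem_iota => /andP[_ kn] -> /mapP[j].
by rewrite mem_filter mem_iota => /and3P[_ j1 jn] ->; lia.
Qed.

Definition from_column j0 D : pred (nat * nat) := fun x => D x && (j0 <= x.2)%N.

Lemma eq_run D D' k j c b : (forall j', (j <= j')%N -> D (k, j') = D' (k, j')) ->
  run D k j c b = run D' k j c b.
Proof.
elim: c j => //= c IH j eD; rewrite eD // IH // => j' jj'.
by apply: eD; apply: ltnW.
Qed.

Lemma eq_cross n D D' k b : (forall k j, (0 < j)%N -> D (k, j) = D' (k, j)) ->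
  cross n D k b = cross n D' k b.
Proof. by move=> eD; elim: k => //= k ->; apply: eq_run => j; apply: eD. Qed.

(** Dropping the leftmost column raises the final position of a token by at most
    one: the two tokens coincide until the column moves one of them, and the other
    one is then to the left of all later cells. *)
Lemma cross_column n D j k b :
  let x := cross n (from_column j D) k b in let y := cross n (from_column j.+1 D) k b in
  x = y \/ (y <= k + j /\ y <= x.+1)%N.
Proof.
elim: k => [|k IH] /=; first by left.
move: {IH} (cross n (from_column j D) k b) (cross n (from_column j.+1 D) k b) IH => x y xy.
have : forall c j', let X := run (from_column j D) k j' c x in
    let Y := run (from_column j.+1 D) k j' c y in
    X = Y \/ ((Y <= k + j + (j' <= j)) /\ Y <= X.+1)%N.
  elim=> [|c IHc] j' /=.
    by case: xy => [->|[h1 h2]]; [left | right; split=> //; apply: leq_trans h1 (leq_addr _ _)].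
  have := IHc j'.+1 => /=.
  move: (run (from_column j D) _ _ _ x) (run (from_column j.+1 D) _ _ _ y) => X Y.
  rewrite /from_column /=; case: (D (k, j')) => /=; last first.
    by case=> [->|[h1 h2]]; [left | right; split=> //; lia].
  rewrite /step; case: (ltngtP j j') => [jj'|jj'|->] /=.
  - case=> [->|[h1 h2]]; first by left.
    right; split; first by do 2?[case: eqP => ?]; lia.
    by do 4?[case: eqP => ?]; lia.
  - by case=> [->|[h1 h2]]; [left | right; split=> //; lia].
  - case=> [->|[h1 h2]]; do 2?[case: eqP => ?]; try (by left); right; lia.
move=> /(_ (n - k)%N 1%N) /=.
move: (run (from_column j D) _ _ _ x) (run (from_column j.+1 D) _ _ _ y) => X Y.
by case=> [->|[h1 h2]]; [left | right; split=> //; move: h1; case: (1 <= j)%N => /=; lia].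
Qed.

Lemma cross_columns n D j b :
  (cross n (from_column j.+1 D) n b <= cross n D n b + j)%N.
Proof.
elim: j => [|j IH].
  rewrite addn0 (@eq_cross _ _ D) // => k j j0.
  by rewrite /from_column /= j0 andbT.
by case: (cross_column n D j.+1 n b) => /=; lia.
Qed.

(** F r c stands for a condition on the vertex of column c on the antidiagonal r
    that propagates up and to the left, and along the cells of D. *)
Lemma cross_forces n p D j0 (F : nat -> nat -> Prop) b :
  (forall r c, (0 < c <= r)%N -> (r <= n)%N -> F r.+1 c -> F r c) ->
  (forall r c, (0 < c < r)%N -> (r <= n.+1)%N -> F r c.+1 -> F r c) ->
  (forall c, (0 < c <= p)%N -> F p c) -> (forall c, F c c -> (c <= p)%N) ->
  (forall k j, (k < n)%N -> (0 < j <= n - k)%N -> D (k, j) -> F (k + j)%N j -> F (k + j).+1 j) ->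
  (0 < j0 <= p)%N -> (0 < b <= p)%N -> (p <= n)%N ->
  let b' := cross n (from_column j0 D) n b in (0 < b' <= n.+1)%N /\ ((p < b')%N -> F b' j0).
Proof.
move=> F1 F2 F3 F0 F4 j0p bp pn.
have Fc r c c' : (0 < c <= c')%N -> (c' <= r <= n.+1)%N -> F r c' -> F r c.
  elim: c' => [|c' IH]; first by lia.
  move=> /andP[c0]; rewrite leq_eqVlt => /orP[/eqP-> //|cc'] /andP[cr rn] Fr.
  by apply: IH; [lia | lia | apply: F2 => //; lia].
have Fr r c c' : (0 < c <= c')%N -> (c' <= r <= n)%N -> F r.+1 c' -> F r c.
  by move=> h1 h2 h3; apply: (Fc _ _ c') => //; [lia | apply: F1 => //; lia].
pose J k j b := (0 < b <= n.+1)%N /\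
  ((p < b)%N -> F b (maxn j0 (if b <= k + j then b - k else b - k.+1))%N).
have row k c j b1 : (k < n)%N -> (0 < j)%N -> (j + c = (n - k).+1)%N ->
    J k (n - k).+1 b1 -> J k j (run (from_column j0 D) k j c b1).
  move=> kn; elim: c j => [|c IH] j j1 jc J1 /=; first by rewrite addn0 in jc; rewrite jc.
  have {IH} := IH j.+1 isT (etrans (addSnnS _ _) jc) J1.
  move: (run _ _ _ _ _) => {J1}b1 [b1n Fb1].
  have stay : J k j b1.
    split=> // pb1; have := Fb1 pb1; case: (leqP b1 (k + j)) => h; case: ifP => h'; try lia.
      by [].
    - by apply: Fc; lia.
    - by [].
  rewrite {1}/from_column /=; have [/andP[Dkj jj0]|] := boolP (D (k, j) && (j0 <= j)%N); last by [].
  rewrite /step; case: eqP => [eb|nb].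
    split=> [|pkj]; first lia.
    rewrite ifF; last by lia.
    have -> : (maxn j0 ((k + j).+1 - k.+1) = j)%N by lia.
    apply: F4 => //; first lia.
    have [pb|pb] := ltnP p b1; last first.
      have -> : (k + j = p)%N by lia.
      by apply: F3; lia.
    have := Fb1 pb; rewrite eb ifT; last by lia.
    by have -> : (maxn j0 (k + j - k) = j)%N by lia.
  case: eqP => [eb|nb'] //.
  split=> [|pkj]; first lia.
  have pb1 : (p < b1)%N by lia.
  have := Fb1 pb1; rewrite eb !ifT; try lia.
  have -> : (maxn j0 (k + j - k) = j)%N by lia.
  have -> : (maxn j0 ((k + j).+1 - k) = j.+1)%N by lia.
  have [k0 Fjj|k0 Fjj] := posnP k; last by apply: (Fr _ _ j.+1) => //; lia.
  by move: Fjj; rewrite k0 => /F0; lia.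
have all_rows k : (k <= n)%N -> J k (n - k).+1 (cross n (from_column j0 D) k b).
  elim: k => [_|k IH kn] /=; first by split=> [|pb]; lia.
  have [h1 h2] := row k (n - k)%N 1%N _ kn isT (add1n _) (IH (ltnW kn)).
  split=> // /h2; move: (run _ _ _ _ _) h1 => b2 h1; rewrite [X in _ -> F _ (maxn _ X)]ifT; last by lia.
  case: leqP => // h.
  by have [-> ->] : (maxn j0 (b2 - k) = j0)%N /\ (maxn j0 (b2 - k.+1) = j0)%N by split; lia.
have [b'n Fb'] := all_rows n (leqnn n); split=> // /Fb'.
by rewrite ifT; [have -> : (maxn j0 (cross n (from_column j0 D) n b - n) = j0)%N by lia | lia].
Qed.

End Tokens.

(** * A Kogan face of type tau *)

Section KoganFaces.
Variables (n i : nat).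
Hypothesis hi : (1 <= i <= n)%N.
Local Notation p := (n.+1 - i)%N.
Variables (w w0 : 'S_n.+1).
Hypotheses (hw : min_coset_rep i w) (hw0 : longest_min_rep i w0).
Local Notation tau := (wmul w (w0^-1)%g).
Implicit Types t x y : 'I_n.+1.

(** The number of vertices of the antidiagonal p + t + 1 that are forced to be
    equal to m. *)
Definition forced t : nat := (p - (w t - t))%N.

Lemma min_rep_sub_mono t t' : (t' <= t)%N -> (t < i)%N -> (w t' - t' <= w t - t)%N.
Proof.
move=> t't ti; have [h1 _] := min_coset_rep_block hw.
have : (w t' + (t - t') <= w t)%N.
  apply: (@homo_block_ge n w t' i) => [x y _ xy yi|x /andP[t'x xi]|].
  - exact: h1.
  - by move: t'x; rewrite leq_eqVlt => /orP[/eqP/ord_inj->//|t'x]; apply/ltnW/h1.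
  - by rewrite t't.
have := min_rep_ge hw (leq_ltn_trans t't ti).
by move: (nat_of_ord (w t)) (nat_of_ord (w t')) => u u'; lia.
Qed.

Lemma min_rep_lt_mono t t' : (t < i)%N -> (t' < i)%N -> (w t' < w t)%N = (t' < t)%N.
Proof.
move=> ti t'i; have [h1 _] := min_coset_rep_block hw.
apply/idP/idP => [wt|/h1]; last by apply.
by rewrite ltnNge leq_eqVlt; apply/negP => /orP[/eqP/ord_inj e|/(h1 t t')];
  [rewrite e ltnn in wt | move=> /(_ isT t'i); rewrite ltnNge ltnW].
Qed.

(** The cells of row w t are its first forced t cells; they carry the token p
    + t + 1 to its final position w t + 1. Tokens are 1-based, the values of w
    are 0-based. *)
Definition tau_cells : pred (nat * nat) := fun z =>
  [exists t : 'I_n.+1, [&& (t < i)%N, w t == z.1 :> nat & (z.2 <= forced t)%N]].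

(** A row whose cells are its first rho ones cyclically permutes an interval
    of positions. *)
Lemma run_initial (D : pred (nat * nat)) k rho c j b :
  (forall j', D (k, j') = (j' <= rho)%N) -> (0 < j)%N ->
  run D k j c b = if (rho < j)%N then b else
    let h := (k + minn rho (j + c).-1)%N in
    if b == h.+1 then (k + j)%N else if (k + j <= b <= h)%N then b.+1 else b.
Proof.
move=> DE; elim: c j => [|c IH] j j0 /=.
  by case: ltnP => // jr; case: eqP => [->|]; [lia | case: ifP => //; lia].
rewrite IH // DE /step /=; have [rj|jr] := ltnP rho j; first by rewrite ltnW // ltnS ltnW.
rewrite ltnS; case: leqP => [rj|{}jr].
  have -> : rho = j by lia.
  have -> : minn j (j + c.+1).-1 = j by lia.
  by case: eqP => [->|]; case: eqP => //; case: ifP => //; lia.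
have -> : (minn rho (j.+1 + c).-1 = minn rho (j + c.+1).-1)%N by lia.
have : (j <= minn rho (j + c.+1).-1)%N by lia.
move: (minn rho _) => h {IH DE jr j0} hj.
case: (b =P (k + h).+1) => [eb|nb]; first by repeat (case: ifP => ?); lia.
by case: (boolP (k + j.+1 <= b <= k + h)%N) => hb; repeat (case: ifP => ?); lia.
Qed.

Lemma run_idle (D : pred (nat * nat)) k c j b :
  (forall j', D (k, j') = false) -> run D k j c b = b.
Proof. by move=> D0; elim: c j => //= c IH j; rewrite D0 IH. Qed.

Lemma tau_cells_row t j : (t < i)%N -> tau_cells (nat_of_ord (w t), j) = (j <= forced t)%N.
Proof.
move=> ti; apply/existsP/idP => [[t' /and3P[_ /eqP/ord_inj/perm_inj -> //]]|jt].
by exists t; rewrite ti eqxx jt.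
Qed.

Lemma run_tau_cells t b : (t < i)%N ->
  run tau_cells (w t) 1 (n - w t) b =
  if b == (p + t).+1 then (w t).+1 else if (w t < b <= p + t)%N then b.+1 else b.
Proof.
move=> ti; rewrite (run_initial (rho := forced t)) // => [|j]; last exact: tau_cells_row.
have := min_rep_ge hw ti; have := min_rep_le hi hw ti; have wn := ltn_ord (w t).
rewrite /forced; move: (nat_of_ord (w t)) wn => u wn h1 h2; rewrite addn1.
case: ltnP => hr.
  have -> : u = (p + t)%N by lia.
  by case: eqP => [->//|_]; case: ifP => //; lia.
have -> : (u + minn (p - (u - t)) (1 + (n - u)).-1 = p + t)%N by lia.
by [].
Qed.

Lemma row_cases k : {t : 'I_n.+1 | (t < i)%N & w t = k :> nat} + {forall j, tau_cells (k, j) = false}.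
Proof.
have [h|h] := boolP [exists t : 'I_n.+1, (t < i)%N && (w t == k :> nat)].
  by left; move: (xchooseP (existsP h)) => /andP[ti /eqP wt]; exists (xchoose (existsP h)).
right=> j; apply: contraNF h => /existsP[t /and3P[ti wt _]].
by apply/existsP; exists t; rewrite ti.
Qed.

(** The token p + t + 1 waits until row w t takes it to w t + 1, which is the
    start of that row; no later row moves it again. *)
Lemma cross_tau_large t k : (t < i)%N ->
  cross n tau_cells k (p + t).+1 = if (w t < k)%N then (w t).+1 else (p + t).+1.
Proof.
move=> ti; elim: k => //= k ->; have [[t' t'i <-]|idle] := row_cases k; last first.
  rewrite run_idle // ltnS; case: (ltngtP (w t) k) => // e.
  have := idle 0%N; rewrite -e tau_cells_row //.
rewrite run_tau_cells //; have wp := min_rep_le hi hw t'i.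
case: (ltngtP t t') => [tt'|t't|/ord_inj ->]; last by rewrite ltnn eqxx leqnn.
  have := tt'; rewrite -(min_rep_lt_mono t'i ti) => wtt'; rewrite wtt' [in RHS]ltnS (ltnW wtt').
  move: (nat_of_ord (w t)) (nat_of_ord (w t')) wp wtt' => u u' wp uu'.
  by rewrite ifF 1?ifF //; lia.
have := t't; rewrite -(min_rep_lt_mono ti t'i) => wt't.
move: (nat_of_ord (w t)) (nat_of_ord (w t')) wp wt't => u u' wp uu'.
by rewrite ltnNge ltnW //= [in RHS]ltnNge uu' /= ifF 1?ifF //; lia.
Qed.

(** The row w t only shifts the small tokens past w t up by one, which
    preserves their order; they stay below every token p + t + 1 that still
    waits. *)
Lemma cross_tau_small a b k : (a < b <= p)%N ->
  (cross n tau_cells k a < cross n tau_cells k b)%N /\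
  forall t, (t < i)%N -> (k <= w t)%N -> (cross n tau_cells k b <= p + t)%N.
Proof.
move=> abp; elim: k => /= [|k [IHab IH]]; first by split=> [|t ti _]; lia.
have [[t' t'i wt']|idle] := row_cases k; last first.
  by rewrite !run_idle //; split=> // t ti kt; apply: IH => //; apply: ltnW.
have := IH t' t'i; rewrite wt' leqnn => /(_ isT) bt'.
have rowE := fun c => run_tau_cells c t'i; rewrite wt' in rowE; rewrite !rowE.
move: (cross n tau_cells k a) (cross n tau_cells k b) IHab bt' {IH} => x y xy yt'.
have yE : (y == (p + t').+1) = false by lia.
have xE : (x == (p + t').+1) = false by lia.
rewrite yE xE /=; split=> [|t ti kt]; first by do 2?case: ifP; lia.
have t't : (t' < t)%N by rewrite -(min_rep_lt_mono ti t'i) wt'.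
by case: ifP; lia.
Qed.

(** Both permutations fill the positions below q increasingly with the same
    set of values. At the first position where they differ, the smaller of the
    two values would be out of order in the other permutation. *)
Lemma perm_eq_homo (u v : 'S_n.+1) (q : nat) :
  (forall x, (q <= x)%N -> u x = v x) ->
  homo_block u 0 q -> homo_block v 0 q -> u = v.
Proof.
move=> uv hu hv; apply/permP => x; have [xq|] := ltnP x q; last exact: uv.
have [k] := ubnP (nat_of_ord x); elim: k x xq => // k IH x xq; rewrite ltnS => xk.
have half (f g : 'S_n.+1) : homo_block g 0 q -> (forall z : 'I_n.+1, (q <= z)%N -> f z = g z) ->
    (forall z : 'I_n.+1, (z < x)%N -> f z = g z) -> (f x < g x)%N -> False.
  move=> hg fgq fgx fgx'; pose y := (g^-1)%g (f x).
  have gy : g y = f x by rewrite permKV.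
  have [yx|xy] := ltnP y x.
    have /perm_inj e : f y = f x by rewrite fgx.
    by rewrite e ltnn in yx.
  have [yq|qy] := ltnP y q; last first.
    have /perm_inj e : f y = f x by rewrite fgq.
    by rewrite -e ltnNge qy in xq.
  move: xy; rewrite leq_eqVlt => /orP[/eqP/ord_inj e|xy].
    by move: gy; rewrite -e => e'; rewrite e' ltnn in fgx'.
  by have := hg x y isT xy yq; rewrite gy ltnNge (ltnW fgx').
have small (z : 'I_n.+1) : (z < x)%N -> u z = v z.
  by move=> zx; apply: IH; [apply: ltn_trans zx xq | apply: leq_trans zx xk].
case: (ltngtP (u x) (v x)) => [h|h|/ord_inj //].
  by case: (half u v hv uv small h).
by case: (half v u hu (fun z qz => esym (uv z qz)) (fun z zx => esym (small z zx)) h).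
Qed.

Lemma tau_homo : homo_block tau 0 p.
Proof.
have [_ h2] := min_coset_rep_block hw.
move=> x y _ xy yp.
have lift_i (z : 'I_n.+1) : (z < p)%N -> exists z' : 'I_n.+1, z' = (z + i)%N :> nat.
  by move=> zp; have h : (z + i < n.+1)%N by [lia]; exists (Ordinal h).
have [x' ex] := lift_i x (ltn_trans xy yp); have [y' ey] := lift_i y yp.
rewrite (tau_small hi w hw0 (ltn_trans xy yp) ex) (tau_small hi w hw0 yp ey).
by apply: h2; rewrite ?ex ?ey ?leq_addl ?ltn_add2r // -ey.
Qed.

Lemma large_pos x : (p <= x)%N -> exists2 t : 'I_n.+1, (t < i)%N & x = (p + t)%N :> nat.
Proof.
move=> px; have xn := ltn_ord x; have tn : (x - p < n.+1)%N by lia.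
by exists (Ordinal tn) => /=; lia.
Qed.

(** Both permutations agree on the large positions and are increasing on the
    small ones. *)
Lemma kogan_type_tau : kogan_type n tau_cells = tau.
Proof.
apply: (@perm_eq_homo _ _ p) => [x /large_pos[t ti xt]|x y _ xy yp|]; last exact: tau_homo.
  rewrite (tau_large hi w hw0 ti xt); apply: ord_inj; apply: succn_inj; rewrite /=.
  rewrite kogan_type_cross xt cross_tau_large //.
  have h1 := min_rep_le hi hw ti; have h2 := ltn_ord (w t); have [//|nw] := ltnP (w t) n.
  by move: (nat_of_ord (w t)) h1 h2 nw => u; move: (ltn_ord x); rewrite xt; lia.
rewrite -ltnS !kogan_type_cross.
by case: (@cross_tau_small x.+1 y.+1 n) => //; rewrite ltnS xy.
Qed.

End KoganFaces.

(** * The largest Kogan face of type tau *)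

Section Faces.
Local Open Scope classical_set_scope.
Variables (R : realType) (n i : nat).
Hypothesis hi : (1 <= i <= n)%N.
Local Notation p := (n.+1 - i)%N.
Local Notation lam m := (fund_mult m p).
Implicit Types (s : nat * nat -> R) (m : nat).

Lemma gt_top_fund m j : gt_top n (lam m) j = if (j <= p)%N then m else 0%N.
Proof.
rewrite /gt_top /fund_mult -big_mkcond /=; case: leqP => jp.
  rewrite -big_filter (_ : seq.filter _ _ = [:: p]) ?big_seq1 //.
  rewrite filter_pred1_uniq ?iota_uniq // mem_index_iota jp; lia.
by rewrite big_seq_cond big_pred0 // => r; rewrite mem_index_iota; apply/negbTE; lia.
Qed.

Lemma GT_top m s j : GT n (lam m) s -> (0 < j <= n.+1)%N ->
  s (0%N, j) = (if (j <= p)%N then m else 0%N)%:R.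
Proof. by move=> [_ st _] jn; rewrite st ?gt_top_fund // /gt_vertex add0n. Qed.

Lemma GT_col m s k j : GT n (lam m) s -> (0 < j)%N -> (k.+1 + j <= n.+1)%N ->
  s (k.+1, j) <= s (k, j).
Proof. by move=> [_ _ sm] j0 kj; have /andP[] := sm k j (introT andP (conj j0 kj)). Qed.

Lemma GT_diag m s k j : GT n (lam m) s -> (0 < j)%N -> (k.+1 + j <= n.+1)%N ->
  s (k, j.+1) <= s (k.+1, j).
Proof. by move=> [_ _ sm] j0 kj; have /andP[] := sm k j (introT andP (conj j0 kj)). Qed.

Lemma GT_bounds m s k j : GT n (lam m) s -> (0 < j)%N -> (k + j <= n.+1)%N ->
  0 <= s (k, j) <= m%:R.
Proof.
move=> Gs; elim: k j => [|k IH] j j0 kj.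
  by rewrite (GT_top Gs) ?j0 //; case: ifP; rewrite lexx ler0n.
have /andP[h1 _] := IH j.+1 isT (etrans (congr1 (fun x => x <= n.+1)%N (addnS k j)) kj).
have /andP[_ h2] := IH j j0 (ltnW kj).
by rewrite (le_trans h1 (GT_diag Gs j0 kj)) (le_trans (GT_col Gs j0 kj) h2).
Qed.

(** The vertex lies above x_{0,k+j} in the poset, where the top row is still
    m. *)
Lemma GT_ones m s k j : GT n (lam m) s -> (0 < j)%N -> (k + j <= p)%N -> s (k, j) = m%:R.
Proof.
move=> Gs; elim: k j => [|k IH] j j0 kj; first by rewrite (GT_top Gs) ?kj //; lia.
have kj' : (k.+1 + j <= n.+1)%N by lia.
apply/eqP; rewrite eq_le; apply/andP; split.
  by have /andP[] := GT_bounds Gs j0 kj'.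
by rewrite -(IH j.+1) ?(GT_diag Gs) // addnS.
Qed.

Lemma GT_zeros m s k j : GT n (lam m) s -> (p < j)%N -> (k + j <= n.+1)%N -> s (k, j) = 0.
Proof.
move=> Gs pj; have j0 : (0 < j)%N by lia.
elim: k => [|k IH] kj; first by rewrite (GT_top Gs) ?(leq_gtF pj) ?j0 // leqNgt pj.
apply/eqP; rewrite eq_le -{1}(IH (ltnW kj)) (GT_col Gs) //=.
by have /andP[] := GT_bounds Gs j0 kj.
Qed.

Lemma GT_mono m s r c r' c' : GT n (lam m) s -> (0 < c' <= c)%N -> (c' <= r' <= r)%N ->
  (c <= r <= n.+1)%N -> s ((r - c)%N, c) <= s ((r' - c')%N, c').
Proof.
move=> Gs; have [d] := ubnP (r - r' + (c - c'))%N; elim: d r c => // d IH r c dd c'c r'r cr.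
have [/andP[/eqP-> /eqP-> //]|ne] := boolP ((r == r') && (c == c')).
have [cc'|cc'] := ltnP c' c.
  apply: (@le_trans _ _ (s ((r - c.-1)%N, c.-1))); last by apply: IH; lia.
  rewrite (_ : (r - c.-1 = (r - c).+1)%N); last lia.
  by rewrite {2}(_ : c = c.-1.+1); [apply: (GT_diag Gs); lia | lia].
apply: (@le_trans _ _ (s ((r.-1 - c)%N, c))); last by apply: IH; lia.
rewrite (_ : (r - c = (r.-1 - c).+1)%N); last lia.
by apply: (GT_col Gs); lia.
Qed.

Lemma GT_full_le m s r c r' c' : GT n (lam m) s -> (0 < c' <= c)%N -> (c' <= r' <= r)%N ->
  (c <= r <= n.+1)%N -> s ((r - c)%N, c) = m%:R -> s ((r' - c')%N, c') = m%:R.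
Proof.
move=> Gs c'c r'r cr e; apply/eqP; rewrite eq_le -{2}e (GT_mono Gs) // andbT.
by have /andP[] : 0 <= s ((r' - c')%N, c') <= m%:R by apply: (GT_bounds Gs); lia.
Qed.

Variables (w w0 : 'S_n.+1).
Hypotheses (hw : min_coset_rep i w) (hw0 : longest_min_rep i w0).
Local Notation tau := (wmul w (w0^-1)%g).

Definition tau_face m : set (nat * nat -> R) :=
  [set s | GT n (lam m) s /\ forall (t : 'I_n.+1) j, (t < i)%N ->
     (0 < j <= forced i w t)%N -> s (((p + t).+1 - j)%N, j) = m%:R].

(** Let u be the type of D restricted to the columns from rho = forced t on.
    If u moves some small position to p + t or beyond, then cross_forces shows
    that s takes the value m at column rho of the antidiagonal p + t + 1.
    Otherwise the positions that u moves to p + t or beyond are large, and by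
    cross_columns, which compares u with tau, they lie beyond p + t; there are
    too few of them. *)
Lemma kogan_face_sub m D : kogan_type n D = tau -> kogan_face n (lam m) D `<=` tau_face m.
Proof.
move=> Dtau s [Gs sD]; split=> // t j ti jf.
set rho := forced i w t in jf; have rho0 : (0 < rho <= p)%N by rewrite /rho /forced in jf *; lia.
suff key : s (((p + t).+1 - rho)%N, rho) = m%:R.
  by apply: (GT_full_le Gs _ _ _ key); lia.
pose u := kogan_type n (from_column rho D).
have uE x : (u x).+1 = cross n (from_column rho D) n x.+1 by rewrite /u kogan_type_cross.
have [/existsP[a /andP[ap ua]]|/existsPn no] := boolP [exists a : 'I_n.+1, (a < p)%N && (p + t <= u a)%N].
  pose F r c := (c <= p)%N /\ ((0 < c <= r)%N -> (r <= n.+1)%N -> s ((r - c)%N, c) = m%:R).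
  have full := GT_full_le Gs.
  have [] := @cross_forces n p D rho F a.+1.
  - move=> r c cr rn [cp h]; split=> // _ _; apply: (full r.+1 c); try lia.
    by apply: h; lia.
  - move=> r c cr rn [cp h]; split=> [|_ _]; first lia.
    by apply: (full r c.+1); try lia; apply: h; lia.
  - by move=> c cp; split=> [|_ _]; [lia | apply: (GT_ones Gs); lia].
  - by move=> c [].
  - move=> k c kn cn Dkc [cp h]; split=> // _ _; rewrite subSn ?leq_addl // addnK -sD //.
    by have := h _ _; rewrite addnK; apply; lia.
  - exact: rho0.
  - by rewrite /= ap.
  - by lia.
  rewrite -uE => _ /(_ (leq_trans (leq_addr t p) ua)) [_ h].
  by apply: (full (u a).+1 rho) => //; [lia | lia | have := ltn_ord (u a); lia | apply: h; have := ltn_ord (u a); lia].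
exfalso.
have uG x : (p + t <= u x)%N -> ((p + t).+1 <= x)%N.
  move=> ux; have px : (p <= x)%N by rewrite leqNgt; apply/negP => xp; have := no x; rewrite xp ux.
  have [y yi xy] := large_pos hi px.
  have := cross_columns n D rho.-1 x.+1; rewrite prednK; last by lia.
  rewrite -uE -kogan_type_cross Dtau (tau_large hi w hw0 yi xy) xy ltn_add2l -(min_rep_lt_mono hw yi ti).
  move: rho0 (min_rep_ge hw ti) (min_rep_le hi hw ti) ux; rewrite /rho /forced.
  by move: (nat_of_ord (w t)) (nat_of_ord (w y)) (nat_of_ord (u x)) => a b c; lia.
have : (#|[set x : 'I_n.+1 | (p + t <= x < n.+1)%N]%SET| <= #|[set x : 'I_n.+1 | ((p + t).+1 <= x < n.+1)%N]%SET|)%N.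
  rewrite -(on_card_preimset (f := u)); last by exists (u^-1)%g => z _; rewrite ?permK ?permKV.
  by apply/subset_leq_card/fintype.subsetP => x; rewrite !inE !ltn_ord !andbT => /uG.
rewrite !card_ord_interval //; lia.
Qed.

(** The cells of row w t join vertices on the antidiagonals up to p + t + 1,
    where their end points have the value m, because forced t decreases with
    t. *)
Lemma tau_face_kogan m : tau_face m = kogan_face n (lam m) (tau_cells i w).
Proof.
apply/seteqP; split; last exact: kogan_face_sub (kogan_type_tau hi hw hw0).
move=> s [Gs sF]; split=> // k j kn jn /existsP[t /and3P[ti /eqP /= wt jf]].
have [kjp|pkj] := leqP (k.+1 + j) p.
  by rewrite !(GT_ones Gs) //; lia.
have le_pt : (k + j <= p + t)%N.
  by move: jf (min_rep_ge hw ti) (min_rep_le hi hw ti); rewrite /forced wt; lia.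
have t'n : (k + j - p < n.+1)%N by lia.
pose t' := Ordinal t'n; have t't : (t' <= t)%N by rewrite /=; lia.
have := sF t' j (leq_ltn_trans t't ti).
have -> : ((p + t').+1 - j = k.+1)%N by rewrite /=; lia.
have jf' : (0 < j <= forced i w t')%N.
  by have := min_rep_sub_mono hi hw t't ti; move: jf; rewrite /forced; lia.
move=> /(_ jf') e; rewrite e; apply/eqP; rewrite eq_le.
have /andP[_ ->] : 0 <= s (k, j) <= m%:R by apply: (GT_bounds Gs); lia.
by rewrite -e (GT_col Gs) //; lia.
Qed.

Lemma max_kogan_faceE m F : max_kogan_face (lam m) tau F <-> F = tau_face m.
Proof.
have tt : kogan_face_of_type (lam m) tau (tau_face m).
  by exists (tau_cells i w); [exact: kogan_type_tau | exact: tau_face_kogan].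
have sub G : kogan_face_of_type (R := R) (lam m) tau G -> G `<=` tau_face m.
  by move=> [D Dt ->]; apply: kogan_face_sub.
split=> [[tF maxF]|->]; first by rewrite (maxF _ tt) //; apply: sub.
by split=> // G tG subG; apply/seteqP; split; [exact: sub | exact: subG].
Qed.

End Faces.

(** * The order polytope *)

Section OrderPolytope.
Local Open Scope classical_set_scope.
Variables (R : realType) (n i : nat).
Hypothesis hi : (1 <= i <= n)%N.
Local Notation p := (n.+1 - i)%N.
Local Notation lam m := (fund_mult m p).
Variables (w w0 : 'S_n.+1).
Hypotheses (hw : min_coset_rep i w) (hw0 : longest_min_rep i w0).
Implicit Types (s o : nat * nat -> R) (m : nat) (x y : nat * nat).
Local Notation P := (poset_elt i (ell i w)).

(** The vertices of the first p columns that are neither in the triangle of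
    entries m below the top row nor forced to be m. *)
Definition free_vertex x := [exists t : 'I_n.+1,
  [&& (t < i)%N, x.1 + x.2 == (p + t).+1 & (forced i w t < x.2 <= p)%N]].

Definition fixed_value m x : R := if gt_vertex n x && (x.2 <= p)%N then m%:R else 0.

Lemma tau_face_fixed m s x : @tau_face R n i w m s -> ~~ free_vertex x -> s x = fixed_value m x.
Proof.
case: x => k j [Gs sF] nf; rewrite /fixed_value.
have [vx|nv] := boolP (gt_vertex n (k, j)); last by case: Gs => -> .
have /andP[/= j0 kj] := vx; case: leqP => jp; last by rewrite (GT_zeros hi Gs).
have [kjp|pkj] := leqP (k + j) p; first by rewrite (GT_ones hi Gs).
have tn : ((k + j).-1 - p < n.+1)%N by lia.
pose t := Ordinal tn; have ti : (t < i)%N by rewrite /=; lia.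
have jf : (j <= forced i w t)%N.
  rewrite leqNgt; apply: contra nf => fj; apply/existsP; exists t; rewrite ti fj jp /= andbT.
  by apply/eqP; lia.
have := sF t j ti; rewrite j0 jf => /(_ isT) <-; congr (s (_, _)); rewrite /=; lia.
Qed.

Definition extension m o x := if free_vertex x then o x else fixed_value m x.

Lemma free_down k j : free_vertex (k, j) -> gt_vertex n (k.+1, j) -> free_vertex (k.+1, j).
Proof.
move=> /existsP[t /and3P[ti /eqP /= kj fj]] /andP[/= j0 kjn].
have tn : (t.+1 < n.+1)%N by lia.
apply/existsP; exists (Ordinal tn); have t'i : (Ordinal tn < i)%N by rewrite /=; lia.
have := @min_rep_sub_mono n i hi w hw (Ordinal tn) t (leqnSn t) t'i; rewrite t'i /= => h; apply/andP; split; first lia.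
by move: fj h; rewrite /forced /=; lia.
Qed.

Lemma free_right k j : free_vertex (k.+1, j) -> (j < p)%N -> free_vertex (k, j.+1).
Proof.
move=> /existsP[t /and3P[ti /eqP /= kj fj]] jp.
by apply/existsP; exists t; rewrite ti /=; lia.
Qed.

Lemma extension_face m o :
  (forall x, free_vertex x -> 0 <= o x <= m%:R) ->
  (forall x y, free_vertex x -> free_vertex y -> (x.1 + x.2 <= y.1 + y.2)%N -> (x.2 <= y.2)%N -> o y <= o x) ->
  @tau_face R n i w m (extension m o).
Proof.
move=> o0m omono.
have nfree_v x : ~~ gt_vertex n x -> free_vertex x = false.
  apply: contraNF => /existsP[t /and3P[ti /eqP xt /andP[fx xp]]].
  by apply/andP; split; lia.
have fix_bd x : 0 <= fixed_value m x <= m%:R.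
  by rewrite /fixed_value; case: ifP; rewrite lexx ler0n.
have ext_bd x : 0 <= extension m o x <= m%:R.
  by rewrite /extension; case: ifP => [/o0m|].
have ext_ge0 x : 0 <= extension m o x by case/andP: (ext_bd x).
have ext_lem x : extension m o x <= m%:R by case/andP: (ext_bd x).
have nfree_small k j : (k + j <= p)%N -> free_vertex (k, j) = false.
  by move=> kj; apply/existsP => -[t /and3P[_ /eqP /= e _]]; lia.
split; first split.
- by move=> x nv; rewrite /extension nfree_v // /fixed_value (negPf nv).
- move=> j vj; rewrite gt_top_fund // /extension.
  have -> : free_vertex (0%N, j) = false.
    by apply/existsP => -[t /and3P[_ /eqP /= e /andP[_ jp]]]; lia.
  by rewrite /fixed_value vj /=; case: ifP.
- move=> k j vkj; have /andP[/= j0 kj] := vkj.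
  have v1 : gt_vertex n (k, j.+1) by rewrite /gt_vertex /=; lia.
  have v2 : gt_vertex n (k, j) by rewrite /gt_vertex /=; lia.
  apply/andP; split.
    have [jp|pj] := ltnP j p; last first.
      rewrite [X in X <= _](_ : _ = 0) // /extension /fixed_value ifF ?ifF //.
        by rewrite v1 /= ltnNge pj.
      by apply/existsP => -[t /and3P[_ _ /andP[_ /=]]]; rewrite ltnNge pj.
    rewrite {2}/extension; case: ifP => [f1|_]; last first.
      by rewrite /fixed_value vkj /= (ltnW jp).
    have f2 := free_right f1 jp; rewrite /extension f2; apply: omono => //=; lia.
  rewrite {2}/extension; case: ifP => [f1|nf1].
    have f2 := free_down f1 vkj; rewrite /extension f2; apply: omono => //=; lia.
  rewrite /fixed_value v2 /=; case: leqP => // pj.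
  rewrite [X in X <= _](_ : _ = 0) // /extension /fixed_value ifF ?ifF //.
    by rewrite vkj /= leqNgt pj.
  by apply/existsP => -[t /and3P[_ _ /andP[_ /=]]]; rewrite leqNgt pj.
- move=> t j ti jf; rewrite /extension; have jp : (j <= p)%N by move: jf; rewrite /forced; lia.
  have tn : (t < n.+1)%N by [].
  have -> : free_vertex (((p + t).+1 - j)%N, j) = false.
    apply/existsP => -[t' /and3P[_ /eqP /= e /andP[f _]]].
    by have et : t' = t; [apply: ord_inj; lia | rewrite et in f; lia].
  by rewrite /fixed_value /gt_vertex /= jp ifT //; lia.
Qed.

(** Row k of the poset becomes the antidiagonal p + k of the Gelfand-Tsetlin
    poset, read from right to left. *)
Definition to_gt x : nat * nat := ((x.1 + x.2 - i)%N, (n.+1 - x.2)%N).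

Lemma poset_eltE x : P x <-> exists2 t : 'I_n.+1, (t < i)%N & x.1 = t.+1 /\ (i <= x.2 < i + (w t - t))%N.
Proof.
case: x => k j; rewrite /poset_elt /=; split.
  move=> [/andP[k0 ki] /andP[ij jl]].
  have tn : (k.-1 < n.+1)%N by lia.
  have ti : (Ordinal tn < i)%N by rewrite /=; lia.
  have kt : k = (Ordinal tn).+1 by rewrite /=; lia.
  exists (Ordinal tn) => //; split=> //; move: jl; rewrite (ellE hi hw kt ti).
  by move: (nat_of_ord (w _)) (nat_of_ord (Ordinal tn)) => u v; lia.
move=> [t ti [/= -> /andP[ij jl]]]; split; first lia.
rewrite (ellE hi hw erefl ti).
by move: (nat_of_ord (w t)) jl => u; lia.
Qed.

Lemma to_gt_free x : P x -> free_vertex (to_gt x).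
Proof.
move=> /poset_eltE[t ti [xt /andP[ix xl]]]; apply/existsP; exists t.
have h1 := min_rep_ge hw ti; have h2 := min_rep_le hi hw ti; rewrite /= /forced ti /= xt.
by move: (nat_of_ord (w t)) h1 h2 xl => u h1 h2 xl; lia.
Qed.

Lemma free_to_gt y : free_vertex y -> exists2 x, P x & to_gt x = y.
Proof.
move=> /existsP[t /and3P[ti /eqP ky /andP[fy yp]]].
have h1 := min_rep_ge hw ti; have h2 := min_rep_le hi hw ti.
exists (t.+1, (n.+1 - y.2)%N); last first.
  by case: y ky fy yp => k j /= ky fy yp; rewrite /to_gt /=; congr (_, _); lia.
apply/poset_eltE; exists t => //=; split => //.
by move: fy; rewrite /forced; move: (nat_of_ord (w t)) h1 h2 => u h1 h2; lia.
Qed.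

Lemma poset_elt_bounds x : P x -> [/\ (0 < x.1 <= i)%N, (i <= x.2 <= n)%N
   & gt_vertex n (to_gt x)].
Proof.
move=> /poset_eltE[t ti [xt /andP[ix xl]]].
have h1 := min_rep_ge hw ti; have h2 := min_rep_le hi hw ti.
move: (nat_of_ord (w t)) h1 h2 xl => u h1 h2 xl.
by split; rewrite /gt_vertex /=; lia.
Qed.

Lemma to_gt_inj x y : P x -> P y -> to_gt x = to_gt y -> x = y.
Proof.
move=> /poset_elt_bounds[hx1 hx2 _] /poset_elt_bounds[hy1 hy2 _].
by case: x y hx1 hx2 hy1 hy2 => [a b] [c d] /= ? ? ? ? [? ?]; congr (_, _); lia.
Qed.

(** Down column c to the antidiagonal r', then along this antidiagonal to
    column c'. *)
Lemma gtposet_ge_path (r c r' c' : nat) : (0 < c <= c')%N -> (c <= r <= r')%N ->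
  (c' <= r' <= n.+1)%N -> gtposet_ge n ((r - c)%N, c) ((r' - c')%N, c').
Proof.
move=> cc' rr' cr'; apply: (rt_trans _ _ _ ((r' - c)%N, c)).
  have [d] := ubnP (r' - r)%N; elim: d r rr' => // d IH r rr' dd.
  have [->|nr] := eqVneq r r'; first exact: rt_refl.
  apply: (rt_trans _ _ _ ((r.+1 - c)%N, c)); last by apply: IH; lia.
  apply: rt_step; split; rewrite /gt_vertex /=; try lia.
  by left; congr (_, _); lia.
have [d] := ubnP (c' - c)%N; elim: d c cc' {rr'} => // d IH c cc' dd.
have [->|nc] := eqVneq c c'; first exact: rt_refl.
apply: (rt_trans _ _ _ ((r' - c.+1)%N, c.+1)); last by apply: IH; lia.
apply: rt_step; split; rewrite /gt_vertex /=; try lia.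
by right; congr (_, _); lia.
Qed.

Lemma gtposet_ge_le x y : gtposet_ge n x y -> (x.1 + x.2 <= y.1 + y.2)%N /\ (x.2 <= y.2)%N.
Proof.
elim=> {x y} [x y [/andP[x0 _] /andP[y0 _] [->|->]]|x|x y z _ [h1 h2] _ [h3 h4]] /=; split; lia.
Qed.

Lemma to_gt_order x y : P x -> P y ->
  poset_ge x y <-> gtposet_ge n (to_gt x) (to_gt y).
Proof.
move=> /poset_elt_bounds[hx1 hx2 _] /poset_elt_bounds[hy1 hy2 _]; split.
  move=> [h1 h2].
  have := @gtposet_ge_path (p + x.1)%N (n.+1 - x.2)%N (p + y.1)%N (n.+1 - y.2)%N.
  rewrite /to_gt; have -> : (p + x.1 - (n.+1 - x.2) = x.1 + x.2 - i)%N by lia.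
  have -> : (p + y.1 - (n.+1 - y.2) = y.1 + y.2 - i)%N by lia.
  by apply; lia.
by move=> /gtposet_ge_le /= [h1 h2]; split; lia.
Qed.

(** The free vertices can all have the value 0, or all have the value 1. *)
Lemma defining_posetE x : defining_poset n (@tau_face R n i w 1) x <-> free_vertex x.
Proof.
split=> [[vx x1 nc]|fx].
  apply: contrapT => nf; apply: nc => s t Fs Ft.
  by rewrite (tau_face_fixed Fs) ?(tau_face_fixed Ft) //; apply/negP.
have ex c : (c <= 1)%N -> @tau_face R n i w 1 (extension 1 (fun=> c%:R)).
  by move=> c1; apply: extension_face => // y _; rewrite ler0n ler_nat.
have [y Py yx] := free_to_gt fx; have [h1 h2 v] := poset_elt_bounds Py.
split; [by rewrite -yx | by rewrite -yx /=; lia|].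
move=> /(_ _ _ (ex 0%N isT) (ex 1%N isT)); rewrite /extension fx => /eqP.
by rewrite eqr_nat.
Qed.

Lemma to_gt_bij : set_bij P (defining_poset n (@tau_face R n i w 1)) to_gt.
Proof.
split.
- by move=> x Px; apply/defining_posetE/to_gt_free.
- by move=> x y /set_mem Px /set_mem Py; apply: to_gt_inj.
- by move=> y /defining_posetE/free_to_gt[x Px <-]; exists x.
Qed.

Lemma tau_face_order_polytope m :
  set_bij (@tau_face R n i w m) (@order_polytope R i (ell i w) m) (pull_coords P to_gt).
Proof.
split.
- move=> s Fs; have [Gs _] := Fs; split.
  + by move=> x Px; rewrite /pull_coords ifF //; apply/negbTE/negP => /set_mem.
  + move=> x Px; rewrite /pull_coords mem_set //.
    by have [_ _ /andP[h1 h2]] := poset_elt_bounds Px; apply: (GT_bounds hi Gs).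
  + move=> x y Px Py [h1 h2] _; rewrite /pull_coords !mem_set //.
    have [hx1 hx2 _] := poset_elt_bounds Px; have [hy1 hy2 _] := poset_elt_bounds Py.
    have := @GT_mono _ _ _ hi m s (p + y.1)%N (n.+1 - y.2)%N (p + x.1)%N (n.+1 - x.2)%N Gs.
    rewrite /to_gt; have -> : (p + x.1 - (n.+1 - x.2) = x.1 + x.2 - i)%N by lia.
    have -> : (p + y.1 - (n.+1 - y.2) = y.1 + y.2 - i)%N by lia.
    by apply; lia.
- move=> s s' /set_mem Fs /set_mem Fs' e; apply/funext => y.
  have [/free_to_gt[x Px <-]|nf] := boolP (free_vertex y).
    by have := congr1 (fun f => f x) e; rewrite /pull_coords mem_set.
  by rewrite (tau_face_fixed Fs) ?(tau_face_fixed Fs').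
- move=> o [o0 obd omono].
  pose back y : nat * nat := ((y.1 + y.2 - p)%N, (n.+1 - y.2)%N).
  have backK x : P x -> back (to_gt x) = x.
    move=> /poset_elt_bounds[h1 h2 _]; case: x h1 h2 => a b /= h1 h2.
    by rewrite /back /=; congr (_, _); lia.
  exists (extension m (o \o back)).
    apply: extension_face => [y /free_to_gt[x Px <-]|y z /free_to_gt[x Px <-] /free_to_gt[x' Px' <-]] /=.
      by rewrite backK //; apply: obd.
    have [hx1 hx2 _] := poset_elt_bounds Px; have [hy1 hy2 _] := poset_elt_bounds Px'.
    rewrite !backK // => h1 h2; have [->|/eqP ne] := eqVneq x x'; first exact: lexx.
    by apply: omono => //; split; lia.
  apply/funext => x; rewrite /pull_coords; case: ifPn => [/set_mem Px|/negP nP].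
    by rewrite /extension to_gt_free //= backK.
  by rewrite o0 // => Px; apply: nP; apply: mem_set.
Qed.

End OrderPolytope.

(** * Lattice points and standard tableaux *)

Lemma card_eq_finset (T : finType) (U : Type) (G : {set T}) (A : set U) (g : T -> U) (x0 : T) :
  (forall x, x \in G -> A (g x)) -> {in G &, injective g} ->
  (forall y, A y -> exists2 x, x \in G & g x = y) -> (A #= `I_#|G|)%card.
Proof.
move=> gA gI Ag; pose f k := g (nth x0 (enum G) k).
have -> : A = (f @` `I_#|G|)%classic.
  apply/seteqP; split=> [y /Ag[x xG <-]|_ [k /= kG <-]]; last first.
    by apply: gA; rewrite -mem_enum mem_nth // -cardE.
  exists (index x (enum G)); first by rewrite /= cardE index_mem mem_enum.
  by rewrite /f nth_index ?mem_enum.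
have memG k : (k < #|G|)%N -> nth x0 (enum G) k \in G.
  by move=> kG; rewrite -mem_enum mem_nth // -cardE.
apply: inj_card_eq => k l; rewrite !inE /= => kG lG e.
have /eqP := gI _ _ (memG _ kG) (memG _ lG) e.
by rewrite nth_uniq -?cardE ?enum_uniq // => /eqP.
Qed.

Lemma initial_segment m (Q : pred 'I_m) l :
  (forall l l' : 'I_m, (l <= l')%N -> Q l' -> Q l) -> Q l = (l < #|[set l | Q l]|)%N.
Proof.
move=> Qd; apply/idP/idP => [Ql|]; last first.
  apply: contraLR => nQl; rewrite -leqNgt -[X in (_ <= X)%N]subn0.
  rewrite -(card_ord_interval 0 (ltnW (ltn_ord l))); apply/subset_leq_card/fintype.subsetP => l'.
  rewrite !inE /= => Ql'; rewrite ltnNge; apply: contra nQl => ll'; exact: Qd Ql'.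
rewrite -[X in (X <= _)%N]subn0 -(card_ord_interval 0 (ltn_ord l)).
by apply/subset_leq_card/fintype.subsetP => l'; rewrite !inE ltnS /= => l'l; apply: Qd Ql.
Qed.

Section LatticePoints.
Variables (R : realType) (n i m : nat).
Hypothesis hi : (1 <= i <= n)%N.
Local Notation p := (n.+1 - i)%N.
Local Notation lam := (fund_mult m p).
Local Notation idx := {ffun 'I_m * 'I_i -> 'I_n.+1}.
Variables (w w0 : 'S_n.+1).
Hypotheses (hw : min_coset_rep i w) (hw0 : longest_min_rep i w0).
Implicit Types (T : idx) (l : 'I_m) (t u : 'I_i) (k j : nat).

Lemma standard_row T l t u : standard T -> (t < u)%N -> (T (l, t) < T (l, u))%N.
Proof. by move=> /andP[/forallP/(_ l)/forallP/(_ t)/forallP/(_ u)/implyP]. Qed.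

Lemma standard_col T l l' t : standard T -> (l <= l')%N -> (T (l, t) <= T (l', t))%N.
Proof.
move=> /andP[_ /forallP/(_ l)/forallP/(_ l')/forallP/(_ t)/implyP h].
by rewrite leq_eqVlt => /orP[/eqP/ord_inj->|/h].
Qed.

Definition row_count T l k := #|[set t | (T (l, t) < k)%N]|.

(** The number of ones in row k of the 0/1 pattern of the row l of T. *)
Definition ones T l k := (p + row_count T l k - k)%N.

(** A standard tableau is a chain of m subsets of size i; the corresponding
    lattice point is the sum of the 0/1 patterns of their complements. *)
Definition tableau_point T : nat * nat -> R :=
  fun x => #|[set l | (0 < x.2 <= ones T l x.1)%N]|%:R.

Lemma row_count_lt T l t k : standard T -> (T (l, t) < k)%N = (t < row_count T l k)%N.
Proof.
move=> sT; apply: (@initial_segment i (fun t => (T (l, t) < k)%N)) => u v.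
by rewrite leq_eqVlt => /orP[/eqP/ord_inj->//|/(standard_row l sT)]; apply: ltn_trans.
Qed.

Lemma row_count0 T l : row_count T l 0 = 0%N.
Proof. by rewrite /row_count; apply/eqP; rewrite cards_eq0; apply/eqP/setP => t; rewrite !inE. Qed.

Lemma row_count_le T l k : (row_count T l k <= i)%N.
Proof. by apply: leq_trans (max_card _) _; rewrite card_ord. Qed.

Lemma row_countS T l (a : 'I_n.+1) :
  row_count T l a.+1 = (row_count T l a + #|[set t | T (l, t) == a]|)%N.
Proof.
rewrite /row_count -cardsUI (_ : _ :&: _ = finset.set0) ?cards0 ?addn0; last first.
  by apply/setP => t; rewrite !inE -val_eqE; case: ltngtP.
congr #|pred_of_set _|; apply/setP => t; rewrite !inE ltnS leq_eqVlt val_eqE orbC.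
by [].
Qed.

Lemma card_row_value T l (a : 'I_n.+1) : standard T -> (#|[set t | T (l, t) == a]| <= 1)%N.
Proof.
move=> sT; apply/card_le1_eqP => t u; rewrite !inE => /eqP et /eqP eu; apply: ord_inj.
by case: (ltngtP t u) => // /(standard_row l sT); rewrite et eu ltnn.
Qed.

Lemma row_count_last T l : row_count T l n.+1 = i.
Proof.
rewrite -[RHS](card_ord i) -cardsT; congr #|pred_of_set _|.
by apply/setP => t; rewrite !inE ltn_ord.
Qed.

Lemma row_count_ge T l k : standard T -> (k <= n.+1)%N -> (k <= p + row_count T l k)%N.
Proof.
move=> sT kn; have [d] := ubnP (n.+1 - k)%N; elim: d k kn => // d IH k kn dd.
have [->|nk] := eqVneq k n.+1; first by rewrite row_count_last; lia.
have kn' : (k < n.+1)%N by lia.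
have := IH k.+1 kn'; rewrite (row_countS T l (Ordinal kn')).
have := card_row_value l (Ordinal kn') sT.
by rewrite /=; move: #|_| (row_count _ _ _) => a b; lia.
Qed.

Lemma onesE T l k : standard T -> (k <= n.+1)%N ->
  (ones T l k)%:R = p%:R + (row_count T l k)%:R - k%:R :> R.
Proof. by move=> sT kn; rewrite natrB ?natrD // row_count_ge. Qed.

Lemma ones_le T l k : (k <= n.+1)%N -> (ones T l k <= n.+1 - k)%N.
Proof. by move=> kn; have := row_count_le T l k; rewrite /ones; lia. Qed.

Lemma onesS T l k : standard T -> (k <= n)%N ->
  (ones T l k.+1 <= ones T l k)%N /\ (ones T l k <= (ones T l k.+1).+1)%N.
Proof.
move=> sT kn; have kn' : (k < n.+1)%N by [].
have := card_row_value l (Ordinal kn') sT; have := row_countS T l (Ordinal kn').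
by rewrite /ones /=; move: #|_| (row_count _ _ k) (row_count _ _ k.+1) => a b c; lia.
Qed.

Lemma ones_anti T l l' k : standard T -> (l <= l')%N -> (ones T l' k <= ones T l k)%N.
Proof.
move=> sT ll'; rewrite /ones leq_sub2r // leq_add2l; apply/subset_leq_card/fintype.subsetP => t.
by rewrite !inE; apply: leq_ltn_trans (standard_col t sT ll').
Qed.

Lemma le_iN : (i <= n.+1)%N.
Proof. by lia. Qed.

Definition schubert_row : {ffun 'I_i -> 'I_n.+1} := [ffun t => w (widen_ord le_iN t)].

(** The entry T (l, t) is at most w t if and only if row l of T contributes 1
    to all the vertices that are forced on the antidiagonal p + t + 1. *)
Lemma tableau_point_face T : standard T -> below schubert_row T ->
  @tau_face R n i w m (tableau_point T).
Proof.
move=> sT bT; rewrite /tableau_point; split; first split.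
- case=> k j; rewrite /gt_vertex /= => nv; rewrite (_ : [set _ | _]%SET = finset.set0) ?cards0 //.
  apply/setP => l; rewrite !inE /=; apply: contraNF nv => /andP[j0 jq]; rewrite j0 /=.
  have [kn|nk] := leqP k n.+1; first by have := ones_le T l kn; lia.
  by have := row_count_le T l k; move: jq; rewrite /ones; lia.
- move=> j /andP[/= j0 jn]; rewrite gt_top_fund //; congr _%:R.
  have q0 l : ones T l 0 = p by rewrite /ones row_count0 addn0 subn0.
  case: (leqP j p) => jp; last first.
    by apply/eqP; rewrite cards_eq0; apply/eqP/setP => l; rewrite !inE q0 (ltn_geF jp) andbF.
  rewrite -[RHS](card_ord m) -cardsT; congr #|pred_of_set _|.
  by apply/setP => l; rewrite !inE q0 j0 jp.
- move=> k j /andP[/= j0 kj]; have kn : (k <= n)%N by lia.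
  rewrite !ler_nat; apply/andP; split; apply/subset_leq_card/fintype.subsetP => l; rewrite !inE /=;
    have [h1 h2] := onesS l sT kn; lia.
- move=> t j ti jf /=; congr _%:R.
  rewrite -[RHS](card_ord m) -cardsT; congr #|pred_of_set _|; apply/setP => l.
  rewrite !inE; have /andP[-> jf'] := jf; rewrite /ones.
  pose t' : 'I_i := Ordinal ti.
  have : (t' < row_count T l ((p + t).+1 - j))%N.
    rewrite -row_count_lt //; have /forallP/(_ l)/forallP/(_ t') := bT.
    rewrite !ffunE (_ : widen_ord le_iN t' = t); last exact: ord_inj.
    move: jf'; have := min_rep_ge hw ti; have := min_rep_le hi hw ti; rewrite /forced.
    by move: (nat_of_ord (w t)) (nat_of_ord (T _)) => a b; lia.
  by move: jf'; rewrite /= /forced; move: (row_count _ _ _) => c; lia.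
Qed.

Lemma tableau_point_lattice T : lattice_point (tableau_point T).
Proof. by move=> x; apply: natr_int. Qed.

Lemma gt_weightE (s : nat * nat -> R) (a : 'I_n.+1) :
  gt_weight n s 0 a = \sum_(1 <= j < n.+2) s (a.+1, j) - \sum_(1 <= j < n.+2) s (nat_of_ord a, j).
Proof.
rewrite /gt_weight summxE big_mkord (bigD1 a) //= [X in _ + X]big1 ?addr0 => [|k nk]; last first.
  rewrite summxE big1 // => j _; rewrite !mxE eqSS val_eqE eq_sym (negPf nk).
  by rewrite mulr0.
by rewrite summxE -sumrB; apply: eq_bigr => j _; rewrite !mxE eqxx mulr1.
Qed.

Lemma row_sum T k : (k <= n.+1)%N ->
  \sum_(1 <= j < n.+2) tableau_point T (k, j) = \sum_l (ones T l k)%:R :> R.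
Proof.
move=> kn; rewrite /tableau_point -!natr_sum; congr _%:R.
under eq_bigr do rewrite -sum1_card big_mkcond.
rewrite exchange_big; apply: eq_bigr => l _ /=; have ql := ones_le T l kn.
have -> : ones T l k = (\sum_(1 <= j < (ones T l k).+1) 1)%N.
  by rewrite sum_nat_const_nat subn1 muln1.
rewrite [RHS](big_nat_widen _ _ n.+2); last lia.
rewrite [RHS]big_mkcond; apply: eq_big_nat => j /andP[j1 _].
by rewrite inE j1 ltnS.
Qed.

Definition content T : 'rV[R[i]]_n.+1 := \row_a (#|[set q | T q == a]|)%:R.

Lemma wt_eval_content T (H : 'M[R[i]]_n.+1) : wt_eval (content T) H = \sum_q H (T q) (T q).
Proof.
rewrite /wt_eval (partition_big T predT) //=; apply: eq_bigr => a _.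
rewrite mxE (eq_bigr (fun=> H a a)) => [|q /eqP -> //].
rewrite sumr_const mulr_natl.
by congr (_ *+ _); apply: eq_card => q; rewrite inE.
Qed.

Lemma content_rows T a : #|[set q | T q == a]| = (\sum_l #|[set t | T (l, t) == a]|)%N.
Proof.
rewrite -sum1_card (eq_bigl (fun q : 'I_m * 'I_i => T q == a)) => [|q]; last by rewrite inE.
rewrite big_mkcond /=; under [RHS]eq_bigr do rewrite -sum1_card big_mkcond.
by rewrite pair_bigA; apply: eq_bigr => -[l t] _; rewrite inE.
Qed.

(** The weight of the point and the content of T differ by a multiple of (1,
    ..., 1), which vanishes on h. *)
Lemma gt_weight_point T (a : 'I_n.+1) : standard T ->
  gt_weight n (tableau_point T) 0 a = (#|[set q | T q == a]|)%:R - m%:R.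
Proof.
move=> sT; have an := ltn_ord a.
have -> : m%:R = \sum_(l < m) 1 :> R by rewrite sumr_const card_ord.
rewrite gt_weightE (row_sum T an) (row_sum T (ltnW an)) content_rows natr_sum -!sumrB.
apply: eq_bigr => l _; rewrite (onesE l sT an) (onesE l sT (ltnW an)) row_countS natrD.
by rewrite -natr1; ring.
Qed.

Lemma wt_eval_point T (H : 'M[R[i]]_n.+1) : standard T -> in_h H ->
  wt_eval (map_mx (real_complex R) (gt_weight n (tableau_point T))) H = wt_eval (content T) H.
Proof.
move=> sT [slH _]; rewrite /wt_eval.
transitivity (\sum_a content T 0 a * H a a - m%:R * \tr H); last by rewrite slH mulr0 subr0.
rewrite mulr_sumr -sumrB; apply: eq_bigr => a _; rewrite -mulrBl; congr (_ * _).
by rewrite !mxE gt_weight_point // rmorphB /= !rmorph_nat.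
Qed.

Lemma has_weightE mu T : has_weight mu T <->
  forall H, in_h H -> wt_eval (content T) H = wt_eval mu H.
Proof.
split=> [/forallP h H hH|h].
  rewrite (in_h_coroots hH); elim/big_rec: _ => [|r A _ IH].
    by rewrite !wt_eval0.
  by rewrite !wt_eval_lin IH wt_eval_content (eqP (h r)).
apply/forallP => r; apply/eqP; rewrite -wt_eval_content; apply: h.
exact: coroot_in_h.
Qed.

(** The rows of T that contribute to a given vertex form an initial segment,
    so the value of the point there tells which rows they are. *)
Lemma ones_point T l k j : standard T -> (0 < j)%N ->
  (j <= ones T l k)%N = (l < #|[set l | (0 < j <= ones T l k)%N]|)%N.
Proof.
move=> sT j0; rewrite -[LHS]andTb -{1}j0.
apply: (@initial_segment m (fun l => (0 < j <= ones T l k)%N)) => l1 l2 l12.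
by move=> /andP[-> /leq_trans]; apply; apply: ones_anti.
Qed.

(** The point determines the 0/1 pattern of each row of T, and the pattern
    determines the row. *)
Lemma tableau_point_inj T T' : standard T -> standard T' ->
  tableau_point T = tableau_point T' -> T = T'.
Proof.
move=> sT sT' e; have onesTT' l k : ones T l k = ones T' l k.
  suff le (S S' : idx) : standard S -> standard S' -> tableau_point S = tableau_point S' ->
      (ones S l k <= ones S' l k)%N by apply/eqP; rewrite eqn_leq !le.
  move=> sS sS' eS; have [->//|q0] := posnP (ones S l k); rewrite (ones_point l k sS') //.
  have /eqP := congr1 (fun f => f (k, ones S l k)) eS; rewrite /tableau_point /= eqr_nat => /eqP <-.
  by rewrite -(ones_point l k sS q0).
have countTT' l k : (k <= n.+1)%N -> row_count T l k = row_count T' l k.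
  move=> kn; have := onesTT' l k; have := row_count_ge l sT kn; have := row_count_ge l sT' kn.
  by rewrite /ones; lia.
suff le (S S' : idx) : standard S -> standard S' ->
    (forall l k, (k <= n.+1)%N -> row_count S l k = row_count S' l k) -> forall l t, (S' (l, t) <= S (l, t))%N.
  by apply/ffunP => -[l t]; apply: ord_inj; apply/eqP; rewrite eqn_leq !le // => l' k kn; rewrite countTT'.
move=> sS sS' eS l t; rewrite -ltnS (row_count_lt l t _ sS') -eS ?ltn_ord //.
by rewrite -row_count_lt.
Qed.


(** The number of vertices among the first p ones of the antidiagonal p + t +
    1 where cutting s at level l gives 0. *)
Definition deficit (s : nat * nat -> R) l t : nat :=
  #|[set j : 'I_p | s ((p + t).+1 - j.+1, j.+1)%N <= l%:R]|.

(** The l-th row is the increasing sequence whose complement has the 0/1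
    pattern of s cut at level l. *)
Definition point_tableau (s : nat * nat -> R) : idx :=
  [ffun q : 'I_m * 'I_i => inord (q.2 + deficit s q.1 q.2)].

Lemma deficit_le s l t : (deficit s l t <= p)%N.
Proof. by apply: leq_trans (max_card _) _; rewrite card_ord. Qed.

Lemma point_tableauE s l t : point_tableau s (l, t) = (t + deficit s l t)%N :> nat.
Proof.
by rewrite ffunE inordK //=; have := deficit_le s l t; have := ltn_ord t; lia.
Qed.

Lemma point_tableau_standard s : GT n lam s -> standard (point_tableau s).
Proof.
move=> Gs; apply/andP; split; apply/forallP => l; apply/forallP => a; apply/forallP => b; apply/implyP => ab;
  rewrite !point_tableauE.
  rewrite -addSn leq_add //; apply/subset_leq_card/fintype.subsetP => j; rewrite !inE.
  apply: le_trans; apply: (GT_mono hi Gs); have := ltn_ord j; have := ltn_ord b; lia.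
rewrite leq_add2l; apply/subset_leq_card/fintype.subsetP => j; rewrite !inE => /le_trans; apply.
by rewrite ler_nat ltnW.
Qed.

Lemma point_tableau_below s : @tau_face R n i w m s -> below schubert_row (point_tableau s).
Proof.
move=> [Gs sF]; apply/forallP => l; apply/forallP => t; rewrite !ffunE -/(point_tableau s).
have ti : (widen_ord le_iN t < i)%N by rewrite /=.
have h1 := min_rep_ge hw ti; have h2 := min_rep_le hi hw ti.
have := point_tableauE s l t; rewrite ffunE => ->; set t' := widen_ord le_iN t in ti h1 h2 *.
have : (deficit s l t <= p - forced i w t')%N.
  rewrite -[X in (_ <= X - _)%N](subnK (leqnn p)) subnn add0n.
  rewrite -(card_ord_interval (N := p) (forced i w t') (leqnn p)).
  apply/subset_leq_card/fintype.subsetP => j; rewrite !inE ltn_ord andbT => sl.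
  rewrite leqNgt; apply/negP => jf; have := sF t' j.+1 ti jf.
  by rewrite /= => e; move: sl; rewrite e ler_nat leqNgt ltn_ord.
by move: h1 h2; rewrite /forced /=; move: (nat_of_ord (w _)) (deficit _ _ _) => a b; lia.
Qed.

(** The values of s decrease along an antidiagonal, so the vertices counted by
    the deficit form a final segment. *)
Lemma deficit_lt s l t (j : nat) : GT n lam s -> (0 < j <= p)%N ->
  (deficit s l t <= p - j)%N = (l%:R < s (((p + t).+1 - j)%N, j)).
Proof.
move=> Gs jp; have tn := ltn_ord t.
have mono (j1 j2 : 'I_p) : (j1 <= j2)%N ->
    s ((p + t).+1 - j2.+1, j2.+1)%N <= s ((p + t).+1 - j1.+1, j1.+1)%N.
  by move=> j12; apply: (GT_mono hi Gs); have := ltn_ord j2; lia.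
have j1p : (j.-1 < p)%N by lia.
have jE : (Ordinal j1p).+1 = j by rewrite /=; lia.
apply/idP/idP => [|lts].
  apply: contraLR; rewrite -leNgt -ltnNge => sl.
  apply: (@leq_trans #|[set j' : 'I_p | (j.-1 <= j' < p)%N]|).
    by rewrite card_ord_interval //; lia.
  apply/subset_leq_card/fintype.subsetP => j'; rewrite !inE => /andP[jj' _].
  by apply: le_trans (mono (Ordinal j1p) j' jj') _; rewrite jE.
rewrite -(card_ord_interval (N := p) j (leqnn p)).
apply/subset_leq_card/fintype.subsetP => j'; rewrite !inE ltn_ord andbT => sl.
rewrite leqNgt; apply/negP => j'j; have j'j1 : (j' <= Ordinal j1p)%N by rewrite /=; lia.
have := le_trans (mono _ _ j'j1) sl; rewrite jE leNgt lts.
by [].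
Qed.

Lemma point_tableauK s : @tau_face R n i w m s -> lattice_point s ->
  tableau_point (point_tableau s) = s.
Proof.
move=> Fs ls; have [Gs _] := Fs; have sT := point_tableau_standard Gs.
have bT := point_tableau_below Fs; have FT := tableau_point_face sT bT.
apply/funext => x; have [fx|nf] := boolP (free_vertex i w x); last first.
  by rewrite (tau_face_fixed hi FT nf) (tau_face_fixed hi Fs nf).
have /existsP[t0 /and3P[ti /eqP kj /andP[_ jp]]] := fx.
case: x fx kj jp => k j /= fx kj jp; pose t : 'I_i := Ordinal ti.
have kE : k = ((p + t).+1 - j)%N by rewrite /=; lia.
have j0 : (0 < j)%N by have := ltn_ord t0; move: fx => /existsP[t1 /and3P[_ _ /andP[/=]]]; lia.
have kjn : (k + j <= n.+1)%N by lia.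
have /andP[s0 sm] : 0 <= s (k, j) <= m%:R by apply: (GT_bounds hi Gs).
have /intrP[z sz] := ls (k, j); have z0 : 0 <= z by rewrite -(ler0z R) -sz.
case: z sz z0 => // v sz _; have {}sz : s (k, j) = v%:R by [].
have vm : (v <= m)%N by rewrite sz ler_nat in sm.
rewrite sz /tableau_point /=; congr _%:R.
rewrite -[RHS]subn0 -(card_ord_interval 0 vm); apply: eq_card => l; rewrite !inE /= j0 /=.
have e : (j <= ones (point_tableau s) l k)%N = (t < row_count (point_tableau s) l k)%N.
  by rewrite /ones; move: (row_count _ _ _) => c; rewrite /=; lia.
rewrite e -(row_count_lt l t k sT) point_tableauE.
have -> : (t + deficit s l t < k)%N = (deficit s l t <= p - j)%N.
  by rewrite kE; have := deficit_le s l t; move: (deficit _ _ _) => d; lia.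
by rewrite deficit_lt ?j0 // -kE sz ltr_nat.
Qed.

(** Cutting a lattice point of the face at the levels 0, ..., m - 1 gives a
    chain of 0/1 patterns, that is, a standard tableau below w. *)
Lemma lattice_points_card (mu : 'rV[R[i]]_n.+1) :
  ([set s | [/\ @tau_face R n i w m s, lattice_point s &
       forall H, in_h H ->
         wt_eval (map_mx (real_complex R) (gt_weight n s)) H = wt_eval mu H]]
    #= `I_#|[set T : idx | [&& standard T, below schubert_row T & has_weight mu T]]%SET|)%classic%card.
Proof.
apply: (@card_eq_finset _ _ _ _ tableau_point [ffun=> ord0]).
- move=> T; rewrite inE => /and3P[sT bT /has_weightE wT]; split.
  + exact: tableau_point_face.
  + exact: tableau_point_lattice.
  + by move=> H hH; rewrite wt_eval_point // wT.
- by move=> T T'; rewrite !inE => /andP[sT _] /andP[sT' _]; apply: tableau_point_inj.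
- move=> s [Fs ls ws]; exists (point_tableau s); last exact: point_tableauK.
  have sT : standard (point_tableau s) by apply: point_tableau_standard; case: Fs.
  rewrite inE sT point_tableau_below //=; apply/has_weightE => H hH.
  by rewrite -wt_eval_point // point_tableauK // ws.
Qed.

End LatticePoints.

(** * Faces and Demazure modules *)

Lemma schubert_row_increasing n i (hi : (1 <= i <= n)%N) (w : 'S_n.+1) :
  min_coset_rep i w -> increasing (schubert_row hi w).
Proof.
move=> hw; have [h1 _] := min_coset_rep_block hw.
by apply/increasingP => t u tu; rewrite !ffunE; apply: h1 => //=.
Qed.

Local Open Scope classical_set_scope.
Local Open Scope ring_scope.

Theorem mainTheorem2 (R : realType) (n i : nat) (hi : (1 <= i <= n)%N)
    (w w0 : 'S_n.+1) (hw : min_coset_rep i w) (hw0 : longest_min_rep i w0) :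
  let tau := wmul w (w0^-1)%g in
  let lam := fun m : nat => fund_mult m (n.+1 - i) in
  [/\ forall m : nat,
        exists! F : set (nat * nat -> R), max_kogan_face (lam m) tau F,
      forall (m : nat) (F : set (nat * nat -> R)),
        max_kogan_face (lam m) tau F ->
        forall (V : vectType R[i]) (rho : 'M[R[i]]_n.+1 -> 'End(V)),
          sl_module rho -> irreducible_module rho ->
          highest_weight rho (m%:R *: omega R[i] n i) ->
          forall D : {vspace V},
            demazure_module rho w (m%:R *: omega R[i] n i) D ->
            same_character rho D F
    & forall F1 : set (nat * nat -> R), max_kogan_face (lam 1%N) tau F1 ->
        exists2 phi : nat * nat -> nat * nat,
          poset_iso (poset_elt i (ell i w)) (defining_poset n F1)
            poset_ge (gtposet_ge n) phi
        & forall (m : nat) (F : set (nat * nat -> R)),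
            max_kogan_face (lam m) tau F ->
            (forall x, ~ defining_poset n F1 x -> constant_on F x) /\
            set_bij F (order_polytope i (ell i w) m)
              (pull_coords (poset_elt i (ell i w)) phi)].
Proof.
move=> tau lam; have maxE m F := max_kogan_faceE (R := R) hi hw hw0 m F.
split=> [m|m F /maxE -> V rho slV irrV hwV D demD mu|F1 /maxE ->].
- exists (tau_face i w m); split; first exact/maxE.
  by move=> F' /maxE.
- rewrite (demazure_dim (le_iN := le_iN hi) mu slV irrV hwV _
    (schubert_row_increasing hi hw) demD) => [|t]; last by rewrite ffunE.
  exact: lattice_points_card.
exists (to_gt n i).
  split; first exact: to_gt_bij.
  by move=> x y Px Py; apply: (to_gt_order hi hw).
move=> m F /maxE ->; split=> [x nx s t Fs Ft|]; last exact: tau_face_order_polytope.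
have nf : ~~ free_vertex i w x by apply/negP => /(defining_posetE R hi hw).
by rewrite (tau_face_fixed hi Fs nf) (tau_face_fixed hi Ft nf).
Qed.
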